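(* There is a randomized polynomial-time $O\left(n \cdot \left(\frac{\log \log n}{\log n}\right)^3\right)$-approximation algorithm for Maximum Balanced Biclique. That is, there are a constant $C > 0$ and a randomized algorithm, running in time polynomial in $n$, that on every input bipartite graph $G = (U, V, E)$ with $|U| = |V| = n \geq 3$ outputs, with high probability, a balanced biclique of $G$ of some size $s$ such that $\mathrm{OPT}(G) \leq C \cdot n \cdot \left(\frac{\log\log n}{\log n}\right)^3 \cdot s$, where $\mathrm{OPT}(G)$ is the maximum size of a balanced biclique in $G$.
   Context: $\log$ denotes the natural logarithm. For a bipartite graph $G = (U, V, E)$ with sides $U, V$ and $E \subseteq U \times V$, a balanced biclique of size $k$ (also called a $k$-biclique, or $K_{k,k}$) is a pair $S \subseteq U$, $T \subseteq V$ with $|S| = |T| = k$ and $S \times T \subseteq E$. The Maximum Balanced Biclique (MBB) problem is: given a bipartite graph $G = (U, V, E)$ with $|U| = |V| = n$, find a balanced biclique in $G$ of maximum size. ''With high probability'' means with probability $1 - o(1)$ as $n \to \infty$ over the algorithm's internal randomness, where $o(1)$ depends only on $n$. *)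

(* Defs.v *)
From HB Require Import structures.
From mathcomp Require Import all_boot all_order all_algebra.
From mathcomp Require Import boolp classical_sets reals topology normedtype.
From mathcomp Require Import sequences exp.

Set Implicit Arguments.
Unset Strict Implicit.
Unset Printing Implicit Defensive.

Import Order.TTheory GRing.Theory Num.Theory.
Import numFieldNormedType.Exports.

(* The bipartite graph (U, V, E) with |U| = |V| = n has both sides numbered by
   'I_n: (u, v) \in E joins the vertex u of U to the vertex v of V. *)

Definition balanced_biclique n (E : {set 'I_n * 'I_n}) (k : nat)
    (S T : {set 'I_n}) : bool :=
  [&& #|S| == k, #|T| == k & [forall u in S, forall v in T, (u, v) \in E]].

Definition OPT n (E : {set 'I_n * 'I_n}) : nat :=
  \max_(k < n.+1 | [exists S, exists T, balanced_biclique E k S T]) k.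

(* Model of computation: structured programs for a random access machine whose
   memory consists of arrays of natural numbers, all cells being 0 unless they
   hold the input. Array names are constants of the program, indices are
   computed. Time is measured by the logarithmic cost criterion: as values are
   charged by their bit length, polynomial time is the same as on a Turing
   machine even though multiplication and division are primitive. *)

Inductive binop := Add | Sub | Mul | Div | Mod | Leq | Eq.

Inductive expr :=
  | Const of nat
  | Read of nat & expr
  | Op of binop & expr & expr.

Inductive cmd :=
  | Skip
  | Write of nat & expr & expr
  | Flip of nat & expr
  | Seq of cmd & cmd
  | If of expr & cmd & cmd
  | While of expr & cmd.

(* [coins] is the unread part of the sequence of random bits. *)
Record state := State { mem : nat -> nat -> nat; coins : nat -> bool }.

Definition update (m : nat -> nat -> nat) (a i v : nat) : nat -> nat -> nat :=
  fun b j => if (b == a) && (j == i) then v else m b j.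

(* [Sub] is truncated; [x %/ 0 = 0] and [x %% 0 = x]. *)
Definition eval_op (o : binop) (x y : nat) : nat :=
  match o with
  | Add => x + y
  | Sub => x - y
  | Mul => x * y
  | Div => x %/ y
  | Mod => x %% y
  | Leq => x <= y
  | Eq => x == y
  end.

Fixpoint eval (m : nat -> nat -> nat) (e : expr) : nat :=
  match e with
  | Const k => k
  | Read a i => m a (eval m i)
  | Op o e1 e2 => eval_op o (eval m e1) (eval m e2)
  end.

Definition bit_length (v : nat) : nat := (trunc_log 2 v).+1.

Fixpoint cost (m : nat -> nat -> nat) (e : expr) : nat :=
  bit_length (eval m e) +
  match e with
  | Const _ => 0
  | Read _ i => cost m i
  | Op _ e1 e2 => cost m e1 + cost m e2
  end.

(* [exec c s s' t]: from state [s], [c] halts in state [s'] after time [t]. *)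
Inductive exec : cmd -> state -> state -> nat -> Prop :=
  | ExecSkip s : exec Skip s s 1
  | ExecWrite a i e s :
      exec (Write a i e) s
        (State (update (mem s) a (eval (mem s) i) (eval (mem s) e)) (coins s))
        (cost (mem s) i + cost (mem s) e).+1
  | ExecFlip a i s :
      exec (Flip a i) s
        (State (update (mem s) a (eval (mem s) i) (coins s 0))
               (fun k => coins s k.+1))
        (cost (mem s) i).+1
  | ExecSeq c1 c2 s1 s2 s3 t1 t2 :
      exec c1 s1 s2 t1 -> exec c2 s2 s3 t2 ->
      exec (Seq c1 c2) s1 s3 (t1 + t2).+1
  | ExecIf e c1 c2 s s' t :
      exec (if eval (mem s) e != 0 then c1 else c2) s s' t ->
      exec (If e c1 c2) s s' (cost (mem s) e + t).+1
  | ExecWhileStop e c s :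
      eval (mem s) e = 0 ->
      exec (While e c) s s (cost (mem s) e).+1
  | ExecWhileStep e c s1 s2 s3 t1 t2 :
      eval (mem s1) e != 0 ->
      exec c s1 s2 t1 -> exec (While e c) s2 s3 t2 ->
      exec (While e c) s1 s3 (cost (mem s1) e + t1 + t2).+1.

(* Input: n in cell 0 of array 0, and the adjacency matrix, row by row, in
   array 1. Output: the indicator vectors of S and T in arrays 2 and 3. *)
Definition input_mem n (E : {set 'I_n * 'I_n}) (a i : nat) : nat :=
  match a with
  | 0 => if i == 0 then n else 0
  | 1 => [exists e in E, i == e.1 * n + e.2]
  | _ => 0
  end.

Definition output_set n (s : state) (a : nat) : {set 'I_n} :=
  [set i : 'I_n | mem s a i != 0].

Definition outputs (A : cmd) n (E : {set 'I_n * 'I_n}) (w : nat -> bool)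
    (S T : {set 'I_n}) : Prop :=
  exists (s : state) (t : nat),
    [/\ exec A (State (input_mem E) w) s t,
        S = output_set n s 2 & T = output_set n s 3].

(* The bound is required for every input graph and every outcome of the coins. *)
Definition runs_in_time (A : cmd) (time : nat -> nat) : Prop :=
  forall n (E : {set 'I_n * 'I_n}) (w : nat -> bool),
    exists (s : state) (t : nat),
      exec A (State (input_mem E) w) s t /\ t <= time n.

Definition polynomially_bounded (f : nat -> nat) : Prop :=
  exists a b : nat, forall n, f n <= a * n ^ b + a.

(* Probability of an event over [m] independent fair coins. For events that
   depend on the first [m] coins only, such as those determined by a run of
   time at most [m], the padding of the sequence is immaterial. *)
Definition coin_prob (R : realType) (m : nat) (event : (nat -> bool) -> Prop) : R :=
  (#|[set r : m.-tuple bool | `[< event (nth false r) >]]|%:R / 2 ^+ m)%R.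

(* Main.v *)
(* Let A x B be a largest balanced biclique, k its size, l = log2 n and
   q = log2 l. One attempt of the algorithm maintains two vertex lists, picks
   random vertices of one list and splits the other list along their
   non-neighbours. Finally it restricts one list to the vertices that miss at
   most a fraction 1/D of the other, picks sigma of them at random and returns
   them together with their common neighbours. All numerical parameters of an
   attempt are guessed, so it suffices that for suitable parameters an attempt
   succeeds with probability at least n^-19: the best of n^20 attempts then
   fails with probability at most 1/(n+1).

   - If k l^3 < n, a single edge is good enough.

   - If n/k is at most of order l/q, take D = sigma = l^3. A walk removes, for
     each chosen vertex, only the first |W|/(2D) of its non-neighbours in W, so
     it can be stopped before W shrinks by more than a factor 2. The potential
     |W cap B| - lambda |W| gains whenever the chosen vertex lies in A, unless
     removed pieces are often rich in B, or many vertices have few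
     non-neighbours in W. In the last case the final stage succeeds; in the
     other cases W or such a piece has a larger density of B, up to a factor
     1 + (density of A)/32, with probability l^-O(1). Alternating the two sides,
     the densities double within O(n/k) phases, and they cannot exceed 1. Hence
     all goes well with probability l^-O(n/k) = n^-O(1).

   - Otherwise take D of order l/q^2 and sigma of order l^2/q^2. With probability
     (k/2n)^O(Dq) = n^-O(1), the first O(Dq) chosen vertices all lie in A, and
     then deleting their non-neighbours keeps B but leaves few vertices with at
     least k/(4D) non-neighbours in A; so many vertices of A have low degree. *)

Require Import Defs.
From HB Require Import structures.
From mathcomp Require Import all_boot all_order all_algebra.
From mathcomp Require Import boolp classical_sets reals topology normedtype.
From mathcomp Require Import sequences exp.
From mathcomp Require Import zify ring lra.

Set Implicit Arguments.
Unset Strict Implicit.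
Unset Printing Implicit Defensive.

Import Order.TTheory GRing.Theory Num.Theory.
Import numFieldNormedType.Exports.

(** * Coin-tossing computations *)

(** Every probability is an average over a finite tree of coin tosses, and every estimate an
    inequality between such averages, proved along the tree; conditioning never occurs. A chain of
    favourable events becomes a chain of lower bounds for the chance of success from the current
    lists ([succ_prob]), each being a hypothesis of the preceding one. Time and correctness are kept
    apart from probability: values stored by assignments are reduced modulo n + 1 and all loops are
    bounded, so the running time is read off the syntax, and the output is a biclique for every
    outcome of the coins. The potential drifts upwards because a vertex of A is adjacent to all of
    B, so the piece it removes misses B. D pieces of size at most |W|/(2D) leave half of W, yet
    suffice to outweigh the initial deficit of the potential. As the potential is at most |W|, a
    large mean forces a denser list with good probability. The number of phases is guessed
    beforehand, whereas lists that suit the final stage may turn up early; a phase must therefore be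
    able to leave everything unchanged. *)

Inductive ctree (X : Type) := Ret of X | Toss of (bool -> ctree X).

Fixpoint bind X Y (t : ctree X) (f : X -> ctree Y) : ctree Y :=
  match t with
  | Ret x => f x
  | Toss g => Toss (fun b => bind (g b) f)
  end.

Fixpoint run X (t : ctree X) (w : nat -> bool) : X * (nat -> bool) :=
  match t with
  | Ret x => (x, w)
  | Toss g => run (g (w 0)) (fun k => w k.+1)
  end.

Fixpoint tosses X (t : ctree X) : nat :=
  match t with
  | Ret _ => 0
  | Toss g => (maxn (tosses (g true)) (tosses (g false))).+1
  end.

Fixpoint rall X (P : X -> Prop) (t : ctree X) : Prop :=
  match t with
  | Ret x => P x
  | Toss g => forall b, rall P (g b)
  end.

(** A coupling of two computations that read the same coins: the trees have the same shape and
    corresponding leaves are related. It carries expectations over from the abstract algorithm to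
    the program. *)
Fixpoint rrel X Y (Q : X -> Y -> Prop) (t : ctree X) (u : ctree Y) : Prop :=
  match t, u with
  | Ret x, Ret y => Q x y
  | Toss g, Toss h => forall b, rrel Q (g b) (h b)
  | _, _ => False
  end.

Fixpoint expect (R : realFieldType) X (t : ctree X) (f : X -> R) : R :=
  match t with
  | Ret x => f x
  | Toss g => (expect (g true) f + expect (g false) f) / 2
  end%R.

Fixpoint iterM X (f : X -> ctree X) (k : nat) (x : X) : ctree X :=
  if k is k'.+1 then bind (f x) (iterM f k') else Ret x.

Lemma run_bind X Y (t : ctree X) (f : X -> ctree Y) w :
  run (bind t f) w = run (f (run t w).1) (run t w).2.
Proof. by elim: t w => [x|g IH] w //=; rewrite IH. Qed.

Lemma rall_run X (P : X -> Prop) (t : ctree X) w : rall P t -> P (run t w).1.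
Proof. by elim: t w => [x|g IH] w //= Pt; apply: IH. Qed.

Lemma rall_bind X Y (P : X -> Prop) (Q : Y -> Prop) t (f : X -> ctree Y) :
  rall P t -> (forall x, P x -> rall Q (f x)) -> rall Q (bind t f).
Proof.
elim: t => [x|g IH] /= Pt PQ; first exact: PQ.
by move=> b; apply: IH.
Qed.

Lemma rall_imp X (P Q : X -> Prop) t :
  (forall x, P x -> Q x) -> rall P t -> rall Q t.
Proof.
move=> PQ; elim: t => [x|g IH] /=; first exact: PQ.
by move=> Pt b; apply: IH.
Qed.

Lemma rallT X (P : X -> Prop) t : (forall x, P x) -> rall P t.
Proof. by move=> PT; elim: t => [x|g IH] //=. Qed.

Lemma rall_and X (P Q : X -> Prop) t :
  rall P t -> rall Q t -> rall (fun x => P x /\ Q x) t.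
Proof.
elim: t => [x|g IH] //= Pt Qt b; exact: IH.
Qed.

Lemma rall_iterM X (P : nat -> X -> Prop) (f : X -> ctree X) k x :
  P k x ->
  (forall j y, j < k -> P j.+1 y -> rall (P j) (f y)) -> rall (P 0) (iterM f k x).
Proof.
elim: k x => [|k IH] x //= Px H.
apply: (@rall_bind _ _ (P k)); first exact: H.
by move=> y Py; apply: IH => // j z ltjk; apply: H; rewrite ltnS ltnW.
Qed.

Lemma tosses_bind X Y (P : X -> Prop) t (f : X -> ctree Y) k :
  rall P t -> (forall x, P x -> tosses (f x) <= k) ->
  tosses (bind t f) <= tosses t + k.
Proof.
elim: t => [x|g IH] /= Pt Pk; first exact: Pk.
by rewrite addSn ltnS geq_max !(leq_trans (IH _ (Pt _) Pk)) //
  leq_add2r ?leq_maxl ?leq_maxr.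
Qed.

Lemma rrel_bind X Y X' Y' (Q : X -> Y -> Prop) (Q' : X' -> Y' -> Prop) t u f g :
  rrel Q t u -> (forall x y, Q x y -> rrel Q' (f x) (g y)) ->
  rrel Q' (bind t f) (bind u g).
Proof.
elim: t u => [x|h IH] [y|h'] //= Qtu QQ'; first exact: QQ'.
by move=> b; apply: IH.
Qed.

Lemma rrel_imp X Y (Q Q' : X -> Y -> Prop) t u :
  (forall x y, Q x y -> Q' x y) -> rrel Q t u -> rrel Q' t u.
Proof.
move=> QQ'; elim: t u => [x|h IH] [y|h'] //= Qtu; first exact: QQ'.
by move=> b; apply: IH.
Qed.

Lemma rrel_andl X Y (Q : X -> Y -> Prop) (P : X -> Prop) t u :
  rrel Q t u -> rall P t -> rrel (fun x y => Q x y /\ P x) t u.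
Proof.
elim: t u => [x|h IH] [y|h'] //= Qtu Pt b; exact: IH.
Qed.

Lemma rrel_andr X Y (Q : X -> Y -> Prop) (P : Y -> Prop) t u :
  rrel Q t u -> rall P u -> rrel (fun x y => Q x y /\ P y) t u.
Proof.
elim: t u => [x|h IH] [y|h'] //= Qtu Pt b; exact: IH.
Qed.

Lemma rrel_rall X Y (Q : X -> Y -> Prop) (P : X -> Prop) t u :
  rrel Q t u -> (forall x y, Q x y -> P x) -> rall P t.
Proof.
elim: t u => [x|h IH] [y|h'] //= Qtu QP; first exact: QP Qtu.
by move=> b; apply: (IH _ (h' b)).
Qed.

Local Open Scope ring_scope.

Lemma expect_bind (R : realFieldType) X Y t (f : X -> ctree Y) (g : Y -> R) :
  expect (bind t f) g = expect t (fun x => expect (f x) g).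
Proof. by elim: t => [x|h IH] //=; rewrite !IH. Qed.

Lemma eq_expect (R : realFieldType) X (t : ctree X) (f g : X -> R) :
  f =1 g -> expect t f = expect t g.
Proof. by move=> fg; elim: t => [x|h IH] //=; rewrite !IH. Qed.

Lemma ler_expect (R : realFieldType) X (P : X -> Prop) t (f g : X -> R) :
  rall P t -> (forall x, P x -> f x <= g x) -> expect t f <= expect t g.
Proof.
elim: t => [x|h IH] /= Pt fg; first exact: fg.
by rewrite ler_pM2r ?invr_gt0 ?ltr0n// lerD ?IH.
Qed.

Lemma ler_expectT (R : realFieldType) X (t : ctree X) (f g : X -> R) :
  (forall x, f x <= g x) -> expect t f <= expect t g.
Proof. by move=> fg; apply: (@ler_expect _ _ (fun=> True)) => //; apply: rallT. Qed.

Lemma ler_expect_rrel (R : realFieldType) X Y (Q : X -> Y -> Prop) t u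
    (f : X -> R) (g : Y -> R) :
  rrel Q t u -> (forall x y, Q x y -> f x <= g y) -> expect t f <= expect u g.
Proof.
elim: t u => [x|h IH] [y|h'] //= Qtu fg; first exact: fg.
by rewrite ler_pM2r ?invr_gt0 ?ltr0n// lerD ?IH.
Qed.

Lemma expectD (R : realFieldType) X (t : ctree X) (f g : X -> R) :
  expect t (fun x => f x + g x) = expect t f + expect t g.
Proof. elim: t => [x|h IH] //=; rewrite !IH; lra. Qed.

Lemma expectZ (R : realFieldType) X (t : ctree X) (c : R) (f : X -> R) :
  expect t (fun x => c * f x) = c * expect t f.
Proof. by elim: t => [x|h IH] //=; rewrite !IH -mulrDr mulrA. Qed.

Lemma expect_cst (R : realFieldType) X (t : ctree X) (c : R) :
  expect t (fun=> c) = c.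
Proof. elim: t => [x|h IH] //=; rewrite !IH; lra. Qed.

Lemma expectB (R : realFieldType) X (t : ctree X) (f g : X -> R) :
  expect t (fun x => f x - g x) = expect t f - expect t g.
Proof. elim: t => [x|h IH] //=; rewrite !IH; lra. Qed.

Lemma expect_sum (R : realFieldType) X I (r : seq I) (t : ctree X) (f : I -> X -> R) :
  expect t (fun x => \sum_(i <- r) f i x) = \sum_(i <- r) expect t (f i).
Proof.
elim: r => [|i r IH].
  by rewrite big_nil -[RHS](expect_cst t); apply: eq_expect => x; rewrite big_nil.
rewrite big_cons -IH -expectD; apply: eq_expect => x; exact: big_cons.
Qed.

Lemma expect_ge0 (R : realFieldType) X (t : ctree X) (f : X -> R) :
  (forall x, 0 <= f x) -> 0 <= expect t f.
Proof. by move=> f0; rewrite -(expect_cst t 0); apply: ler_expectT. Qed.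

(** [iterM] unfolds at its first round, whereas the drift of a walk is estimated at its last
    step. *)
Lemma expect_iterMSr (R : realFieldType) X (f : X -> ctree X) k x (g : X -> R) :
  expect (iterM f k.+1 x) g = expect (iterM f k x) (fun y => expect (f y) g).
Proof.
elim: k x => [|k IH] x; first by rewrite /= expect_bind.
rewrite [iterM f k.+2 x]/= expect_bind [iterM f k.+1 x in RHS]/= expect_bind.
by apply: eq_expect => y; rewrite -IH.
Qed.

(** The first bit splits the bit strings into two halves, one for each subtree. At a leaf that is
    reached early, the remaining bits scale the count and the total by the same power of 2. *)
Lemma coin_prob_run (R : realType) X (t : ctree X) (P : X -> bool) m :
  (tosses t <= m)%N ->
  coin_prob R m (fun w => P (run t w).1) = expect t (fun x => (P x)%:R).
Proof.
elim: m t => [|m IH] [x|g] //= tm.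
- rewrite /coin_prob expr0 divr1; congr (_%:R).
  rewrite (_ : [set _ | _] = [set r : 0.-tuple bool | P x]); last first.
    by apply/setP => r; rewrite !inE asboolb.
  case: (P x).
    rewrite (_ : [set _ | _] = [set: 0.-tuple bool]).
      by rewrite cardsT card_tuple expn0.
    by apply/setP => r; rewrite !inE.
  rewrite (_ : [set _ | _] = finset.set0); first by rewrite cards0.
  by apply/setP => r; rewrite !inE.
- rewrite /coin_prob (_ : [set _ | _] = if P x then [set: m.+1.-tuple bool]
    else finset.set0); last by apply/setP => r; rewrite inE asboolb; case: (P x); rewrite inE.
  case: (P x); last by rewrite cards0 mul0r.
  by rewrite cardsT card_tuple card_bool natrX divff// expf_neq0// pnatr_eq0.
- have tb b : (tosses (g b) <= m)%N.
    by move: tm; rewrite ltnS geq_max => /andP[? ?]; case: b.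
  rewrite -!IH// /coin_prob.
  pose S b := [set r : m.-tuple bool | `[< is_true (P (run (g b) (nth false r)).1) >]].
  rewrite (_ : #|_| = #|S true| + #|S false|)%N; last first.
    pose c b (r : m.-tuple bool) : m.+1.-tuple bool := [tuple of b :: r].
    have cI b : injective (c b) by move=> r1 r2 /(congr1 val)[] /val_inj.
    rewrite -(card_imset (S true) (cI true)) -(card_imset (S false) (cI false)).
    rewrite -cardsUI (_ : _ :&: _ = finset.set0) ?cards0 ?addn0; last first.
      apply/setP => r; rewrite !inE; apply/negP => /andP[/imsetP[r1 _ ->]].
      by move=> /imsetP[r2 _] /(congr1 val).
    congr #|pred_of_set _|; apply/setP => r; rewrite !inE.
    case/tupleP: r => b r /=.
    have cX b1 b2 (r' : m.-tuple bool) : (c b1 r' \in [set c b2 x | x in S b2]) =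
        (b1 == b2) && (r' \in S b2).
      apply/imsetP/andP => [[r1 Sr1] /(congr1 val)[-> /val_inj ->]|[/eqP-> Sr']] //.
      by exists r'.
    rewrite !cX !inE /=; case: b => /=; by rewrite ?orbF.
  rewrite natrD exprS; field; rewrite expf_neq0// pnatr_eq0//.
Qed.

Lemma ler_coin_prob (R : realType) m (P Q : (nat -> bool) -> Prop) :
  (forall w, P w -> Q w) -> coin_prob R m P <= coin_prob R m Q.
Proof.
move=> PQ; rewrite /coin_prob ler_pM2r ?invr_gt0 ?exprn_gt0 ?ltr0n//.
rewrite ler_nat subset_leq_card//; apply/fintype.subsetP => r.
by rewrite inE => /asboolP Pr; rewrite inE; apply/asboolP; exact: PQ.
Qed.

Local Close Scope ring_scope.

(** * A structured language compiled to the machine *)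

Lemma poly_cst c : polynomially_bounded (fun=> c).
Proof. by exists c, 0 => n; rewrite leq_addl. Qed.

Lemma poly_id : polynomially_bounded id.
Proof. by exists 1, 1 => n; rewrite expn1 mul1n leq_addr. Qed.

(** The summand 1 is for n = 0, where n ^ 0 = 1 exceeds n ^ d. *)
Lemma leq_expDl n b d : n ^ b <= n ^ (b + d) + 1.
Proof.
case: n => [|n]; first by apply: (@leq_trans 1); [case: b => [|b] //; rewrite exp0n|exact: leq_addl].
by apply: leq_trans (leq_addr _ _); rewrite leq_pexp2l// leq_addr.
Qed.

Lemma poly_add f g : polynomially_bounded f -> polynomially_bounded g ->
  polynomially_bounded (fun n => f n + g n).
Proof.
move=> [a [b fab]] [c [d gcd]]; exists (2 * (a + c)), (b + d) => n.
have := fab n; have := gcd n; have := leq_expDl n b d; have := leq_expDl n d b.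
rewrite [d + b]addnC; nia.
Qed.

Lemma poly_mul f g : polynomially_bounded f -> polynomially_bounded g ->
  polynomially_bounded (fun n => f n * g n).
Proof.
move=> [a [b fab]] [c [d gcd]]; exists (3 * (a * c)), (b + d) => n.
have h1 := leq_expDl n b d; have h2 := leq_expDl n d b.
rewrite [d + b]addnC in h2.
apply: leq_trans (leq_mul (fab n) (gcd n)) _.
move: h1 h2; rewrite expnD.
move: (n ^ b) (n ^ d) => x y h1 h2.
have -> : (a * x + a) * (c * y + c) = (a * c) * (x * y + x + y + 1) by ring.
have -> : 3 * (a * c) * (x * y) + 3 * (a * c) = (a * c) * (3 * (x * y) + 3) by ring.
by apply: leq_mul => //; lia.
Qed.

Lemma poly_succ f : polynomially_bounded f -> polynomially_bounded (fun n => (f n).+1).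
Proof.
move=> /poly_add/(_ (poly_cst 1))[a [b ab]]; exists a, b => n.
by have := ab n; rewrite addn1.
Qed.

Notation eval := Defs.eval.

Definition memory := nat -> nat -> nat.

Definition var (a : nat) : expr := Read a (Const 0).

(* Cell 0 of array 0 always holds n, so that every stored value is at most n. *)
Definition capped (e : expr) : expr := Op Mod e (Op Add (var 0) (Const 1)).

(* [PFor c e p] counts c down from the value of e to 1; as p must not write to
   c, programs always halt, with a bound that can be read off the syntax. *)
Inductive prog :=
  | PSet of nat & expr & expr
  | PFlip of nat & expr
  | PSeq of prog & prog
  | PIf of expr & prog & prog
  | PFor of nat & expr & prog.

Definition decr (c : nat) : expr := Op Defs.Sub (var c) (Const 1).

Fixpoint compile (p : prog) : cmd :=
  match p with
  | PSet a i e => Write a i (capped e)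
  | PFlip a i => Flip a i
  | PSeq p q => Seq (compile p) (compile q)
  | PIf e p q => If e (compile p) (compile q)
  | PFor c e p =>
      Seq (Write c (Const 0) (capped e))
          (While (var c) (Seq (compile p) (Write c (Const 0) (decr c))))
  end.

(** The compiled loop writes the counter once and decrements it after each round. Writing it at the
    start of each round, and 0 at the end, passes through the same memories. *)
Fixpoint for_loop (c : nat) (f : memory -> ctree memory) (k : nat) (m : memory) :
    ctree memory :=
  if k is k'.+1 then bind (f (update m c 0 k)) (for_loop c f k')
  else Ret (update m c 0 0).

Fixpoint den (p : prog) (m : memory) : ctree memory :=
  match p with
  | PSet a i e => Ret (update m a (eval m i) (eval m (capped e)))
  | PFlip a i => Toss (fun b => Ret (update m a (eval m i) b))
  | PSeq p q => bind (den p m) (den q)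
  | PIf e p q => if eval m e != 0 then den p m else den q m
  | PFor c e p => for_loop c (den p) (eval m (capped e)) m
  end.

Fixpoint writes (p : prog) : seq nat :=
  match p with
  | PSet a _ _ | PFlip a _ => [:: a]
  | PSeq p q | PIf _ p q => writes p ++ writes q
  | PFor c _ p => c :: writes p
  end.

Fixpoint wf (p : prog) : bool :=
  match p with
  | PSet a _ _ | PFlip a _ => a != 0
  | PSeq p q | PIf _ p q => wf p && wf q
  | PFor c _ p => [&& c != 0, c \notin writes p & wf p]
  end.

Definition agree_off (A : seq nat) (m m' : memory) : Prop :=
  forall a j, a \notin A -> m' a j = m a j.

(** The bound is n + 1 instead of n because a coin flip can store 1 when n = 0. *)
Definition bounded (n : nat) (m : memory) : Prop :=
  m 0 0 = n /\ forall a i, m a i <= n.+1.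

Lemma den_PFor c e p m :
  den (PFor c e p) m = for_loop c (den p) (eval m (capped e)) m.
Proof. by []. Qed.

Lemma update_same m a i v : update m a i v a i = v.
Proof. by rewrite /update !eqxx. Qed.

Lemma update_other m a i v b j : b != a -> update m a i v b j = m b j.
Proof. by rewrite /update => /negbTE->. Qed.

Lemma for_loop_rall (P : memory -> memory -> Prop) c f k m :
  (forall m v, P m (update m c 0 v)) ->
  (forall m m' m'', P m m' -> P m' m'' -> P m m'') ->
  (forall m, rall (P m) (f m)) -> rall (P m) (for_loop c f k m).
Proof.
move=> Pu Pt Pf; elim: k m => [|k IH] m /=; first exact: Pu.
apply: (rall_bind (Pf _)) => m' Pm'; apply: rall_imp (IH m') => m'' Pm''.
exact: Pt (Pt _ _ _ (Pu _ _) Pm') Pm''.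
Qed.

Lemma den_agree p m : rall (agree_off (writes p) m) (den p m).
Proof.
elim: p m => [a i e|a i|p IHp q IHq|e p IHp q IHq|c e p IHp] m /=.
- by move=> b j; rewrite inE => ba; rewrite update_other.
- by move=> x b j; rewrite inE => ba; rewrite update_other.
- apply: (rall_bind (IHp m)) => m' mm'; apply: rall_imp (IHq m') => m'' mm'' a j.
  by rewrite mem_cat negb_or => /andP[ap aq]; rewrite mm''// mm'.
- case: ifP => _; [apply: rall_imp (IHp m)|apply: rall_imp (IHq m)] => m' mm' a j;
  by rewrite mem_cat negb_or => /andP[ap aq]; rewrite mm'.
- apply: (@for_loop_rall (agree_off (c :: writes p))).
  + by move=> m1 v a j; rewrite inE negb_or => /andP[ac _]; rewrite update_other.
  + by move=> m1 m2 m3 m12 m23 a j acp; rewrite m23// m12.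
  + move=> m1; apply: rall_imp (IHp m1) => m2 m12 a j.
    by rewrite inE negb_or => /andP[_ ap]; rewrite m12.
Qed.

Lemma eval_capped n m e : bounded n m -> eval m (capped e) = eval m e %% n.+1.
Proof. by case=> m0 _ /=; rewrite m0 addn1. Qed.

Lemma bounded_update n m a i v :
  bounded n m -> a != 0 -> v <= n.+1 -> bounded n (update m a i v).
Proof.
move=> [m0 mb] a0 vn; split; first by rewrite update_other// eq_sym.
by move=> b j; rewrite /update; case: ifP.
Qed.

Lemma eval_capped_le n m e : bounded n m -> eval m (capped e) <= n.
Proof. by move=> bm; rewrite (eval_capped _ bm) -ltnS ltn_mod. Qed.

Lemma den_bounded n p m : wf p -> bounded n m -> rall (bounded n) (den p m).
Proof.
elim: p m => [a i e|a i|p IHp q IHq|e p IHp q IHq|c e p IHp] m wp bm.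
- by apply: bounded_update => //; apply/leqW/(eval_capped_le e bm).
- by move=> b; apply: bounded_update => //; case: b.
- by case/andP: wp => wp wq /=; apply: (rall_bind (IHp m wp bm)) => m'; exact: IHq.
- by case/andP: wp => wp wq /=; case: ifP => _; [exact: IHp|exact: IHq].
- case/and3P: wp => c0 _ wp; rewrite den_PFor.
  have := eval_capped_le e bm; move: (eval _ _) => k kn.
  elim: k kn m bm => [|k IH] kn m bm /=; first exact: bounded_update.
  apply: (@rall_bind _ _ (bounded n)); last by move=> m' bm'; apply: IH => //; lia.
  by apply: IHp => //; apply: bounded_update => //; exact: leqW.
Qed.

(** The product (x + 1)(y + 1) dominates the result of every primitive operation at once, truth
    values included. *)
Fixpoint vbound (e : expr) (n : nat) : nat :=
  match e with
  | Const k => k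
  | Read _ _ => n.+1
  | Op _ e1 e2 => (vbound e1 n).+1 * (vbound e2 n).+1
  end.

Fixpoint cbound (e : expr) (n : nat) : nat :=
  (vbound e n).+1 +
  match e with
  | Const _ => 0
  | Read _ i => cbound i n
  | Op _ e1 e2 => cbound e1 n + cbound e2 n
  end.

Fixpoint tbound (p : prog) (n : nat) : nat :=
  match p with
  | PSet _ i e => (cbound i n + cbound (capped e) n).+1
  | PFlip _ i => (cbound i n).+1
  | PSeq p q => (tbound p n + tbound q n).+1
  | PIf e p q => (cbound e n + (tbound p n + tbound q n)).+1
  | PFor c e p =>
      ((cbound (Const 0) n + cbound (capped e) n).+1 +
       (n * (cbound (var c) n +
         (tbound p n + (cbound (Const 0) n + cbound (decr c) n).+1).+1).+1 +
        (cbound (var c) n).+1)).+1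
  end.

Lemma tbound_PFor c e p n : tbound (PFor c e p) n =
  ((cbound (Const 0) n + cbound (capped e) n).+1 +
   (n * (cbound (var c) n +
     (tbound p n + (cbound (Const 0) n + cbound (decr c) n).+1).+1).+1 +
    (cbound (var c) n).+1)).+1.
Proof. by []. Qed.

Lemma eval_vbound n m e : bounded n m -> eval m e <= vbound e n.
Proof.
move=> [_ mb]; elim: e => [k|a i _|o e1 IH1 e2 IH2] //=.
move: IH1 IH2; move: (eval m e1) (eval m e2) (vbound e1 n) (vbound e2 n) => x y a b xa yb.
have ab : [&& a < a.+1 * b.+1, b < a.+1 * b.+1 & a + b < a.+1 * b.+1].
  by rewrite mulSn mulnS; apply/and3P; split; lia.
have abm : x * y <= a.+1 * b.+1 by apply: leq_mul; exact: leqW.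
move: ab abm; move: (a.+1 * b.+1) => c /and3P[ac bc abc] abm; case: o => /=.
- by lia.
- by lia.
- by [].
- by apply: leq_trans (leq_div _ _) _; lia.
- by apply: leq_trans (leq_mod _ _) _; lia.
- by case: (x <= y); lia.
- by case: (x == y); lia.
Qed.

Lemma cost_cbound n m e : bounded n m -> cost m e <= cbound e n.
Proof.
move=> bm; have bl v : bit_length v <= v.+1.
  rewrite /bit_length ltnS; case: v => [|v]; first by rewrite trunc_log0.
  apply/ltnW; apply: leq_trans (ltn_expl _ (isT : 1 < 2)) _.
  exact: trunc_logP.
elim: e => [k|a i IH|o e1 IH1 e2 IH2].
- by rewrite /= leq_add2r bl.
- rewrite [cost _ _]/= [cbound _ _]/= leq_add// (leq_trans (bl _))// ltnS.
  exact: (eval_vbound (Read a i) bm).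
- rewrite [cost _ _]/= [cbound _ _]/= leq_add ?leq_add// (leq_trans (bl _))// ltnS.
  exact: (eval_vbound (Op o e1 e2) bm).
Qed.

Lemma den_tosses n p m : wf p -> bounded n m -> tosses (den p m) <= tbound p n.
Proof.
elim: p m => [a i e|a i|p IHp q IHq|e p IHp q IHq|c e p IHp] m.
- by [].
- by move=> _ _ /=; rewrite ltnS maxnn.
- move=> /= /andP[wp wq] bm.
  apply: leq_trans (tosses_bind (den_bounded wp bm) (IHq^~ wq)) _.
  by rewrite -addnS leq_add ?IHp.
- move=> /= /andP[wp wq] bm; case: ifP => _.
  + by have := IHp m wp bm; lia.
  + by have := IHq m wq bm; lia.
- move=> /and3P[c0 _ wp] bm; rewrite den_PFor.
  have := eval_capped_le e bm; move: (eval _ _) => k kn.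
  suff : tosses (for_loop c (den p) k m) <= k * tbound p n.
    rewrite tbound_PFor; move: (tbound p n) (tosses _) => T x xk.
    apply: (leq_trans xk); apply: (@leq_trans (n * T)); first by rewrite leq_mul2r kn orbT.
    apply/leqW; apply: leq_trans _ (leq_addl _ _); apply: leq_trans _ (leq_addr _ _).
    by rewrite leq_mul2l; apply/orP; right; lia.
  elim: k kn m bm => [|k IH] kn m bm //=.
  have bk : bounded n (update m c 0 k.+1) by apply: bounded_update => //; exact: leqW.
  apply: leq_trans (tosses_bind (den_bounded wp bk) (IH (ltnW kn))) _.
  by rewrite mulSn leq_add2r IHp.
Qed.

Lemma den_exec n p m w : wf p -> bounded n m ->
  exists t, exec (compile p) (State m w)
      (State (run (den p m) w).1 (run (den p m) w).2) t /\ t <= tbound p n.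
Proof.
elim: p m w => [a i e|a i|p IHp q IHq|e p IHp q IHq|c e p IHp] m w.
- move=> _ bm; eexists; split; first exact: ExecWrite.
  by rewrite [tbound _ _]/= ltnS leq_add ?cost_cbound.
- move=> _ bm; eexists; split; first exact: ExecFlip.
  by rewrite [tbound _ _]/= ltnS cost_cbound.
- move=> /= /andP[wp wq] bm; rewrite run_bind.
  have [t1 [e1 b1]] := IHp m w wp bm.
  have [t2 [e2 b2]] := IHq _ (run (den p m) w).2 wq (rall_run w (den_bounded wp bm)).
  by exists (t1 + t2).+1; split; [exact: ExecSeq e1 e2 | rewrite ltnS leq_add].
- move=> /= /andP[wp wq] bm.
  have Hc := cost_cbound e bm.
  have [t1 [e1 b1]] := IHp m w wp bm; have [t2 [e2 b2]] := IHq m w wq bm.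
  case: ifP => ev.
  + exists (cost m e + t1).+1; split; last by lia.
    by apply: (@ExecIf e (compile p) (compile q) (State m w)); rewrite /= ev.
  + exists (cost m e + t2).+1; split; last by lia.
    by apply: (@ExecIf e (compile p) (compile q) (State m w)); rewrite /= ev.
- move=> /and3P[c0 cp wp] bm; rewrite den_PFor.
  set k := eval m (capped e).
  have kn : k <= n := eval_capped_le e bm.
  have be : cost m (Const 0) + cost m (capped e) <= cbound (Const 0) n + cbound (capped e) n.
    by rewrite leq_add ?cost_cbound.
  (* The induction starts from the memory whose counter already holds k: this is the state of the
     machine at each test of the [While]. *)
  suff [t [et bt]] : exists t, exec (While (var c) (Seq (compile p)
      (Write c (Const 0) (decr c)))) (State (update m c 0 k) w)
      (State (run (for_loop c (den p) k m) w).1 (run (for_loop c (den p) k m) w).2) t /\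
      t <= k * (cbound (var c) n +
         (tbound p n + (cbound (Const 0) n + cbound (decr c) n).+1).+1).+1 +
        (cbound (var c) n).+1.
    exists ((cost m (Const 0) + cost m (capped e)).+1 + t).+1; split.
      apply: ExecSeq et; exact: (ExecWrite c (Const 0) (capped e) (State m w)).
    rewrite tbound_PFor ltnS; apply: leq_add => //; apply: leq_trans bt _.
    by rewrite leq_add2r leq_mul2r kn orbT.
  clear be; clearbody k; elim: k kn m w bm => [|k IH] kn m w bm.
    exists (cost (update m c 0 0) (var c)).+1; split.
      by apply: ExecWhileStop; rewrite /= update_same.
    by rewrite mul0n add0n ltnS cost_cbound//; apply: bounded_update.
  have bk : bounded n (update m c 0 k.+1) by apply: bounded_update => //; exact: leqW.
  have [t1 [e1 b1]] := IHp _ w wp bk.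
  rewrite [for_loop _ _ _ _]/= run_bind; set r := run (den p _) w in e1 *.
  have br : bounded n r.1 := rall_run w (den_bounded wp bk).
  have rc : r.1 c 0 = k.+1.
    by rewrite (rall_run w (den_agree p (update m c 0 k.+1)))// update_same.
  have [t2 [e2 b2]] := IH (ltnW kn) r.1 r.2 br.
  have ed : eval r.1 (decr c) = k by rewrite /= rc subn1.
  exists (cost (update m c 0 k.+1) (var c) +
    (t1 + (cost r.1 (Const 0) + cost r.1 (decr c)).+1).+1 + t2).+1; split.
    apply: (@ExecWhileStep _ _ (State _ w) (State (update r.1 c 0 k) r.2)) e2.
      by rewrite /= update_same.
    apply: ExecSeq e1 _; rewrite -[X in update _ _ _ X]ed.
    exact: (ExecWrite c (Const 0) (decr c) (State r.1 r.2)).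
  have := cost_cbound (var c) bk; have := cost_cbound (decr c) br.
  have := cost_cbound (Const 0) br; move: b1 b2.
  rewrite mulSn; move: (k * _) => K; lia.
Qed.

Lemma poly_vbound e : polynomially_bounded (vbound e).
Proof.
elim: e => [k|a i _|o e1 IH1 e2 IH2] /=; first exact: poly_cst.
- exact/poly_succ/poly_id.
- by apply: poly_mul; apply: poly_succ.
Qed.

Lemma poly_cbound e : polynomially_bounded (cbound e).
Proof.
elim: e => [k|a i IH|o e1 IH1 e2 IH2].
- by apply: poly_add; [exact/poly_succ/(poly_vbound (Const k))|exact: poly_cst].
- by apply: poly_add => //; exact/poly_succ/(poly_vbound (Read a i)).
- by apply: poly_add; [exact/poly_succ/(poly_vbound (Op o e1 e2))|exact: poly_add].
Qed.

Lemma poly_tbound p : polynomially_bounded (tbound p).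
Proof.
elim: p => [a i e|a i|p IHp q IHq|e p IHp q IHq|c e p IHp].
- by apply: poly_succ; apply: poly_add; exact: poly_cbound.
- by apply: poly_succ; exact: poly_cbound.
- by apply: poly_succ; exact: poly_add.
- by apply: poly_succ; apply: poly_add; [exact: poly_cbound|exact: poly_add].
- apply: poly_succ; apply: poly_add.
    by apply: poly_succ; apply: poly_add; exact: poly_cbound.
  apply: poly_add; last by apply: poly_succ; exact: poly_cbound.
  apply: poly_mul; first exact: poly_id.
  apply: poly_succ; apply: poly_add; first exact: poly_cbound.
  apply: poly_succ; apply: poly_add => //.
  by apply: poly_succ; apply: poly_add; exact: poly_cbound.
Qed.

(** * The algorithm *)

Notation LST := 4 (only parsing).
Notation CNT := 5 (only parsing).
Notation MARK := 6 (only parsing).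
Notation BEST := 7 (only parsing).
Notation ACC := 10 (only parsing).
Notation MODULUS := 11 (only parsing).
Notation RCTR := 12 (only parsing).
Notation BIT := 13 (only parsing).
Notation SIDE := 14 (only parsing).
Notation PICKED := 15 (only parsing).
Notation CAP := 16 (only parsing).
Notation REMOVED := 17 (only parsing).
Notation KEPT := 18 (only parsing).
Notation KEEP := 19 (only parsing).
Notation COUNT := 20 (only parsing).
Notation STEPCTR := 21 (only parsing).
Notation DIVISOR := 22 (only parsing).
Notation SIGMA := 23 (only parsing).
Notation CUR := 24 (only parsing).
Notation DISTINCT := 25 (only parsing).
Notation FLAG := 26 (only parsing).
Notation DEG := 27 (only parsing).
Notation PHASECTR := 28 (only parsing).
Notation SCANCTR := 29 (only parsing).
Notation OUTERCTR := 30 (only parsing).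
Notation TAU := 31 (only parsing).
Notation PHASES := 32 (only parsing).

Definition Z0 := Const 0.
Definition set_var (a : nat) (e : expr) : prog := PSet a Z0 e.
Definition eadd := Op Add.
Definition esub := Op Defs.Sub.
Definition emul := Op Mul.
Definition eleq := Op Leq.
Definition eeq := Op Eq.
Definition size_in : expr := var 0.
Definition this_side : expr := var SIDE.
Definition other_side : expr := esub (Const 1) (var SIDE).
Definition cell (s j : expr) : expr := eadd (emul s size_in) j.
(** Expressions have no conditional, so multiplication by the two side bits selects the matrix
    entry; the row always belongs to U. *)
Definition non_adjacent (x v : expr) : expr :=
  eeq (Read 1 (eadd (emul (eadd (emul x size_in) v) other_side)
                    (emul (eadd (emul v size_in) x) this_side))) Z0.

(** Horner's scheme reduces the random n-bit number at every bit, because the whole number would not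
    survive the capping of stored values. *)
Definition p_rnd (e : expr) : prog :=
  PSeq (set_var MODULUS e) (PSeq (set_var ACC Z0)
    (PFor RCTR size_in (PSeq (PFlip BIT Z0)
      (set_var ACC (Op Mod (eadd (emul (Const 2) (var ACC)) (var BIT)) (var MODULUS)))))).

(** The second factor turns the pick from an empty list into vertex 0, so that stale cells of the
    list are never returned. *)
Definition p_pick : prog :=
  PSeq (p_rnd (Read CNT this_side))
    (set_var PICKED (emul (Read LST (cell this_side (var ACC)))
                          (eleq (Const 1) (Read CNT this_side)))).

(** Compaction in place: the current element is always copied to position [KEPT], which never
    overtakes the reading position, and [KEPT] advances only if the element stays. *)
Definition p_split_body : prog :=
  PSeq (set_var CUR (Read LST (cell other_side (esub (Read CNT other_side) (var SCANCTR)))))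
  (PSeq (set_var FLAG (emul (non_adjacent (var PICKED) (var CUR))
                            (eleq (eadd (var REMOVED) (Const 1)) (var CAP))))
  (PSeq (set_var REMOVED (eadd (var REMOVED) (var FLAG)))
  (PSeq (PSet LST (cell other_side (var KEPT)) (var CUR))
        (set_var KEPT (eadd (var KEPT) (eeq (var FLAG) (var KEEP))))))).

Definition p_split : prog :=
  PSeq (set_var KEPT Z0) (PSeq (set_var REMOVED Z0)
    (PSeq (PFor SCANCTR (Read CNT other_side) p_split_body)
          (PSet CNT other_side (var KEPT)))).

Definition p_clear : prog :=
  PSeq (PFor SCANCTR size_in (PSet MARK (decr SCANCTR) Z0)) (set_var DISTINCT Z0).

Definition p_step : prog :=
  PSeq p_pick
    (PSeq (set_var DISTINCT (eadd (var DISTINCT) (eeq (Read MARK (var PICKED)) Z0)))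
      (PSeq (PSet MARK (var PICKED) (Const 1)) p_split)).

Definition p_steps : prog := PSeq p_clear (PFor STEPCTR (var COUNT) p_step).

Definition p_degree : prog :=
  PFor SCANCTR (Read CNT other_side)
    (set_var DEG (eadd (var DEG)
      (non_adjacent (var CUR) (Read LST (cell other_side (decr SCANCTR)))))).

Definition p_filter_body : prog :=
  PSeq (set_var CUR (Read LST (cell this_side (esub (Read CNT this_side) (var OUTERCTR)))))
  (PSeq (set_var DEG Z0) (PSeq p_degree
  (PSeq (PSet LST (cell this_side (var KEPT)) (var CUR))
        (set_var KEPT (eadd (var KEPT)
          (eleq (emul (var DIVISOR) (var DEG)) (Read CNT other_side))))))).

Definition p_filter : prog :=
  PSeq (set_var KEPT Z0) (PSeq (PFor OUTERCTR (Read CNT this_side) p_filter_body)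
    (PSet CNT this_side (var KEPT))).

Definition p_init : prog :=
  PSeq (PFor SCANCTR size_in
    (PSeq (PSet LST (decr SCANCTR) (decr SCANCTR))
          (PSet LST (eadd size_in (decr SCANCTR)) (decr SCANCTR))))
  (PSeq (PSet CNT Z0 size_in) (PSet CNT (Const 1) size_in)).

Definition p_phase : prog :=
  PSeq (PFlip SIDE Z0) (PSeq (set_var KEEP Z0)
  (PSeq (set_var CAP (Op Div (Read CNT other_side) (emul (Const 2) (var DIVISOR))))
  (PSeq (p_rnd (eadd (var DIVISOR) (Const 1)))
  (PSeq (set_var COUNT (var ACC)) (PSeq p_steps
  (PSeq (PFlip COUNT Z0) (PSeq (set_var KEEP (Const 1)) p_steps))))))).

Definition p_final : prog :=
  PSeq (PFlip SIDE Z0) (PSeq p_filter (PSeq (set_var KEEP Z0)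
  (PSeq (set_var CAP size_in) (PSeq (set_var COUNT (var SIGMA)) p_steps)))).

Definition p_output (a b : nat) : prog :=
  PSeq (PFor SCANCTR size_in
    (PSeq (PSet a (decr SCANCTR) (Read MARK (decr SCANCTR))) (PSet b (decr SCANCTR) Z0)))
  (PFor SCANCTR (var SIGMA)
    (PSet b (Read LST (cell other_side (decr SCANCTR))) (Const 1))).

(** Requiring sigma different picks makes the two sides equally large, as the common neighbours can
    be cut down to sigma. The last branch assigns [BEST] to itself because [prog] has no skip. *)
Definition p_accept : prog :=
  PIf (emul (eleq (var SIGMA) (var DISTINCT))
        (emul (eleq (var SIGMA) (Read CNT other_side))
              (eleq (eadd (var BEST) (Const 1)) (var SIGMA))))
    (PSeq (set_var BEST (var SIGMA)) (PIf this_side (p_output 3 2) (p_output 2 3)))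
    (set_var BEST (var BEST)).

Definition p_param (a : nat) : prog := PSeq (p_rnd size_in) (set_var a (var ACC)).

Definition p_setup : prog :=
  PSeq p_init
  (PSeq (p_param TAU) (PSeq (p_param PHASES) (PSeq (p_param DIVISOR) (PSeq (p_param SIGMA)
  (PSeq (set_var SIDE Z0) (PSeq (set_var KEEP Z0) (PSeq (set_var CAP size_in)
        (set_var COUNT (var TAU))))))))).

(** One program serves all regimes: [TAU] = 0 makes the uncapped initial walk void, and [PHASES] = 0
    does the same for the capped ones. *)
Definition p_path : prog :=
  PSeq p_setup (PSeq p_steps
    (PSeq (PFor PHASECTR (var PHASES) p_phase) (PSeq p_final p_accept))).

(* Runs n^k attempts. *)
Fixpoint p_repeat (k : nat) : prog :=
  if k is k'.+1 then PFor (100 + k) size_in (p_repeat k') else p_path.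

Lemma wf_main : wf (p_repeat 20).
Proof. by []. Qed.

(* The abstract counterpart of the program: the segments of array LST become
   lists. The value of n random bits modulo m is uniform up to a factor 2. *)
Definition rnd (n m : nat) : ctree nat :=
  iterM (fun acc => Toss (fun b : bool => Ret (((2 * acc + b) %% m) %% n.+1))) n 0.

Definition pick (n : nat) (Z : seq nat) : ctree nat :=
  bind (rnd n (size Z)) (fun i => Ret (nth 0 Z i * (0 < size Z))).

(* Splits W along f, but puts only the first [cap] elements satisfying f in the
   part [h = true]. *)
Fixpoint split_seq (f : pred nat) (cap : nat) (h : bool) (W : seq nat) : seq nat :=
  if W is v :: W' then
    let a := f v && (0 < cap) in
    let r := split_seq f (cap - a) h W' in if a == h then v :: r else r
  else [::].

Definition sides := (seq nat * seq nat)%type.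
Definition chooser (o : bool) (L : sides) : seq nat := if o then L.2 else L.1.
Definition target (o : bool) (L : sides) : seq nat := if o then L.1 else L.2.
Definition set_target (o : bool) (L : sides) (W : seq nat) : sides :=
  if o then (W, L.2) else (L.1, W).

(* [A] is the adjacency matrix, row by row; [o] tells on which side x lies. *)
Definition nonadj (n : nat) (A : nat -> nat) (o : bool) (x v : nat) : bool :=
  A (if o then v * n + x else x * n + v) == 0.

(* The second component records the chosen vertices. *)
Definition step (n : nat) (A : nat -> nat) (o h : bool) (cap : nat) (Z : seq nat)
    (y : seq nat * seq nat) : ctree (seq nat * seq nat) :=
  bind (pick n Z) (fun x => Ret (split_seq (nonadj n A o x) cap h y.1, x :: y.2)).

Definition steps n A o h cap Z c (W : seq nat) :=
  iterM (step n A o h cap Z) c (W, [::]).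

(* Random walk of c steps, ending with a coin flip: if it comes up true, W is
   replaced by one of the pieces that the next step would remove. *)
Definition phase (n : nat) (A : nat -> nat) (D : nat) (L : sides) : ctree sides :=
  Toss (fun o =>
    let cap := size (target o L) %/ (2 * D) in
    bind (rnd n D.+1) (fun c =>
    bind (steps n A o false cap (chooser o L) c (target o L)) (fun y =>
    Toss (fun b : bool =>
    bind (steps n A o true cap (chooser o L) b y.1) (fun y' =>
    Ret (set_target o L y'.1)))))).

Definition low_degree n A o D (Z W : seq nat) : seq nat :=
  [seq u <- Z | D * count (nonadj n A o u) W <= size W].

Definition final n A D sigma (L : sides) : ctree (bool * (seq nat * seq nat)) :=
  Toss (fun o =>
    bind (steps n A o false n (low_degree n A o D (chooser o L) (target o L))
            sigma (target o L))
         (fun y => Ret (o, y))).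

Definition setup n : ctree ((nat * nat) * (nat * nat)) :=
  bind (rnd n n) (fun tau => bind (rnd n n) (fun J =>
  bind (rnd n n) (fun D => bind (rnd n n) (fun sigma => Ret ((tau, J), (D, sigma)))))).

Definition explore n A (q : (nat * nat) * (nat * nat)) :
    ctree (bool * (seq nat * seq nat)) :=
  bind (steps n A false false n (iota 0 n) q.1.1 (iota 0 n)) (fun y =>
  bind (iterM (phase n A q.2.1) q.1.2 (iota 0 n, y.1)) (fun L =>
  final n A q.2.1 q.2.2 L)).

Definition attempt n A : ctree (nat * (bool * (seq nat * seq nat))) :=
  bind (setup n) (fun q => bind (explore n A q) (fun r => Ret (q.2.2, r))).

Definition accepted (r : nat * (bool * (seq nat * seq nat))) : bool :=
  (r.1 <= size (undup r.2.2.2)) && (r.1 <= size r.2.2.1).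

(** * The program implements the abstract algorithm *)

(** Marks the deterministic stretches of the program; they toss no coin and so leave no trace in the
    shape of the abstract tree. *)
Definition pure (P : memory -> Prop) (t : ctree memory) : Prop :=
  if t is Ret m then P m else False.

Lemma pure_bind P Q t f :
  pure P t -> (forall m, P m -> pure Q (f m)) -> pure Q (bind t f).
Proof. by case: t => [m|g] //= Pm; apply. Qed.

Lemma pure_imp (P Q : memory -> Prop) t : (forall m, P m -> Q m) -> pure P t -> pure Q t.
Proof. by move=> PQ; case: t => //= m; apply: PQ. Qed.

Lemma pure_rall (P Q : memory -> Prop) t : rall P t -> pure Q t -> pure (fun m => P m /\ Q m) t.
Proof. by case: t. Qed.

Lemma pure_rrel X Y (P : memory -> Prop) (Q : X -> Y -> Prop) t f u :
  pure P t -> (forall m, P m -> rrel Q (f m) u) -> rrel Q (bind t f) u.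
Proof. by case: t => [m|g] //= Pm; apply. Qed.

Lemma pure_frame n p m P : wf p -> bounded n m -> pure P (den p m) ->
  pure (fun m' => [/\ bounded n m', agree_off (writes p) m m' & P m']) (den p m).
Proof.
move=> wp bm Pp.
apply: pure_imp (pure_rall (rall_and (den_bounded wp bm) (den_agree p m)) Pp).
by move=> m' [[]].
Qed.

Lemma agree_trans A m m' m'' :
  agree_off A m m' -> agree_off A m' m'' -> agree_off A m m''.
Proof. by move=> h h' a j aA; rewrite h'// h. Qed.

Lemma agree_sub A B m m' : {subset A <= B} -> agree_off A m m' -> agree_off B m m'.
Proof. by move=> AB h a j aB; apply: h; apply: contra aB; exact: AB. Qed.

Lemma agree_update A m a i v : a \in A -> agree_off A m (update m a i v).
Proof.
by move=> aA b j bA; rewrite update_other//; apply: contraNneq bA => ->.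
Qed.

Lemma for_pure n (I : nat -> memory -> Prop) c p k m :
  c != 0 -> c \notin writes p -> wf p -> bounded n m -> k <= n ->
  I k m ->
  (forall j m' v, v <= n.+1 -> I j m' -> I j (update m' c 0 v)) ->
  (forall j m', j < k -> bounded n m' -> agree_off (c :: writes p) m m' ->
     m' c 0 = j.+1 -> I j.+1 m' -> pure (I j) (den p m')) ->
  pure (fun m' => [/\ bounded n m', agree_off (c :: writes p) m m' & I 0 m'])
    (for_loop c (den p) k m).
Proof.
move=> c0 cp wp bm kn Ik Iu Ip.
suff H m' : bounded n m' -> agree_off (c :: writes p) m m' -> I k m' ->
    pure (fun m' => [/\ bounded n m', agree_off (c :: writes p) m m' & I 0 m'])
      (for_loop c (den p) k m') by apply: H.
have cin : c \in c :: writes p by rewrite mem_head.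
elim: k kn m' {Ik} Ip => [|k IH] kn m' Ip bm' mm' Ik /=.
  split; [exact: bounded_update|exact: agree_trans mm' (agree_update _ _ _ cin)|exact: Iu].
have bk : bounded n (update m' c 0 k.+1) by apply: bounded_update => //; exact: leqW.
have ak := agree_trans mm' (agree_update m' 0 k.+1 cin).
have := Ip k (update m' c 0 k.+1) (ltnSn k) bk ak (update_same _ _ _ _) (Iu _ _ _ (leqW kn) Ik).
move/(pure_frame wp bk)/pure_bind; apply => m'' [bm'' am'' Im''].
apply: IH => //; first exact: ltnW.
  by move=> j m1 jk; apply: Ip; exact: leqW.
by apply: agree_trans ak _; apply: agree_sub am'' => a ap; rewrite inE ap orbT.
Qed.

Lemma for_rrel n Y (I : nat -> memory -> Y -> Prop) (g : Y -> ctree Y) c p k m y :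
  c != 0 -> c \notin writes p -> wf p -> bounded n m -> k <= n ->
  I k m y ->
  (forall j m' y v, v <= n.+1 -> I j m' y -> I j (update m' c 0 v) y) ->
  (forall j m' y, j < k -> bounded n m' -> agree_off (c :: writes p) m m' ->
     m' c 0 = j.+1 -> I j.+1 m' y -> rrel (I j) (den p m') (g y)) ->
  rrel (fun m' y => [/\ bounded n m', agree_off (c :: writes p) m m' & I 0 m' y])
    (for_loop c (den p) k m) (iterM g k y).
Proof.
move=> c0 cp wp bm kn Ik Iu Ip.
suff H m' : bounded n m' -> agree_off (c :: writes p) m m' -> I k m' y ->
    rrel (fun m' y => [/\ bounded n m', agree_off (c :: writes p) m m' & I 0 m' y])
      (for_loop c (den p) k m') (iterM g k y) by apply: H.
have cin : c \in c :: writes p by rewrite mem_head.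
elim: k y kn m' {Ik} Ip => [|k IH] y kn m' Ip bm' mm' Ik /=.
  split; [exact: bounded_update|exact: agree_trans mm' (agree_update _ _ _ cin)|exact: Iu].
have bk : bounded n (update m' c 0 k.+1) by apply: bounded_update => //; exact: leqW.
have ak := agree_trans mm' (agree_update m' 0 k.+1 cin).
have := Ip k (update m' c 0 k.+1) y (ltnSn k) bk ak (update_same _ _ _ _) (Iu _ _ _ _ (leqW kn) Ik).
move=> /rrel_andl/(_ (den_bounded wp bk))/rrel_andl/(_ (den_agree _ _))/rrel_bind; apply.
move=> m'' y'' [[Im'' bm''] am''].
apply: IH => //; first exact: ltnW.
  by move=> j m1 y1 jk; apply: Ip; exact: leqW.
by apply: agree_trans ak _; apply: agree_sub am'' => a ap; rewrite inE ap orbT.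
Qed.

Definition seg n (m : memory) (o : bool) (L : seq nat) : Prop :=
  m CNT o = size L /\ forall t, t < size L -> m LST (o * n + t) = nth 0 L t.

Definition valid n (L : seq nat) : bool := uniq L && all (fun v => v < n) L.

Definition rep n (A : nat -> nat) (m : memory) (L : sides) : Prop :=
  [/\ bounded n m, forall j, m 1 j = A j, seg n m false L.1, seg n m true L.2
    & valid n L.1 && valid n L.2].

Lemma valid_size n L : valid n L -> size L <= n.
Proof.
case/andP=> uL /allP Ln; rewrite -(size_iota 0 n) uniq_leq_size// => v /Ln.
by rewrite mem_iota.
Qed.

Lemma valid_nth n L t : valid n L -> t < size L -> nth 0 L t < n.
Proof. by case/andP=> _ /all_nthP; apply. Qed.

Lemma rep_seg n A m L o : rep n A m L -> seg n m o (chooser o L).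
Proof. by case: o => -[]. Qed.

Lemma rep_valid n A m L o : rep n A m L -> valid n (chooser o L).
Proof. by case: o => -[_ _ _ _ /andP[]]. Qed.

Lemma target_chooser o L : target o L = chooser (~~ o) L.
Proof. by case: o. Qed.

Lemma seg_agree n m m' o L B : agree_off B m m' -> LST \notin B -> CNT \notin B ->
  seg n m o L -> seg n m' o L.
Proof. by move=> mm' lB cB [h1 h2]; split=> [|t tL]; rewrite mm'// h2. Qed.

Lemma rep_agree n A m m' L B : agree_off B m m' -> bounded n m' ->
  all (fun a => a \notin B) [:: 1; LST; CNT] -> rep n A m L -> rep n A m' L.
Proof.
move=> mm' bm' /and4P[B1 B4 B5 _] [bm mA s1 s2 v].
by split=> //; [move=> j; rewrite mm'|apply: seg_agree mm' _ _ s1|apply: seg_agree mm' _ _ s2].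
Qed.

Lemma eval_non_adjacent (n : nat) (A : nat -> nat) (m : memory) (o : bool) ex ev :
  m 0 0 = n -> m SIDE 0 = o -> (forall j, m 1 j = A j) ->
  eval m (non_adjacent ex ev) = nonadj n A o (eval m ex) (eval m ev).
Proof.
move=> m0 ms mA; rewrite /nonadj /= m0 ms mA; congr (nat_of_bool (A _ == 0)).
by case: o {ms}; rewrite /nat_of_bool ?subn0 ?subnn ?muln1 ?muln0 ?addn0 ?add0n.
Qed.

Lemma eval_this (m : memory) (o : bool) : m SIDE 0 = o -> eval m this_side = o.
Proof. exact. Qed.

Lemma eval_other (m : memory) (o : bool) : m SIDE 0 = o -> eval m other_side = ~~ o.
Proof. by move=> ms; rewrite /= ms; case: o {ms}. Qed.

Lemma eval_read m a e : eval m (Read a e) = m a (eval m e). Proof. by []. Qed.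

Lemma den_PSet n m a i e v : bounded n m -> eval m e = v -> v <= n ->
  den (PSet a i e) m = Ret (update m a (eval m i) v).
Proof.
move=> bm ev vn.
have /= -> := eval_capped e bm; by rewrite ev modn_small.
Qed.

Lemma den_seq_set n m a i e k v p : bounded n m -> eval m i = k -> eval m e = v ->
  v <= n -> den (PSeq (PSet a i e) p) m = den p (update m a k v).
Proof.
move=> bm ei ev vn; rewrite -[LHS]/(bind (den (PSet a i e) m) (den p)).
by rewrite (den_PSet a i bm ev vn) /= ei.
Qed.

Lemma cell_neq n (o : bool) t t' : t < n -> t' < n -> (o * n + t == ~~ o * n + t') = false.
Proof. by move=> tn tn'; apply/eqP; case: o => /=; lia. Qed.

Lemma cell_eq n (o : bool) t t' : (o * n + t == o * n + t') = (t == t').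
Proof. by rewrite eqn_add2l. Qed.

Lemma size_split_seq f cap h W : size (split_seq f cap h W) <= size W.
Proof. elim: W cap => //= v W IH cap; case: ifP => _ /=; [exact: IH|exact: leqW]. Qed.

Lemma split_seq_subseq f cap h W : subseq (split_seq f cap h W) W.
Proof.
elim: W cap => // v W IH cap; rewrite [split_seq _ _ _ _]/=.
case: ifP => _; first by rewrite /= eqxx.
by apply: subseq_trans (IH _) _; exact: subseq_cons.
Qed.

Lemma split_seq_valid n f cap h W : valid n W -> valid n (split_seq f cap h W).
Proof.
case/andP=> uW Wn; have s := split_seq_subseq f cap h W.
rewrite /valid (subseq_uniq s uW); apply/allP => v /(mem_subseq s) vW.
exact: (allP Wn).
Qed.

Lemma rep_set_target n A m L o W' : bounded n m -> (forall j, m 1 j = A j) ->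
  seg n m o (chooser o L) -> seg n m (~~ o) W' -> valid n (chooser o L) ->
  valid n W' -> rep n A m (set_target o L W').
Proof. by case: o => bm mA s1 s2 /= v1 v2; split=> //=; rewrite v1 v2. Qed.

Ltac unfold_mem :=
  repeat match goal with |- context [?v ?a ?j] => is_var v; progress (unfold v) end.

Ltac mem_simpl := repeat (progress (unfold_mem; rewrite ?update_same ?update_other//)).

Lemma den_split n A m L (o h : bool) :
  rep n A m L -> m SIDE 0 = o -> m KEEP 0 = h -> 
  pure (fun m' => [/\ rep n A m' (set_target o L
     (split_seq (nonadj n A o (m PICKED 0)) (m CAP 0) h (target o L))) &
     agree_off (writes p_split) m m']) (den p_split m).
Proof.
move=> rm ms mh; have [bm mA _ _ _] := rm; have [m0 _] := bm.
set W := target o L; set f := nonadj n A o _; set cap := m CAP 0.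
have sW : seg n m (~~ o) W by rewrite /W target_chooser; exact: rep_seg rm.
have vW : valid n W by rewrite /W target_chooser; exact: rep_valid rm.
have sWn := valid_size vW.
have [sZ1 sZ2] := rep_seg o rm.
have vZ := rep_valid o rm; have sZn := valid_size vZ.
have aw a j : a != KEPT -> a != REMOVED ->
    update (update m KEPT 0 0) REMOVED 0 0 a j = m a j.
  by move=> ak ar; rewrite !update_other.
set m1 := update (update m KEPT 0 0) REMOVED 0 0 in aw.
have bm1 : bounded n m1 by do 2!apply: bounded_update => //.
have -> : den p_split m = bind (for_loop SCANCTR (den p_split_body) (size W) m1)
    (den (PSet CNT other_side (var KEPT))).
  have -> : size W = eval m1 (capped (Read CNT other_side)).
    rewrite (eval_capped _ bm1) eval_read (eval_other (o := o)) ?aw// sW.1.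
    by rewrite modn_small.
  rewrite /p_split /set_var (den_seq_set (k := 0) (v := 0) _ _ bm)//.
  by rewrite (@den_seq_set n _ _ _ _ 0 0)//; apply: bounded_update.
(* With j elements unread, P is the part kept so far and r the number of elements put into the
   removed piece, so the rest is split with cap [cap - r]. The unread cells are intact since P is no
   longer than the part already read. *)
pose I j m' := exists P r,
  [/\ split_seq f cap h W = P ++ split_seq f (cap - r) h (drop (size W - j) W),
    size P <= size W - j & r <= size W - j] /\
  [/\ m' KEPT 0 = size P, m' REMOVED 0 = r,
      forall t, t < size P -> m' LST (~~ o * n + t) = nth 0 P t,
      forall t, size W - j <= t < size W -> m' LST (~~ o * n + t) = nth 0 W t &
      forall t, t < n -> m' LST (o * n + t) = m LST (o * n + t)].
apply: (@pure_bind (fun m' => [/\ bounded n m',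
    agree_off (SCANCTR :: writes p_split_body) m1 m' & I 0 m'])).
  apply: for_pure => //.
  - exists [::], 0; split; first by rewrite subnn drop0 subn0.
    by split=> // t; rewrite subnn => /sW.2 <-; rewrite aw.
  move=> j m' jW bm' am' m'c [P [r [[E1 E2 E3] [H2 H3 H4 H5 H6]]]].
  have n0 : 0 < n by lia.
  set i := size W - j.+1 in E1 E2 E3 H5.
  have iW : i < size W by rewrite /i; lia.
  have ij : size W - j = i.+1 by rewrite /i; lia.
  have ms' : m' SIDE 0 = o by rewrite am'// aw.
  have m0' : m' 0 0 = n by case: bm'.
  have oth : eval m' other_side = ~~ o by exact: eval_other.
  have cnt' : m' CNT (~~ o) = size W by rewrite am'// aw// sW.1.
  have Ec : eval m' (Read LST (cell other_side (esub (Read CNT other_side) (var SCANCTR)))) =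
      nth 0 W i.
    rewrite eval_read /cell /eadd /emul /esub -[eval _ (Op _ _ _)]/(eval m' other_side * m' 0 0 + (m' CNT (eval m' other_side) - m' SCANCTR 0)).
    by rewrite oth m0' cnt' m'c -/i H5// leqnn.
  have vi : nth 0 W i < n := valid_nth vW iW.
  rewrite /p_split_body /set_var.
  set m2 := update m' CUR 0 (nth 0 W i).
  have bm2 : bounded n m2 by apply: bounded_update => //; lia.
  set a := f (nth 0 W i) && (0 < cap - r).
  have Ef : eval m2 (emul (non_adjacent (var PICKED) (var CUR))
        (eleq (eadd (var REMOVED) (Const 1)) (var CAP))) = a.
    rewrite /emul -[LHS]/(eval m2 (non_adjacent (var PICKED) (var CUR)) *
      (m2 REMOVED 0 + 1 <= m2 CAP 0)).
    rewrite (eval_non_adjacent (n := n) (A := A) (o := o)) ?update_other//; last first.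
      by move=> k; mem_simpl; rewrite am'// aw.
    rewrite -[eval m2 (var PICKED)]/(m2 PICKED 0) -[eval m2 (var CUR)]/(m2 CUR 0).
    rewrite (_ : m2 PICKED 0 = m PICKED 0); last by (mem_simpl; rewrite am'// aw).
    rewrite (_ : m2 CUR 0 = nth 0 W i); last by (mem_simpl).
    rewrite (_ : m2 REMOVED 0 = r); last by (mem_simpl).
    rewrite (_ : m2 CAP 0 = cap); last by (mem_simpl; rewrite am'// aw).
    by rewrite /a /f subn_gt0 addn1 mulnb.
  set m3 := update m2 FLAG 0 a.
  have bm3 : bounded n m3 by apply: bounded_update => //; case: (a).
  set m4 := update m3 REMOVED 0 (r + a).
  have ran : r + a <= n by case: (a); rewrite /i in E3; lia.
  have bm4 : bounded n m4 by apply: bounded_update => //; lia.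
  set m5 := update m4 LST (~~ o * n + size P) (nth 0 W i).
  have bm5 : bounded n m5 by apply: bounded_update => //; lia.
  set m6 := update m5 KEPT 0 (size P + (a == h)).
  have Pn : size P + (a == h) <= n.
    by apply: (@leq_trans (size P + 1)); [rewrite leq_add2l; case: (_ == _)|rewrite /i in E2; lia].
  have i3 : eval m3 (eadd (var REMOVED) (var FLAG)) = r + a.
    by rewrite /=; mem_simpl; rewrite H3.
  have i4 : eval m4 (cell other_side (var KEPT)) = ~~ o * n + size P.
    rewrite -[LHS]/(eval m4 other_side * m4 0 0 + m4 KEPT 0).
    by rewrite (eval_other (o := o)); mem_simpl; rewrite m0' H2.
  have i4' : eval m4 (var CUR) = nth 0 W i by rewrite /=; mem_simpl.
  have i5 : eval m5 (eadd (var KEPT) (eeq (var FLAG) (var KEEP))) = size P + (a == h).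
    rewrite /=; mem_simpl; rewrite H2 am'// aw// mh.
    by case: (a); case: (h).
  rewrite (den_seq_set (k := 0) _ _ bm' _ Ec)//; last exact: ltnW.
  rewrite (den_seq_set (k := 0) _ _ bm2 _ Ef)//; last by case: (a); lia.
  rewrite (den_seq_set (k := 0) _ _ bm3 _ i3)//.
  rewrite (den_seq_set _ _ bm4 i4 i4')//; last exact: ltnW.
  rewrite (den_PSet _ _ bm5 i5 Pn) -/m6.
  have EW : drop i W = nth 0 W i :: drop i.+1 W by rewrite (drop_nth 0).
  have Er : cap - r - a = cap - (r + a) by rewrite subnDA.
  exists (if a == h then rcons P (nth 0 W i) else P), (r + a).
  have sP : size (if a == h then rcons P (nth 0 W i) else P) = size P + (a == h).
    by case: ifP => _; rewrite ?size_rcons ?addn1 ?addn0.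
  rewrite sP ij; split; first split.
  - rewrite E1 EW /= -/a Er; case: ifP => // _; by rewrite cat_rcons.
  - by rewrite -addn1 leq_add//; case: (_ == _).
  - by rewrite -addn1 leq_add//; case: (a).
  split.
  - by rewrite /m6 update_same.
  - by rewrite /m6 update_other// /m5 update_other// /m4 update_same.
  - move=> t tP; rewrite /m6 update_other// /m5.
    have [tE|tP'] := eqVneq t (size P).
      rewrite tE in tP *; rewrite update_same.
      have -> : a == h by move: tP; case: (a == h) => //=; lia.
      by rewrite nth_rcons ltnn eqxx.
    have tP2 : t < size P by move: tP; case: (a == h) => /=; lia.
    rewrite {1}/update cell_eq (negbTE tP') andbF; mem_simpl; rewrite H4//.
    by case: ifP => // _; rewrite nth_rcons tP2.
  - move=> t /andP[it tW]; rewrite /m6 update_other// /m5 {1}/update cell_eq.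
    have -> : t == size P = false by apply/eqP; lia.
    by rewrite andbF; mem_simpl; rewrite H5// (ltnW it).
  - move=> t tn; rewrite /m6 update_other// /m5 {1}/update cell_neq//; last by lia.
    by rewrite andbF; mem_simpl; rewrite H6.
move=> m' [bm' am' [P [r [[E1 _ _] [H2 H3 H4 H5 H6]]]]].
rewrite subn0 drop_size /= cats0 in E1.
have m0' : m' 0 0 = n by case: bm'.
have ms' : m' SIDE 0 = o by rewrite am'// aw.
have EP : size P <= n.
  by rewrite -E1 (leq_trans (size_split_seq _ _ _ _)).
have iP : eval m' (var KEPT) = size P by rewrite /= H2.
rewrite (den_PSet _ _ bm' iP EP) (eval_other ms').
have bmP : bounded n (update m' CNT (~~ o) (size P)) by apply: bounded_update => //; lia.
split.
  rewrite E1; apply: rep_set_target => //.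
  - by move=> j; rewrite update_other// am'// aw.
  - split; first by rewrite /update /= am'//= aw// sZ1; case: (o).
    by move=> t tZ; rewrite update_other// H6 ?sZ2// (leq_trans tZ).
  - split; first by rewrite update_same.
    by move=> t tP; rewrite update_other// H4.
  - by rewrite -E1 split_seq_valid.
move=> a j aB; rewrite update_other//; last by apply: contraNneq aB => ->.
rewrite am' ?aw//; by apply: contraNN aB; rewrite !inE; do ?case/orP; move=> /eqP->.
Qed.

Lemma rrel_frame n p m Y (Q : memory -> Y -> Prop) t : wf p -> bounded n m ->
  rrel Q (den p m) t ->
  rrel (fun m' y => [/\ bounded n m', agree_off (writes p) m m' & Q m' y]) (den p m) t.
Proof.
move=> wp bm /rrel_andl/(_ (rall_and (den_bounded wp bm) (den_agree p m))).
by apply: rrel_imp => m' y [? []].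
Qed.

Lemma den_PSeq p q m : den (PSeq p q) m = bind (den p m) (den q).
Proof. by []. Qed.

Lemma rnd_lt n m : 0 < m -> m <= n -> rall (fun i => i < m) (rnd n m).
Proof.
move=> m0 mn; apply: (@rall_iterM _ (fun _ i => i < m)) => // j i _ _ b /=.
by rewrite modn_small ?ltn_mod// ltnS ltnW// (leq_trans _ mn)// ltn_mod.
Qed.

Lemma den_rnd n m e k : bounded n m -> eval m e = k -> k <= n ->
  rrel (fun m' r => m' ACC 0 = r) (den (p_rnd e) m) (rnd n k).
Proof.
move=> bm ek kn; have [m0 _] := bm.
rewrite /p_rnd /set_var (@den_seq_set n _ _ _ _ 0 k)//.
set m1 := update m MODULUS 0 k.
have bm1 : bounded n m1 by apply: bounded_update => //; exact: leqW.
rewrite (@den_seq_set n _ _ _ _ 0 0)//; set m2 := update m1 ACC 0 0.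
have bm2 : bounded n m2 by apply: bounded_update.
rewrite den_PFor (eval_capped _ bm2) -[eval m2 size_in]/(m2 0 0) (proj1 bm2) modn_small//.
set body := PSeq _ _.
pose I (j : nat) (m' : memory) r := m' ACC 0 = r.
have : rrel (fun m' r => [/\ bounded n m', agree_off (RCTR :: writes body) m2 m' & I 0 m' r])
  (for_loop RCTR (den body) n m2) (rnd n k); last by apply: rrel_imp => ? ? [].
apply: for_rrel => // j m' r jn bm' am' m'j Ij b.
set m3 := update m' BIT 0 b.
have bm3 : bounded n m3 by apply: bounded_update => //; case: b {m3}; lia.
rewrite /I -[LHS]/(update m3 ACC 0 (eval m3 (capped (Op Mod
  (eadd (emul (Const 2) (var ACC)) (var BIT)) (var MODULUS)))) ACC 0).
rewrite update_same (eval_capped _ bm3) /= ; mem_simpl.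
by rewrite Ij am'.
Qed.

Lemma den_pick n A m L (o : bool) : 0 < n -> rep n A m L -> m SIDE 0 = o ->
  rrel (fun m' x => [/\ m' PICKED 0 = x, x < n & rep n A m' L])
    (den p_pick m) (pick n (chooser o L)).
Proof.
move=> n0 rm ms; have [bm mA _ _ _] := rm; have [m0 _] := bm.
have [sZ1 sZ2] := rep_seg o rm; have vZ := rep_valid o rm; have sZn := valid_size vZ.
set Z := chooser o L in sZ1 sZ2 vZ sZn *.
rewrite /p_pick den_PSeq /pick.
have ek : eval m (Read CNT this_side) = size Z by rewrite eval_read (eval_this ms).
apply: (@rrel_bind _ _ _ _ (fun m' r => [/\ bounded n m', 
    agree_off (writes (p_rnd (Read CNT this_side))) m m', m' ACC 0 = r &
    (0 < size Z) ==> (r < size Z)])).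
  have R := rrel_frame (isT : wf (p_rnd _)) bm (den_rnd bm ek sZn).
  case: (posnP (size Z)) => [Z0|Zp]; first by apply: rrel_imp R => m' r [? ? ?]; split=> //; rewrite Z0.
  have := rrel_andr R (rnd_lt Zp sZn); apply: rrel_imp => m' r [[? ? ?] rZ].
  by split=> //; apply/implyP.
move=> m' r [bm' am' mr rZ]; rewrite /set_var.
have m0' : m' 0 0 = n by case: bm'.
have ms' : m' SIDE 0 = o by rewrite am'.
have xn : nth 0 Z r * (0 < size Z) < n.
  case: (ltnP r (size Z)) => rs; last by rewrite nth_default.
  by apply: leq_ltn_trans (valid_nth vZ rs); case: (0 < size Z); rewrite ?muln1 ?muln0.
have ex : eval m' (emul (Read LST (cell this_side (var ACC)))
    (eleq (Const 1) (Read CNT this_side))) = nth 0 Z r * (0 < size Z).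
  rewrite -[LHS]/(m' LST (m' SIDE 0 * m' 0 0 + m' ACC 0) * (1 <= m' CNT (m' SIDE 0))).
  rewrite ms' m0' mr (am' CNT)// sZ1; case: (posnP (size Z)) rZ => [_ _|Z0 rZ].
    by rewrite !muln0.
  by rewrite am'// sZ2.
rewrite (den_PSet _ _ bm' ex (ltnW xn)); split=> //.
apply: (@rep_agree n A m _ L (PICKED :: writes (p_rnd (Read CNT this_side)))) => //.
  move=> a j; rewrite inE negb_or => /andP[ap aw].
  by rewrite update_other// am'.
by apply: bounded_update => //; apply/leqW/ltnW.
Qed.

Definition marks n (m : memory) (T : seq nat) : Prop :=
  [/\ forall i, i < n -> m MARK i = (i \in T), m DISTINCT 0 = size (undup T)
    & all (fun i => i < n) T].

Lemma marks_agree n m m' T B : agree_off B m m' -> MARK \notin B -> DISTINCT \notin B ->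
  marks n m T -> marks n m' T.
Proof. by move=> am h1 h2 [H1 H2 H3]; split=> // [i /H1|]; rewrite am. Qed.

Lemma den_clear n A m L : rep n A m L -> pure (marks n ^~ [::]) (den p_clear m).
Proof.
case=> bm _ _ _ _; have [m0 _] := bm.
rewrite /p_clear den_PSeq den_PFor (eval_capped _ bm) -[eval m size_in]/(m 0 0) m0 modn_small//.
pose I j (m' : memory) := forall i, j <= i < n -> m' MARK i = 0.
apply: (@pure_bind (fun m' => [/\ bounded n m', agree_off [:: SCANCTR; MARK] m m' & I 0 m'])).
  apply: for_pure => //.
    by move=> i; case: ltngtP.
  move=> j m' jn bm' am' m'j Ij.
  have e0 : eval m' Z0 = 0 by [].
  rewrite (den_PSet _ _ bm' e0)//= m'j subn1 /=.
  move=> i /andP[ji iN]; rewrite /update /=; case: eqVneq => // ij.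
  by rewrite Ij// iN andbT ltn_neqAle eq_sym ij.
move=> m' [bm' am' I0]; have e0 : eval m' Z0 = 0 by [].
by rewrite /set_var (den_PSet _ _ bm' e0)//=; split.
Qed.

Lemma chooser_set o L W : chooser o (set_target o L W) = chooser o L.
Proof. by case: o. Qed.

Lemma target_set o L W : target o (set_target o L W) = W.
Proof. by case: o. Qed.

Lemma set_set o L W W' : set_target o (set_target o L W) W' = set_target o L W'.
Proof. by case: o. Qed.

Lemma set_target_id o L : set_target o L (target o L) = L.
Proof. by case: o L => [] []. Qed.

Lemma den_step n A m L (o h : bool) y : 0 < n ->
  rep n A m (set_target o L y.1) -> marks n m y.2 -> m SIDE 0 = o -> m KEEP 0 = h ->
  rrel (fun m' y' => rep n A m' (set_target o L y'.1) /\ marks n m' y'.2)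
    (den p_step m) (step n A o h (m CAP 0) (chooser o L) y).
Proof.
move=> n0 rm mk ms mh; have [bm _ _ _ _] := rm.
rewrite /p_step den_PSeq /step.
have := den_pick n0 rm ms; rewrite chooser_set => R.
apply: rrel_bind (rrel_frame (isT : wf p_pick) bm R) _ => m1 x [bm1 am1 [px xn rm1]].
have m10 : m1 0 0 = n by case: bm1.
have [H1 H2 H3] := mk.
have e1 : eval m1 (eadd (var DISTINCT) (eeq (Read MARK (var PICKED)) Z0)) =
    size (undup (x :: y.2)).
  rewrite -[LHS]/(m1 DISTINCT 0 + (m1 MARK (m1 PICKED 0) == 0)) px am1// H2 am1// H1//=.
  by case: (x \in y.2); rewrite ?addn0 ?addn1.
have xn2 : all (fun i => i < n) (x :: y.2) by rewrite /= xn.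
have sn : size (undup (x :: y.2)) <= n.
  by apply: valid_size; rewrite /valid undup_uniq; apply/allP => v; rewrite mem_undup => /(allP xn2).
rewrite /set_var (@den_seq_set n _ _ _ _ 0 _ _ bm1 _ e1)//.
set m2 := update m1 _ _ _.
have bm2 : bounded n m2 by apply: bounded_update => //; exact: leqW.
have ep : eval m2 (var PICKED) = x by rewrite /= /m2 update_other.
rewrite (@den_seq_set n _ _ _ _ x 1 _ bm2)//.
set m3 := update m2 _ _ _.
have bm3 : bounded n m3 by apply: bounded_update.
have am3 : agree_off [:: DISTINCT; MARK] m1 m3.
  move=> a j; rewrite !inE negb_or => /andP[a1 a2].
  by rewrite /m3 update_other// /m2 update_other.
have rm3 : rep n A m3 (set_target o L y.1) := rep_agree am3 bm3 isT rm1.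
have ms3 : m3 SIDE 0 = o by rewrite am3// am1.
have mh3 : m3 KEEP 0 = h by rewrite am3// am1.
have mk3 : marks n m3 (x :: y.2).
  split=> //.
  move=> i iN; rewrite /m3 {1}/update /= inE /m2 update_other//.
  by case: eqVneq => //= _; rewrite am1// H1.
have := den_split rm3 ms3 mh3; rewrite target_set set_set => D.
have -> : m CAP 0 = m3 CAP 0 by rewrite am3// am1.
have -> : x = m3 PICKED 0 by rewrite am3.
case: (den p_split m3) D => //= m4 [rm4 am4]; split; first exact: rm4.
by rewrite am3// px; apply: marks_agree am4 _ _ mk3.
Qed.

Lemma den_steps n A m L (o h : bool) c cap : 0 < n -> rep n A m L ->
  m SIDE 0 = o -> m KEEP 0 = h -> m COUNT 0 = c -> c <= n -> m CAP 0 = cap ->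
  rrel (fun m' y => [/\ bounded n m', agree_off (writes p_steps) m m',
      rep n A m' (set_target o L y.1) & marks n m' y.2])
    (den p_steps m) (steps n A o h cap (chooser o L) c (target o L)).
Proof.
move=> n0 rm ms mh mc cn mcap; have [bm _ _ _ _] := rm.
have D := pure_frame (isT : wf p_clear) bm (den_clear rm).
suff H : rrel (fun m' y => rep n A m' (set_target o L y.1) /\ marks n m' y.2)
    (den p_steps m) (steps n A o h cap (chooser o L) c (target o L)).
  by apply: rrel_imp (rrel_frame (isT : wf p_steps) bm H) => m' y [? ? []].
rewrite /p_steps den_PSeq; apply: pure_rrel D _ => m1 [bm1 am1 mk1].
rewrite den_PFor (eval_capped _ bm1) -[eval m1 (var COUNT)]/(m1 COUNT 0) am1// mc modn_small//.
pose I (j : nat) m' y := rep n A m' (set_target o L y.1) /\ marks n m' y.2.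
have : rrel (fun m' y => [/\ bounded n m', agree_off (STEPCTR :: writes p_step) m1 m' & I 0 m' y])
   (for_loop STEPCTR (den p_step) c m1) (steps n A o h cap (chooser o L) c (target o L));
   last by apply: rrel_imp => ? ? [].
apply: for_rrel => //.
- by split=> //; rewrite /= set_target_id; apply: rep_agree am1 _ _ rm.
- move=> j m' y v vn [rm' mk']; split; last by case: mk'.
  have [bm' _ _ _ _] := rm'; apply: (rep_agree (B := [:: STEPCTR])) rm' => //.
    by apply: agree_update; rewrite mem_head.
  exact: bounded_update.
- move=> j m' y jc bm' am' m'j [rm' mk'].
  have -> : cap = m' CAP 0 by rewrite am'// am1.
  by apply: den_step => //; rewrite am'// am1.
Qed.

Lemma den_degree n A m (o : bool) W : bounded n m -> (forall j, m 1 j = A j) ->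
  m SIDE 0 = o -> seg n m (~~ o) W -> size W <= n -> m DEG 0 = 0 ->
  pure (fun m' => m' DEG 0 = count (nonadj n A o (m CUR 0)) W) (den p_degree m).
Proof.
move=> bm mA ms [sW1 sW2] Wn md; have [m0 _] := bm.
set f := nonadj n A o _.
rewrite /p_degree den_PFor (eval_capped _ bm) eval_read (eval_other ms) sW1 modn_small//.
set body := set_var DEG _.
pose I j (m' : memory) := m' DEG 0 = count f (drop j W).
have : pure (fun m' => [/\ bounded n m', agree_off (SCANCTR :: writes body) m m' & I 0 m'])
  (for_loop SCANCTR (den body) (size W) m); last first.
  by apply: pure_imp => m' [_ _]; rewrite /I drop0.
apply: for_pure => //; first by rewrite /I drop_size.
move=> j m' jW bm' am' m'j Ij.
have m0' : m' 0 0 = n by case: bm'.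
have ms' : m' SIDE 0 = o by rewrite am'.
have E : eval m' (eadd (var DEG) (non_adjacent (var CUR) (Read LST (cell other_side (decr SCANCTR)))))
    = count f (drop j W).
  rewrite -[LHS]/(m' DEG 0 + eval m' (non_adjacent (var CUR) (Read LST (cell other_side (decr SCANCTR))))).
  rewrite (eval_non_adjacent (n := n) (A := A) (o := o))//; last by move=> k; rewrite am'.
  rewrite -[eval m' (var CUR)]/(m' CUR 0).
  rewrite -[eval m' (Read LST _)]/(m' LST (eval m' other_side * m' 0 0 + (m' SCANCTR 0 - 1))).
  rewrite (eval_other ms') m0' m'j subn1 /= (am' LST)// sW2// (am' CUR)// Ij.
  by rewrite (drop_nth 0 jW) /= addnC.
have En : count f (drop j W) <= n.
  by apply: leq_trans (count_size _ _) _; rewrite size_drop; lia.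
by rewrite /body /set_var (den_PSet _ _ bm' E En) /I /= .
Qed.

Lemma den_filter n A m L (o : bool) :
  rep n A m L -> m SIDE 0 = o ->
  pure (fun m' => rep n A m' (set_target (~~ o) L
     (low_degree n A o (m DIVISOR 0) (chooser o L) (target o L)))) (den p_filter m).
Proof.
move=> rm ms; have [bm mA _ _ _] := rm; have [m0 _] := bm.
set W := target o L; set Z := chooser o L; set D := m DIVISOR 0.
have sW : seg n m (~~ o) W by rewrite /W target_chooser; exact: rep_seg rm.
have vW : valid n W by rewrite /W target_chooser; exact: rep_valid rm.
have sWn := valid_size vW.
have [sZ1 sZ2] := rep_seg o rm.
have vZ := rep_valid o rm; have sZn := valid_size vZ.
rewrite -/Z in sZ1 sZ2 vZ sZn.
pose g u := D * count (nonadj n A o u) W <= size W.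
rewrite /p_filter /set_var (@den_seq_set n _ _ _ _ 0 0)//.
set m1 := update m KEPT 0 0.
have bm1 : bounded n m1 by apply: bounded_update.
have aw a j : a != KEPT -> m1 a j = m a j by move=> ak; rewrite /m1 update_other.
rewrite den_PSeq den_PFor (eval_capped _ bm1) eval_read (eval_this (o := o)) ?aw// sZ1 modn_small//.
pose I j m' := exists P,
  [/\ seq.filter g Z = P ++ seq.filter g (drop (size Z - j) Z), size P <= size Z - j &
   [/\ m' KEPT 0 = size P,
      forall t, t < size P -> m' LST (o * n + t) = nth 0 P t,
      forall t, size Z - j <= t < size Z -> m' LST (o * n + t) = nth 0 Z t &
      forall t, t < n -> m' LST (~~ o * n + t) = m LST (~~ o * n + t)]].
apply: (@pure_bind (fun m' => [/\ bounded n m',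
    agree_off (OUTERCTR :: writes p_filter_body) m1 m' & I 0 m'])).
  apply: for_pure => //.
  - exists [::]; rewrite subnn drop0; split=> //.
  move=> j m' jZ bm' am' m'c [P [E1 E2 [H2 H4 H5 H6]]].
  have n0 : 0 < n by lia.
  set i := size Z - j.+1 in E1 E2 H5.
  have iZ : i < size Z by rewrite /i; lia.
  have ij : size Z - j = i.+1 by rewrite /i; lia.
  have ms' : m' SIDE 0 = o by rewrite am'// aw.
  have m0' : m' 0 0 = n by case: bm'.
  have vi : nth 0 Z i < n := valid_nth vZ iZ.
  have Ec : eval m' (Read LST (cell this_side (esub (Read CNT this_side) (var OUTERCTR)))) =
      nth 0 Z i.
    rewrite -[LHS]/(m' LST (m' SIDE 0 * m' 0 0 + (m' CNT (m' SIDE 0) - m' OUTERCTR 0))).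
    by rewrite ms' m0' (am' CNT)// aw// sZ1 m'c -/i H5// leqnn.
  rewrite /p_filter_body /set_var (@den_seq_set n _ _ _ _ 0 _ _ bm' _ Ec)//; last exact: ltnW.
  set m2 := update m' CUR 0 _.
  have bm2 : bounded n m2 by apply: bounded_update => //; lia.
  rewrite (@den_seq_set n _ _ _ _ 0 0 _ bm2)//.
  set m3 := update m2 DEG 0 _.
  have bm3 : bounded n m3 by apply: bounded_update => //; lia.
  have am3 : agree_off [:: CUR; DEG] m' m3.
    move=> a k; rewrite !inE negb_or => /andP[a1 a2].
    by rewrite /m3 update_other// /m2 update_other.
  have D3 : pure (fun m' => m' DEG 0 = count (nonadj n A o (nth 0 Z i)) W) (den p_degree m3).
    rewrite (_ : nth 0 Z i = m3 CUR 0); last by rewrite /m3 /m2.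
    apply: den_degree => //.
    - by move=> k; rewrite am3// am'// aw.
    - split; first by rewrite am3// am'// aw// sW.1.
      by move=> t tW; rewrite am3// H6 ?sW.2// (leq_trans tW).
  rewrite den_PSeq; apply: pure_bind (pure_frame (isT : wf p_degree) bm3 D3) _ => m4 [bm4 am4 d4].
  have ms4 : m4 SIDE 0 = o by rewrite am4// am3.
  have m04 : m4 0 0 = n by case: bm4.
  have i4 : eval m4 (cell this_side (var KEPT)) = o * n + size P.
    rewrite -[LHS]/(m4 SIDE 0 * m4 0 0 + m4 KEPT 0).
    by rewrite ms4 m04 am4// am3// H2.
  have i4' : eval m4 (var CUR) = nth 0 Z i.
    by rewrite -[LHS]/(m4 CUR 0) am4.
  rewrite (den_seq_set _ _ bm4 i4 i4')//; last exact: ltnW.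
  set m5 := update m4 _ _ _.
  have bm5 : bounded n m5 by apply: bounded_update => //; lia.
  have i5 : eval m5 (eadd (var KEPT) (eleq (emul (var DIVISOR) (var DEG)) (Read CNT other_side)))
      = size P + g (nth 0 Z i).
    rewrite -[LHS]/(m5 KEPT 0 + (m5 DIVISOR 0 * m5 DEG 0 <= m5 CNT (eval m5 other_side))).
    rewrite (eval_other (o := o)); last by mem_simpl.
    mem_simpl; rewrite d4 (am4 KEPT)// (am3 KEPT)// H2.
    rewrite (am4 DIVISOR)// (am3 DIVISOR)// (am' DIVISOR)// (aw DIVISOR)//.
    by rewrite (am4 CNT)// (am3 CNT)// (am' CNT)// (aw CNT)// sW.1.
  have Pn : size P + g (nth 0 Z i) <= n.
    apply: (@leq_trans (size P + 1)); first by rewrite leq_add2l; case: (g _).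
    by rewrite /i in E2; lia.
  rewrite (den_PSet _ _ bm5 i5 Pn).
  have EW : drop i Z = nth 0 Z i :: drop i.+1 Z by rewrite (drop_nth 0).
  have am4' t : m4 LST t = m' LST t by rewrite am4// am3.
  exists (if g (nth 0 Z i) then rcons P (nth 0 Z i) else P).
  have sP : size (if g (nth 0 Z i) then rcons P (nth 0 Z i) else P) = size P + g (nth 0 Z i).
    by case: (g _); rewrite ?size_rcons ?addn1 ?addn0.
  rewrite sP ij; split.
  - by rewrite E1 EW /=; case: (g _) => //; rewrite cat_rcons.
  - by rewrite -addn1 leq_add//; case: (g _).
  split.
  - by rewrite update_same.
  - move=> t tP; rewrite update_other// /m5.
    have [tE|tP'] := eqVneq t (size P).
      rewrite tE in tP *; rewrite update_same.
      have -> : g (nth 0 Z i) by move: tP; case: (g _) => //=; lia.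
      by rewrite nth_rcons ltnn eqxx.
    have tP2 : t < size P by move: tP; case: (g _) => /=; lia.
    rewrite {1}/update cell_eq (negbTE tP') andbF am4' H4//.
    by case: (g _) => //; rewrite nth_rcons tP2.
  - move=> t /andP[it tW]; rewrite update_other// /m5 {1}/update cell_eq.
    have -> : t == size P = false by apply/eqP; lia.
    by rewrite andbF am4' H5// (ltnW it).
  - move=> t tn; rewrite update_other// /m5 {1}/update eq_sym.
    rewrite [_ == ~~ o * n + t]cell_neq//; last by lia.
    by rewrite andbF am4' H6.
move=> m' [bm' am' [P [E1 _ [H2 H4 H5 H6]]]].
rewrite subn0 drop_size /= cats0 in E1.
have ms' : m' SIDE 0 = o by rewrite am'// aw.
have EP : size P <= n by rewrite -E1 size_filter (leq_trans (count_size _ _)).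
have iP : eval m' (var KEPT) = size P by rewrite -[LHS]/(m' KEPT 0) H2.
rewrite (den_PSet _ _ bm' iP EP) (eval_this ms') /=.
have bmP : bounded n (update m' CNT o (size P)) by apply: bounded_update => //; lia.
have -> : low_degree n A o D Z W = P by exact: E1.
apply: rep_set_target => //.
- by move=> j; rewrite update_other// am'// aw.
- rewrite -target_chooser; split.
    have -> : update m' CNT o (size P) CNT (~~ o) = m' CNT (~~ o) by rewrite /update; case: (o).
    by rewrite am'// aw// sW.1.
  by move=> t tZ; rewrite update_other// H6 ?sW.2// (leq_trans tZ).
- rewrite negbK; split; first by rewrite update_same.
  by move=> t tP; rewrite update_other// H4.
- by rewrite -target_chooser.
- rewrite -E1; case/andP: vZ => uZ /allP Zn; rewrite /valid filter_uniq//.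
  by apply/allP => v; rewrite mem_filter => /andP[_ /Zn].
Qed.

Lemma den_init n A m : bounded n m -> (forall j, m 1 j = A j) ->
  pure (fun m' => rep n A m' (iota 0 n, iota 0 n)) (den p_init m).
Proof.
move=> bm mA; have [m0 _] := bm.
rewrite /p_init den_PSeq den_PFor (eval_capped _ bm) -[eval m size_in]/(m 0 0) m0 modn_small//.
set body := PSeq _ _.
pose I j (m' : memory) := forall i, j <= i < n -> m' LST i = i /\ m' LST (n + i) = i.
apply: (@pure_bind (fun m' => [/\ bounded n m', agree_off (SCANCTR :: writes body) m m' & I 0 m'])).
  apply: for_pure => //; first by move=> i; case: ltngtP.
  move=> j m' jn bm' am' m'j Ij.
  have e0 m2 : m2 SCANCTR 0 = j.+1 -> eval m2 (decr SCANCTR) = j.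
    by move=> mj; rewrite -[LHS]/(m2 SCANCTR 0 - 1) mj subn1.
  rewrite /body (@den_seq_set n _ _ _ _ j j _ bm')//; [|exact: e0|exact: e0|exact: ltnW].
  set m2 := update m' LST j j.
  have bm2 : bounded n m2 by apply: bounded_update => //; lia.
  have j2 : m2 SCANCTR 0 = j.+1 by rewrite /m2 update_other.
  rewrite (den_PSet _ _ bm2 (e0 _ j2) (ltnW jn)).
  have -> : eval m2 (eadd size_in (decr SCANCTR)) = n + j.
    rewrite -[LHS]/(m2 0 0 + eval m2 (decr SCANCTR)) (e0 _ j2).
    by case: bm2 => ->.
  move=> i /andP[ji iN]; rewrite /m2 /update /= !eqn_add2l.
  have -> : i == n + j = false by apply/eqP; lia.
  have -> : n + i == j = false by apply/eqP; lia.
  case: eqVneq => [->//|ij]; apply: Ij; rewrite iN andbT; move/eqP: ij; lia.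
move=> m' [bm' am' I0].
have m0' : m' 0 0 = n by case: bm'.
rewrite (@den_seq_set n _ _ _ _ 0 n _ bm')//.
set m2 := update m' CNT 0 n.
have bm2 : bounded n m2 by apply: bounded_update.
have en : eval m2 size_in = n by rewrite -[LHS]/(m2 0 0); case: bm2.
rewrite (den_PSet _ _ bm2 en)//=.
have bm3 : bounded n (update m2 CNT 1 n) by apply: bounded_update.
have vI : valid n (iota 0 n).
  by rewrite /valid iota_uniq; apply/allP => i; rewrite mem_iota.
have E4 t : update m2 CNT 1 n LST t = m' LST t by rewrite update_other// /m2 update_other.
split.
- by [].
- by move=> j; rewrite update_other// /m2 update_other// am'.
- split; first by rewrite size_iota.
  by move=> t; rewrite size_iota => tn; rewrite E4 mul0n nth_iota// (proj1 (I0 t _)).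
- split; first by rewrite size_iota.
  by move=> t; rewrite size_iota => tn; rewrite E4 mul1n nth_iota// (proj2 (I0 t _)).
- by rewrite vI.
Qed.

Lemma bind_ret X (t : ctree X) : bind t (@Ret X) = t.
Proof. by elim: t => //= g IH; congr Toss; apply: funext. Qed.

Lemma bindA X Y Z (t : ctree X) (f : X -> ctree Y) (g : Y -> ctree Z) :
  bind (bind t f) g = bind t (fun x => bind (f x) g).
Proof. by elim: t => //= h IH; congr Toss; apply: funext. Qed.

Lemma rrel_Toss X Y (Q : X -> Y -> Prop) g h :
  (forall b, rrel Q (g b) (h b)) -> rrel Q (Toss g) (Toss h).
Proof. by []. Qed.

Lemma den_seq_flip a i p m :
  den (PSeq (PFlip a i) p) m = Toss (fun b => den p (update m a (eval m i) b)).
Proof. by []. Qed.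

Lemma den_phase n A m L D : 0 < n -> rep n A m L -> m DIVISOR 0 = D -> D < n ->
  rrel (fun m' L' => rep n A m' L') (den p_phase m) (phase n A D L).
Proof.
move=> n0 rm mD Dn; have [bm mA _ _ _] := rm; rewrite /p_phase den_seq_flip /phase; apply: rrel_Toss => o.
set m1 := update m SIDE 0 o.
have bm1 : bounded n m1 by apply: bounded_update => //; case: o {m1}; lia.
rewrite -/m1.
rewrite /set_var (@den_seq_set n _ _ _ _ 0 0 _ bm1)//.
set m2 := update m1 KEEP 0 0.
have bm2 : bounded n m2 by apply: bounded_update.
have ms2 : m2 SIDE 0 = o by mem_simpl.
have sW : seg n m (~~ o) (target o L) by rewrite target_chooser; exact: rep_seg rm.
set W := target o L in sW *; set Z := chooser o L.
have vW : valid n W by rewrite /W target_chooser; exact: rep_valid rm.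
have capn : size W %/ (2 * D) <= n by rewrite (leq_trans (leq_div _ _))// valid_size.
have e2 : eval m2 (Op Div (Read CNT other_side) (emul (Const 2) (var DIVISOR))) =
    size W %/ (2 * D).
  rewrite -[LHS]/(m2 CNT (eval m2 other_side) %/ (2 * m2 DIVISOR 0)) (eval_other ms2).
  by mem_simpl; rewrite sW.1 mD.
rewrite (@den_seq_set n _ _ _ _ 0 _ _ bm2 _ e2)//.
set cap := size W %/ (2 * D) in capn *.
set m3 := update m2 CAP 0 cap.
have bm3 : bounded n m3 by apply: bounded_update => //; exact: leqW.
have am3 : agree_off [:: SIDE; KEEP; CAP] m m3.
  move=> a j; rewrite !inE !negb_or => /and3P[a1 a2 a3].
  by rewrite /m3 update_other// /m2 update_other// /m1 update_other.
have rm3 := rep_agree am3 bm3 isT rm.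
rewrite den_PSeq.
have e3 : eval m3 (eadd (var DIVISOR) (Const 1)) = D.+1.
  by rewrite -[LHS]/(m3 DIVISOR 0 + 1) am3// mD addn1.
have R := rrel_andr (rrel_frame (isT : wf (p_rnd _)) bm3 (den_rnd bm3 e3 Dn)) (rnd_lt (ltn0Sn D) Dn).
apply: rrel_bind R _ => m4 c [[bm4 am4 m4c] cD].
have e4 : eval m4 (var ACC) = c by [].
have cn : c <= n by lia.
rewrite (@den_seq_set n _ _ _ _ 0 _ _ bm4 _ e4)//.
set m5 := update m4 COUNT 0 c.
have bm5 : bounded n m5 by apply: bounded_update => //; exact: leqW.
have am5 : agree_off (COUNT :: writes (p_rnd (eadd (var DIVISOR) (Const 1)))) m3 m5.
  by move=> a j; rewrite inE negb_or => /andP[a1 a2]; rewrite /m5 update_other// am4.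
have rm5 := rep_agree am5 bm5 isT rm3.
have ms5 : m5 SIDE 0 = o by rewrite am5.
have cap5 : m5 CAP 0 = cap by rewrite am5.
have kp5 : m5 KEEP 0 = false by rewrite am5.
rewrite den_PSeq.
have cnt5 : m5 COUNT 0 = c by rewrite /m5 update_same.
have := den_steps n0 rm5 ms5 kp5 cnt5 cn cap5.
move/rrel_bind; apply => m6 y [bm6 am6 rm6 _].
rewrite den_seq_flip; apply: rrel_Toss => b.
set m7 := update m6 COUNT 0 b.
have bm7 : bounded n m7 by apply: bounded_update => //; case: b {m7}; lia.
rewrite -/m7.
rewrite /set_var (@den_seq_set n _ _ _ _ 0 1 _ bm7)//.
set m8 := update m7 KEEP 0 1.
have bm8 : bounded n m8 by apply: bounded_update.
have am8 : agree_off [:: COUNT; KEEP] m6 m8.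
  move=> a j; rewrite !inE !negb_or => /andP[a1 a2].
  by rewrite /m8 update_other// /m7 update_other.
have rm8 := rep_agree am8 bm8 isT rm6.
have ms8 : m8 SIDE 0 = o by rewrite am8// am6.
have cap8 : m8 CAP 0 = cap by rewrite am8// am6.
have kp8 : m8 KEEP 0 = true by rewrite /m8 update_same.
have cnt8 : m8 COUNT 0 = b by rewrite /m8 update_other// /m7 update_same.
have bn : b <= n by case: b {m7 bm7 m8 bm8 am8 rm8 ms8 cap8 kp8 cnt8}.
have R2 := den_steps n0 rm8 ms8 kp8 cnt8 bn cap8.
rewrite chooser_set target_set in R2.
by rewrite -[den p_steps m8]bind_ret; apply: rrel_bind R2 _ => m9 y' [bm9 am9]; rewrite set_set.
Qed.

Definition final_rel n A (m : memory) (r : bool * (seq nat * seq nat)) : Prop :=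
  [/\ bounded n m, forall j, m 1 j = A j, seg n m (~~ r.1) r.2.1 /\ valid n r.2.1,
      marks n m r.2.2 & m SIDE 0 = r.1].

Lemma den_final n A m L D sigma : 0 < n -> rep n A m L -> m DIVISOR 0 = D ->
  m SIGMA 0 = sigma -> sigma <= n ->
  rrel (final_rel n A) (den p_final m) (final n A D sigma L).
Proof.
move=> n0 rm mD msg sn; have [bm mA _ _ _] := rm; rewrite /p_final den_seq_flip /final; apply: rrel_Toss => o.
set m1 := update m SIDE 0 o.
have bm1 : bounded n m1 by apply: bounded_update => //; case: o {m1}; lia.
rewrite -/m1 den_PSeq.
have am1 : agree_off [:: SIDE] m m1 by apply: agree_update; rewrite mem_head.
have rm1 := rep_agree am1 bm1 isT rm.
have ms1 : m1 SIDE 0 = o by rewrite /m1 update_same.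
have F := pure_frame (isT : wf p_filter) bm1 (den_filter rm1 ms1).
apply: pure_rrel F _ => m2 [bm2 am2 rm2].
have {}rm2 : rep n A m2 (set_target (~~ o) L
    (low_degree n A o D (chooser o L) (target o L))).
  by move: rm2; rewrite /m1 update_other// mD.
set L2 := set_target (~~ o) L _ in rm2.
have -> : low_degree n A o D (chooser o L) (target o L) = chooser o L2.
  by rewrite /L2; case: (o).
have -> : target o L = target o L2 by rewrite /L2; case: (o).
rewrite /set_var (@den_seq_set n _ _ _ _ 0 0 _ bm2)//.
set m3 := update m2 KEEP 0 0.
have bm3 : bounded n m3 by apply: bounded_update.
have e3 : eval m3 size_in = n by rewrite -[LHS]/(m3 0 0); case: bm3.
rewrite (@den_seq_set n _ _ _ _ 0 n _ bm3)//.
set m4 := update m3 CAP 0 n.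
have bm4 : bounded n m4 by apply: bounded_update.
have e4 : eval m4 (var SIGMA) = sigma.
  by rewrite -[LHS]/(m4 SIGMA 0) /m4 update_other// /m3 update_other// am2// am1.
rewrite (@den_seq_set n _ _ _ _ 0 _ _ bm4 _ e4)//.
set m5 := update m4 COUNT 0 sigma.
have bm5 : bounded n m5 by apply: bounded_update => //; exact: leqW.
have am5 : agree_off [:: KEEP; CAP; COUNT] m2 m5.
  move=> a j; rewrite !inE !negb_or => /and3P[a1 a2 a3].
  by rewrite /m5 update_other// /m4 update_other// /m3 update_other.
have rm5 := rep_agree am5 bm5 isT rm2.
have ms5 : m5 SIDE 0 = o by rewrite am5// am2.
have R := @den_steps n A m5 L2 o false sigma n n0 rm5 ms5 erefl erefl sn erefl.
rewrite -[den p_steps m5]bind_ret; apply: rrel_bind R _ => m6 y [bm6 am6 rm6 mk6].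
split=> //=; last by rewrite am6.
+ by case: rm6.
+ have := rep_seg (~~ o) rm6; have := rep_valid (~~ o) rm6.
  by rewrite -target_chooser target_set.
Qed.

Definition setup_rel n A (m : memory) (q : (nat * nat) * (nat * nat)) : Prop :=
  [/\ rep n A m (iota 0 n, iota 0 n), [/\ m TAU 0 = q.1.1, m PHASES 0 = q.1.2,
      m DIVISOR 0 = q.2.1 & m SIGMA 0 = q.2.2],
      [/\ q.1.1 < n, q.1.2 < n, q.2.1 < n & q.2.2 < n] &
      [/\ m SIDE 0 = false, m KEEP 0 = false, m CAP 0 = n & m COUNT 0 = q.1.1]].

Lemma den_param n m a : a != 0 -> 0 < n -> bounded n m ->
  rrel (fun m' r => [/\ bounded n m', agree_off (a :: writes (p_rnd size_in)) m m',
      m' a 0 = r & r < n]) (den (p_param a) m) (rnd n n).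
Proof.
move=> a0 n0 bm; rewrite /p_param den_PSeq.
have en : eval m size_in = n by rewrite -[LHS]/(m 0 0); case: bm.
have R := rrel_andr (rrel_frame (isT : wf (p_rnd _)) bm (den_rnd bm en (leqnn n)))
  (rnd_lt n0 (leqnn n)).
rewrite -[rnd n n]bind_ret.
apply: rrel_bind R _ => m' r [[bm' am' mr] rn].
have e' : eval m' (var ACC) = r by [].
rewrite /set_var (den_PSet _ _ bm' e' (ltnW rn)); split=> //.
- by apply: bounded_update => //; apply/leqW/ltnW.
- by move=> b j; rewrite inE negb_or => /andP[b1 b2]; rewrite update_other// am'.
- by rewrite update_same.
Qed.

Lemma den_setup n A m : 0 < n -> bounded n m -> (forall j, m 1 j = A j) ->
  rrel (setup_rel n A) (den p_setup m) (setup n).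
Proof.
move=> n0 bm mA; rewrite /p_setup den_PSeq.
apply: pure_rrel (pure_frame (isT : wf p_init) bm (den_init bm mA)) _ => m0 [bm0 am0 rm0].
rewrite den_PSeq /setup.
apply: rrel_bind (den_param (isT : TAU != 0) n0 bm0) _ => m1 tau [bm1 am1 mtau ltau].
rewrite den_PSeq.
apply: rrel_bind (den_param (isT : PHASES != 0) n0 bm1) _ => m2 J [bm2 am2 mJ lJ].
rewrite den_PSeq.
apply: rrel_bind (den_param (isT : DIVISOR != 0) n0 bm2) _ => m3 D [bm3 am3 mD lD].
rewrite den_PSeq.
apply: rrel_bind (den_param (isT : SIGMA != 0) n0 bm3) _ => m4 s [bm4 am4 msg ls].
rewrite /set_var (@den_seq_set n _ _ _ _ 0 0 _ bm4)//.
set m5 := update m4 SIDE 0 0.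
have bm5 : bounded n m5 by apply: bounded_update.
rewrite (@den_seq_set n _ _ _ _ 0 0 _ bm5)//.
set m6 := update m5 KEEP 0 0.
have bm6 : bounded n m6 by apply: bounded_update.
have e6 : eval m6 size_in = n by rewrite -[LHS]/(m6 0 0); case: bm6.
rewrite (@den_seq_set n _ _ _ _ 0 n _ bm6)//.
set m7 := update m6 CAP 0 n.
have bm7 : bounded n m7 by apply: bounded_update.
have t7 : m7 TAU 0 = tau.
  by rewrite /m7 update_other// /m6 update_other// /m5 update_other// am4// am3// am2.
rewrite (@den_PSet n _ _ _ _ tau bm7)//; last exact: ltnW.
set m8 := update m7 _ _ _.
have bm8 : bounded n m8 by apply: bounded_update => //; apply/leqW/ltnW.
have am8 : agree_off [:: SIDE; KEEP; CAP; COUNT] m4 m8.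
  move=> a j; rewrite !inE !negb_or => /and4P[a1 a2 a3 a4].
  by rewrite /m8 update_other// /m7 update_other// /m6 update_other// /m5 update_other.
split=> //=.
- apply: rep_agree am8 bm8 isT _; apply: rep_agree am4 bm4 isT _.
  by apply: rep_agree am3 bm3 isT _; apply: rep_agree am2 bm2 isT _; apply: rep_agree am1 bm1 isT rm0.
- by split; rewrite am8// am4// am3// am2.
Qed.

Lemma split_seq_full f cap W : size W <= cap ->
  split_seq f cap false W = [seq v <- W | ~~ f v].
Proof.
elim: W cap => //= v W IH cap Wcap; rewrite (leq_ltn_trans (leq0n _) Wcap) andbT eqbF_neg.
by rewrite IH//; case: (f v) => /=; lia.
Qed.

Definition sound n A sigma (r : bool * (seq nat * seq nat)) : Prop :=
  size r.2.2 = sigma /\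
  forall x v, x \in r.2.2 -> v \in r.2.1 -> ~~ nonadj n A r.1 x v.

(** A cap of n never binds, so each pick deletes all its non-neighbours, and later steps only delete
    more. *)
Lemma steps_sound n A o Z c W : size W <= n ->
  rall (fun y => [/\ subseq y.1 W, size y.2 = c &
      forall x v, x \in y.2 -> v \in y.1 -> ~~ nonadj n A o x v])
    (steps n A o false n Z c W).
Proof.
move=> Wn; apply: (@rall_imp _ (fun y => [/\ subseq y.1 W, size y.2 + 0 = c &
    forall x v, x \in y.2 -> v \in y.1 -> ~~ nonadj n A o x v])).
  by move=> y [? <- ?]; rewrite addn0.
apply: (@rall_iterM _ (fun j y => [/\ subseq y.1 W, size y.2 + j = c &
      forall x v, x \in y.2 -> v \in y.1 -> ~~ nonadj n A o x v])) => // j [W' T].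
move=> jc [/= sW sT H].
apply: (@rall_bind _ _ (fun=> True)); first exact: rallT.
move=> x _ /=; rewrite split_seq_full; last by apply: leq_trans (size_subseq sW) Wn.
split=> /=.
- by apply: subseq_trans sW; exact: filter_subseq.
- by rewrite -sT addSnnS.
- move=> x' v; rewrite inE mem_filter => /orP[/eqP->|x'T] /andP[xv vW] //.
  exact: H.
Qed.

Lemma final_sound n A D sigma L : valid n (target false L) -> valid n (target true L) ->
  rall (sound n A sigma) (final n A D sigma L).
Proof.
move=> v1 v2 o; have Wn : size (target o L) <= n by apply: valid_size; case: o.
apply: rall_bind (steps_sound A o _ sigma Wn) _ => y [_ sT H].
by split.
Qed.

Lemma den_explore n A m q : 0 < n -> setup_rel n A m q ->
  rrel (fun m' r => [/\ final_rel n A m' r, m' SIGMA 0 = q.2.2 & sound n A q.2.2 r])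
   (den (PSeq p_steps (PSeq (PFor PHASECTR (var PHASES) p_phase) p_final)) m)
   (explore n A q).
Proof.
move=> n0 [rm [mt mJ mD msg] [lt lJ lD ls] [ms mk mcap mc]].
have [bm mA _ _ _] := rm.
rewrite den_PSeq /explore.
have R := den_steps n0 rm ms mk mc (ltnW lt) mcap.
apply: rrel_bind R _ => m1 y [bm1 am1 rm1 _].
rewrite den_PSeq den_PFor (eval_capped _ bm1) -[eval m1 _]/(m1 PHASES 0) am1// mJ modn_small; last exact: ltnW.
pose I (j : nat) (m' : memory) L := rep n A m' L.
apply: (@rrel_bind _ _ _ _ (fun m' L => [/\ bounded n m',
  agree_off (PHASECTR :: writes p_phase) m1 m' & I 0 m' L])).
  apply: for_rrel => //; first exact: ltnW.
    move=> j m' L v vn rm'; have [bm' _ _ _ _] := rm'; apply: (rep_agree (B := [:: PHASECTR])) rm' => //.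
      by apply: agree_update; rewrite mem_head.
    exact: bounded_update.
  move=> j m' L jJ bm' am' m'j rm'; apply: den_phase => //.
  by rewrite am'// am1.
move=> m2 L [bm2 am2 rm2].
have D2 : m2 DIVISOR 0 = q.2.1 by rewrite am2// am1.
have S2 : m2 SIGMA 0 = q.2.2 by rewrite am2// am1.
have vL : valid n L.1 && valid n L.2 by case: rm2.
case/andP: vL => vL1 vL2.
have := rrel_andr (rrel_frame (isT : wf p_final) bm2 (den_final n0 rm2 D2 S2 (ltnW ls)))
  (final_sound A q.2.1 q.2.2 vL2 vL1).
by apply: rrel_imp => m3 r [[bm3 am3 fr] sr]; split=> //; rewrite am3.
Qed.

Lemma den_output n m (o : bool) sigma W T a b : 0 < n -> bounded n m ->
  m SIDE 0 = o -> m SIGMA 0 = sigma -> sigma <= size W -> seg n m (~~ o) W ->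
  valid n W -> marks n m T -> 1 < a < 4 -> 1 < b < 4 -> a != b ->
  pure (fun m' => forall i, i < n ->
      m' a i = (i \in T) /\ m' b i = (i \in take sigma W)) (den (p_output a b) m).
Proof.
move=> n0 bm ms msg sW [sW1 sW2] vW [mk _ _] ha hb ab.
have sWn := valid_size vW; have sn := leq_trans sW sWn.
have [m0 _] := bm.
have a0 : a != 0 by lia. have b0 : b != 0 by lia.
rewrite /p_output den_PSeq den_PFor (eval_capped _ bm) -[eval m size_in]/(m 0 0) m0 modn_small//.
set body := PSeq _ _.
pose I j (m' : memory) := forall i, j <= i < n -> m' a i = (i \in T) /\ m' b i = 0.
have wb : wf body by rewrite /body /= a0 b0.
apply: (@pure_bind (fun m' => [/\ bounded n m', agree_off (SCANCTR :: writes body) m m' & I 0 m'])).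
  apply: for_pure => //.
  - by rewrite /= !inE; lia.
  - by move=> i; case: ltngtP.
  - move=> j m' v _ Ij i /Ij; rewrite !update_other//; lia.
  move=> j m' jn bm' am' m'j Ij.
  have e0 m2 : m2 SCANCTR 0 = j.+1 -> eval m2 (decr SCANCTR) = j.
    by move=> mj; rewrite -[LHS]/(m2 SCANCTR 0 - 1) mj subn1.
  have eM : eval m' (Read MARK (decr SCANCTR)) = (j \in T).
    rewrite eval_read e0// am' ?mk// /= !inE; lia.
  rewrite /body (@den_seq_set n _ _ _ _ j _ _ bm' _ eM)//; [|exact: e0|by case: (_ \in _)].
  set m2 := update m' a j _.
  have bm2 : bounded n m2 by apply: bounded_update => //; case: (_ \in _); lia.
  have j2 : m2 SCANCTR 0 = j.+1 by rewrite /m2 update_other//; lia.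
  rewrite (@den_PSet n _ _ _ _ 0 bm2)// (e0 _ j2).
  move=> i /andP[ji iN].
  have [->|ij] := eqVneq i j.
    by rewrite update_same update_other// /m2 update_same; split.
  have E c : update m2 b j 0 c i = m' c i.
    by rewrite /m2 /update (negbTE ij) !andbF.
  by rewrite !E; apply: Ij; rewrite iN andbT; move/eqP: ij; lia.
move=> m1 [bm1 am1 I0].
have nw c : c \notin [:: SCANCTR; a; b] -> c \notin SCANCTR :: writes body.
  by rewrite /= !inE.
have other c : (3 < c) && (c != SCANCTR) || (c == 0) -> c \notin SCANCTR :: writes body.
  by move=> hc; apply: nw; rewrite !inE; lia.
rewrite den_PFor (eval_capped _ bm1) -[eval m1 _]/(m1 SIGMA 0) am1; last exact: other.
rewrite msg modn_small//.
set body2 := PSet b _ _.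
pose I2 j (m' : memory) := forall i, i < n ->
  m' a i = (i \in T) /\ m' b i = (i \in drop j (take sigma W)).
have : pure (fun m' => [/\ bounded n m', agree_off (SCANCTR :: writes body2) m1 m' & I2 0 m'])
   (for_loop SCANCTR (den body2) sigma m1); last first.
  by apply: pure_imp => m' [_ _] H i /H; rewrite drop0.
apply: for_pure => //.
- by rewrite /= !inE; lia.
- move=> i iN; rewrite drop_oversize; last by rewrite size_take; case: ifP; lia.
  by have [-> ->] := I0 i iN.
- move=> j m' v _ Ij i /Ij; rewrite !update_other//; lia.
move=> j m' js bm' am' m'j Ij.
have am2 c : (3 < c) && (c != SCANCTR) || (c == 0) -> forall i, m' c i = m c i.
  move=> hc i; rewrite am'; last by rewrite /= !inE; lia.
  by rewrite am1//; exact: other.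
rewrite (@den_PSet n _ _ _ _ 1 bm')//.
have jW : j < size W by exact: leq_trans js sW.
have ei : eval m' (Read LST (cell other_side (decr SCANCTR))) = nth 0 W j.
  rewrite -[LHS]/(m' LST (eval m' other_side * m' 0 0 + (m' SCANCTR 0 - 1))).
  rewrite (eval_other (o := o)); last by rewrite am2.
  by rewrite m'j subn1 (am2 LST)// (am2 0)// m0 sW2.
rewrite ei => i iN; have [Ia Ib] := Ij i iN.
rewrite update_other//; split=> //.
have jT : j < size (take sigma W) by rewrite size_take; case: ifP.
rewrite (drop_nth 0 jT) inE nth_take// /update eqxx /=.
by case: eqVneq => //= _; exact: Ib.
Qed.

(** The output arrays hold a biclique of size [BEST] before and after every attempt, the empty one
    at the start. Only the size of the output depends on luck. *)
Definition output_ok n (A : nat -> nat) (m : memory) : Prop :=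
  exists S T : seq nat, [/\ valid n S && valid n T,
    size S = m BEST 0 /\ size T = m BEST 0,
    forall u v, u \in S -> v \in T -> A (u * n + v) != 0 &
    forall i, i < n -> (m 2 i != 0) = (i \in S) /\ (m 3 i != 0) = (i \in T)].

Definition invariant n A (m : memory) : Prop :=
  [/\ bounded n m, forall j, m 1 j = A j & output_ok n A m].

Lemma den_PIf e p q m : den (PIf e p q) m = if eval m e != 0 then den p m else den q m.
Proof. by []. Qed.

Lemma den_accept n A m r sigma : 0 < n -> final_rel n A m r -> m SIGMA 0 = sigma ->
  sound n A sigma r -> sigma <= n -> output_ok n A m ->
  pure (fun m' => [/\ output_ok n A m', m BEST 0 <= m' BEST 0 &
     accepted (sigma, r) -> sigma <= m' BEST 0]) (den p_accept m).
Proof.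
case: r => o [W T] n0 [bm mA [sW vW] mk ms] msg [sT adj] sn ok.
move: sW vW mk ms sT adj; rewrite ![(o, (W, T)).1]/= ![(o, (W, T)).2]/= ![(W, T).1]/= ![(W, T).2]/=.
move=> sW vW mk ms sT adj.
have [sW1 sW2] := sW; have [mk1 mk2 mk3] := mk.
rewrite /p_accept den_PIf.
have -> : (eval m (emul (eleq (var SIGMA) (var DISTINCT))
  (emul (eleq (var SIGMA) (Read CNT other_side))
              (eleq (eadd (var BEST) (Const 1)) (var SIGMA)))) != 0) =
   [&& sigma <= size (undup T), sigma <= size W & m BEST 0 < sigma].
  rewrite -[eval m _]/((m SIGMA 0 <= m DISTINCT 0) *
    ((m SIGMA 0 <= m CNT (eval m other_side)) * (m BEST 0 + 1 <= m SIGMA 0))).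
  rewrite (eval_other ms) msg mk2 sW1 addn1.
  by case: (_ <= _) => //; case: (_ <= _) => //; case: (_ < _).
case: ifPn => [/and3P[h1 h2 h3]|nh]; last first.
  have bn : m BEST 0 <= n by case: ok => S [? [/andP[/valid_size vS _] [<-]]].
  rewrite /set_var (@den_PSet n _ _ _ _ (m BEST 0) bm)//; split.
  - case: ok => S [T' [H1 H2 H3 H4]]; exists S, T'; split=> //.
  - by rewrite update_same.
  - rewrite update_same /accepted /= => /andP[h1 h2].
    by move: nh; rewrite h1 h2 /= -leqNgt.
rewrite /set_var (@den_seq_set n _ _ _ _ 0 sigma _ bm)//.
set m1 := update m _ _ _; rewrite den_PIf.
have bm1 : bounded n m1 by apply: bounded_update => //; exact: leqW.
have am1 : agree_off [:: BEST] m m1 by apply: agree_update; rewrite mem_head.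
have ms1 : m1 SIDE 0 = o by rewrite am1.
rewrite (eval_this ms1).
have uT : size (undup T) = sigma by apply/eqP; rewrite eqn_leq h1 andbT -sT size_undup.
have vT : valid n (undup T).
  by rewrite /valid undup_uniq; apply/allP => v; rewrite mem_undup => /(allP mk3).
have vt : valid n (take sigma W).
  case/andP: vW => uW /allP Wn; rewrite /valid take_uniq//.
  by apply/allP => v /mem_take/Wn.
have st : size (take sigma W) = sigma by rewrite size_takel.
have out a b : 1 < a < 4 -> 1 < b < 4 -> a != b ->
  pure (fun m' => [/\ bounded n m', agree_off (writes (p_output a b)) m1 m' &
    forall i, i < n -> m' a i = (i \in T) /\ m' b i = (i \in take sigma W)])
    (den (p_output a b) m1).
  move=> ha hb ab; apply: pure_frame => //; first by rewrite /= !inE; lia.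
  exact: (@den_output n m1 o).
have nzb (c : bool) : (nat_of_bool c != 0) = c by case: c.
case: o {ms ms1 sW sW1 sW2} adj out => adj out /=.
- apply: pure_imp (out 3 2 isT isT isT) => m' [bm' am' H].
  have mb : m' BEST 0 = sigma by rewrite am'// /m1 update_same.
  rewrite mb; split=> //; last exact: ltnW.
  exists (take sigma W), (undup T); rewrite vT vt mb st uT; split=> //.
  + move=> u v /mem_take uW; rewrite mem_undup => vT'; exact: adj vT' uW.
  + by move=> i /H[-> ->]; rewrite !nzb mem_undup.
- apply: pure_imp (out 2 3 isT isT isT) => m' [bm' am' H].
  have mb : m' BEST 0 = sigma by rewrite am'// /m1 update_same.
  rewrite mb; split=> //; last exact: ltnW.
  exists (undup T), (take sigma W); rewrite vT vt mb st uT; split=> //.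
  + move=> u v; rewrite mem_undup => uT' /mem_take vW'; exact: adj uT' vW'.
  + by move=> i /H[-> ->]; rewrite !nzb mem_undup.
Qed.

Lemma den_attempt n A m : 0 < n -> invariant n A m ->
  rrel (fun m' r => [/\ invariant n A m', m BEST 0 <= m' BEST 0 &
     accepted r -> r.1 <= m' BEST 0]) (den p_path m) (attempt n A).
Proof.
move=> n0 [bm mA ok]; rewrite /p_path den_PSeq /attempt.
have := rrel_frame (isT : wf p_setup) bm (den_setup n0 bm mA).
move/rrel_bind; apply => m1 q [bm1 am1 sq].
(* Reassociation separates the part that [explore] describes from the deterministic acceptance
   test. *)
have -> : den (PSeq p_steps (PSeq (PFor PHASECTR (var PHASES) p_phase) (PSeq p_final p_accept))) m1
  = bind (den (PSeq p_steps (PSeq (PFor PHASECTR (var PHASES) p_phase) p_final)) m1)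
         (den p_accept).
  rewrite [RHS]bindA; apply: (f_equal (bind (den p_steps m1))); apply: funext => m'.
  by rewrite bindA.
have wE : wf (PSeq p_steps (PSeq (PFor PHASECTR (var PHASES) p_phase) p_final)) by [].
have R := rrel_frame wE bm1 (den_explore n0 sq).
apply: rrel_bind R _ => m2 r [bm2 am2 [fr sg sr]].
have qn : q.2.2 <= n by case: sq => _ _ [_ _ _ /ltnW].
have ok2 : output_ok n A m2.
  case: ok => S [T [H1 H2 H3 H4]]; exists S, T; rewrite am2// am1//; split=> //.
  by move=> i iN; rewrite !am2// !am1//; exact: H4.
have := pure_frame (isT : wf p_accept) bm2 (den_accept n0 fr sg sr qn ok2).
case: (den p_accept m2) => //= m3 [bm3 am3 [ok3 best3 acc3]].
split; last by [].
- split=> //; move=> j; rewrite am3//.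
  by case: fr.
- by rewrite -am1// -am2.
Qed.

Definition fails (R : realFieldType) (s : nat) (m : memory) : R := (m BEST 0 < s)%N%:R.

Lemma invariant_update n A m c v : 100 <= c -> v <= n.+1 ->
  invariant n A m -> invariant n A (update m c 0 v).
Proof.
move=> hc vn [bm mA [S [T [H1 H2 H3 H4]]]].
have u a i : a < 100 -> update m c 0 v a i = m a i by move=> ha; rewrite update_other//; lia.
split; [apply: bounded_update => //; lia|by move=> j; rewrite u|].
by exists S, T; split=> //; [rewrite u|move=> i /H4; rewrite !u].
Qed.

Lemma repeat_invariant n A k m : 0 < n -> invariant n A m ->
  rall (fun m' => invariant n A m' /\ m BEST 0 <= m' BEST 0) (den (p_repeat k) m).
Proof.
move=> n0; elim: k m => [|k IH] m im.
  by apply: rrel_rall (den_attempt n0 im) _ => m' r [].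
rewrite [p_repeat _]/= den_PFor.
have [bm _ _] := im; have := eval_capped_le size_in bm; move: (eval _ _) => j jn.
elim: j jn m im {bm} => [|j IHj] jn m im.
  split; first exact: invariant_update.
  by rewrite update_other.
rewrite [for_loop _ _ _ _]/=.
have im1 : invariant n A (update m (100 + k.+1) 0 j.+1).
  by apply: invariant_update => //; exact: leqW.
apply: rall_bind (IH _ im1) _ => m' [im' b1]; apply: rall_imp (IHj (ltnW jn) _ im').
move=> m'' [im'' b2]; split=> //; apply: leq_trans b2; apply: leq_trans b1.
by rewrite update_other.
Qed.

Local Open Scope ring_scope.

(** From any memory satisfying the invariant, an attempt misses the size s with probability at most
    1 - p, and a success is permanent because [BEST] never decreases. Each level of nesting raises
    the factor to the n-th power. *)
Lemma repeat_fails (R : realFieldType) n A s (p : R) k m :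
  (0 < n)%N -> invariant n A m -> p <= 1 ->
  p <= expect (attempt n A) (fun r => (accepted r && (s <= r.1)%N)%:R) ->
  expect (den (p_repeat k) m) (fails R s) <= fails R s m * (1 - p) ^+ (n ^ k)%N.
Proof.
move=> n0 im p1 hp; have q0 : 0 <= 1 - p by lra.
elim: k m im => [|k IH] m im.
  rewrite expn0 expr1 /fails; case: (ltnP (m BEST 0)%N s) => hb; last first.
    rewrite mul0r -(expect_cst (den (p_repeat 0) m) 0).
    apply: ler_expect (repeat_invariant 0 n0 im) _ => m' [_ mm'].
    by rewrite (ltnNge (m' BEST 0)%N) (leq_trans hb mm').
  rewrite mul1r.
  apply: (@le_trans _ _ (expect (attempt n A)
     (fun r => 1 - (accepted r && (s <= r.1)%N)%:R))).
    apply: ler_expect_rrel (den_attempt n0 im) _ => m' r [_ _ ha].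
    case: (boolP (accepted r)) => [/ha hr|_] /=; last by rewrite subr0 lern1 leq_b1.
    case: (leqP s r.1) => hs; last by rewrite subr0 lern1 leq_b1.
    by rewrite subrr ltnNge (leq_trans hs hr).
  by rewrite expectB expect_cst; lra.
rewrite [p_repeat _]/= den_PFor.
have -> : eval m (capped size_in) = n.
  have [bm _ _] := im; rewrite (eval_capped _ bm) -[eval m _]/(m 0%N 0%N) (proj1 bm).
  exact: modn_small.
rewrite expnS mulnC exprM.
set Q := (1 - p) ^+ (n ^ k) in IH *; have Q0 : 0 <= Q by exact: exprn_ge0.
have : (n <= n)%N by []; move: {1 3 4}n => j jn.
elim: j jn m im => [|j IHj] jn m im.
  by rewrite expr0 mulr1 /= /fails update_other.
rewrite [for_loop _ _ _ _]/= expect_bind.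
have im1 : invariant n A (update m (100 + k.+1) 0 j.+1).
  by apply: invariant_update => //; exact: leqW.
apply: (@le_trans _ _ (expect (den (p_repeat k) (update m (100 + k.+1) 0 j.+1))
    (fun m' => Q ^+ j * fails R s m'))).
  apply: ler_expect (repeat_invariant k n0 im1) _ => m' [im' _].
  by rewrite mulrC; apply: IHj => //; exact: ltnW.
rewrite expectZ exprSr mulrA mulrAC [leLHS]mulrC.
rewrite ler_wpM2r ?exprn_ge0//; apply: le_trans (IH _ im1) _.
by rewrite /fails update_other.
Qed.

Local Close Scope ring_scope.

(** * Probability of success of one attempt *)

Local Open Scope ring_scope.

Lemma sum_modn (R : realFieldType) (g : nat -> R) q m :
  \sum_(0 <= j < q * m) g (j %% m)%N = q%:R * \sum_(0 <= i < m) g i.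
Proof.
elim: q => [|q IH]; first by rewrite mul0n big_geq// mul0r.
rewrite mulSn addnC (@big_cat_nat _ _ _ (q * m))//= ?leq_addr// IH.
rewrite -natr1 mulrDl mul1r; congr (_ + _).
rewrite -{1}[(q * m)%N]add0n big_addn addnC addnK.
by apply: eq_big_nat => i /andP[_ im]; rewrite addnC modnMDl modn_small.
Qed.

Lemma expect_rnd (R : realFieldType) n m (g : nat -> R) : (0 < m)%N -> (m <= n)%N ->
  expect (rnd n m) g = (\sum_(0 <= j < 2 ^ n) g (j %% m)%N) / (2 ^ n)%:R.
Proof.
move=> m0 mn; rewrite /rnd.
(* From accumulator a, the remaining k bits, read as a number j, lead to a * 2^k + j modulo m; the
   next bit decides in which half of its range j lies. *)
have H k a : (a < m)%N ->
    expect (iterM (fun acc => Toss (fun b : bool => Ret (((2 * acc + b) %% m) %% n.+1)%N)) k a) g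
    = (\sum_(0 <= j < 2 ^ k) g ((a * 2 ^ k + j) %% m)%N) / (2 ^ k)%:R.
  elim: k a => [|k IH] a am.
    by rewrite expn0 divr1 big_nat1 muln1 addn0 modn_small.
  rewrite /=; have sm b : (((2 * a + b) %% m) %% n.+1 = (2 * a + b) %% m)%N.
    by rewrite modn_small// ltnS (leq_trans _ mn)// ltnW// ltn_mod.
  rewrite !sm !IH ?ltn_mod//.
  have -> : (\sum_(0 <= j < 2 ^ k.+1) g ((a * 2 ^ k.+1 + j) %% m)%N =
    \sum_(0 <= j < 2 ^ k) g ((((2 * a + true) %% m) * 2 ^ k + j) %% m)%N +
    \sum_(0 <= j < 2 ^ k) g ((((2 * a + false) %% m) * 2 ^ k + j) %% m)%N).
    rewrite addrC expnS mul2n -addnn (@big_cat_nat _ _ _ (2 ^ k))//= ?leq_addr//.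
    congr (_ + _).
      apply: eq_bigr => j _; congr (g _).
      by rewrite -[RHS]modnDml modnMml modnDml; congr (_ %% _)%N; lia.
    rewrite -{1}[(2 ^ k)%N]add0n big_addn addnK.
    apply: eq_bigr => j _; congr (g _).
    by rewrite -[RHS]modnDml modnMml modnDml; congr (_ %% _)%N; lia.
  rewrite expnS natrM; field.
  by rewrite pnatr_eq0 expn_eq0.
by rewrite H//; congr (_ / _); apply: eq_bigr => j _; rewrite mul0n add0n.
Qed.

(** With N = 2^n and q the integer part of N/m, each residue occurs q or q + 1 times. Since q is at
    least 1, both numbers lie between N/(2m) and 2N/m. *)
Lemma expect_rnd_bounds (R : realFieldType) n m (g : nat -> R) :
  (0 < m)%N -> (m <= n)%N -> (forall i, 0 <= g i) ->
  (\sum_(0 <= i < m) g i) / (2 * m)%:R <= expect (rnd n m) g <=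
  (\sum_(0 <= i < m) g i) * 2 / m%:R.
Proof.
move=> m0 mn g0; rewrite expect_rnd//.
set S := \sum_(0 <= i < m) g i; have S0 : 0 <= S by exact: sumr_ge0.
have Nm : (m <= 2 ^ n)%N by apply: leq_trans mn (ltnW (ltn_expl _ _)).
move: (2 ^ n)%N Nm => N Nm; set q := (N %/ m)%N.
have q1 : (1 <= q)%N by rewrite divn_gt0.
have qN : (q * m <= N)%N by exact: leq_trunc_div.
have Nq : (N <= q.+1 * m)%N by exact/ltnW/ltn_ceil.
have qm : (m <= q * m)%N by exact: leq_pmull.
rewrite mulSn in Nq.
have mR : 0 < m%:R :> R by rewrite ltr0n.
have NR : 0 < N%:R :> R by rewrite ltr0n; lia.
have lo : q%:R * S <= \sum_(0 <= j < N) g (j %% m)%N.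
  by rewrite -sum_modn [leRHS](@big_cat_nat _ _ _ (q * m))//= lerDl; exact: sumr_ge0.
have Nq1 : (N <= q.+1 * m)%N by rewrite mulSn.
have hi : \sum_(0 <= j < N) g (j %% m)%N <= q.+1%:R * S.
  by rewrite -sum_modn [leRHS](@big_cat_nat _ _ _ N)//= lerDl; exact: sumr_ge0.
apply/andP; split.
  rewrite ler_pdivrMr ?ltr0n ?muln_gt0// mulrAC ler_pdivlMr//.
  rewrite [X in _ <= X](_ : _ = (2 * m)%:R * \sum_(0 <= j < N) g (j %% m)%N); last by ring.
  apply: le_trans (ler_wpM2l _ lo) => //.
  rewrite mulrA -natrM mulrC ler_wpM2r// ler_nat; nia.
rewrite ler_pdivrMr// mulrAC ler_pdivlMr//.
apply: (@le_trans _ _ (q.+1%:R * S * m%:R)); first by rewrite ler_wpM2r.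
rewrite mulrAC -natrM.
rewrite [leRHS](_ : _ = (2 * N)%:R * S); last by rewrite natrM; ring.
rewrite ler_wpM2r// ler_nat mulSn; lia.
Qed.

Lemma expect_pick (R : realFieldType) n Z (g : nat -> R) : valid n Z -> (0 < size Z)%N ->
  (forall x, 0 <= g x) ->
  (\sum_(x <- Z) g x) / (2 * size Z)%:R <= expect (pick n Z) g <=
  (\sum_(x <- Z) g x) * 2 / (size Z)%:R.
Proof.
move=> vZ Z0 g0; rewrite /pick expect_bind /= Z0.
rewrite (@eq_expect _ _ _ _ (fun i => g (nth 0%N Z i))); last first.
  by move=> i; rewrite muln1.
by rewrite (big_nth 0%N); apply: expect_rnd_bounds => //; exact: valid_size.
Qed.

Lemma pick_mem n Z : (0 < size Z)%N -> (size Z <= n)%N -> rall (fun x => x \in Z) (pick n Z).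
Proof.
move=> Z0 Zn; rewrite /pick Z0; apply: rall_bind (rnd_lt Z0 Zn) _ => i iZ /=.
by rewrite muln1 mem_nth.
Qed.

Lemma sum_count (R : realFieldType) (P : pred nat) (s : seq nat) :
  \sum_(x <- s) (P x)%:R = (count P s)%:R :> R.
Proof.
by elim: s => [|x s IH]; rewrite ?big_nil// big_cons IH /= natrD.
Qed.

Lemma pick_pred_ge (R : realFieldType) n Z (P : pred nat) : valid n Z -> (0 < size Z)%N ->
  (count P Z)%:R / (2 * size Z)%:R <= expect (pick n Z) (fun x => (P x)%:R) :> R.
Proof.
move=> vZ Z0; have /andP[h _] := @expect_pick R n Z (fun x => (P x)%:R) vZ Z0 (fun=> ler0n _ _).
by rewrite -sum_count.
Qed.

Lemma pick_pred_le (R : realFieldType) n Z (P : pred nat) : valid n Z -> (0 < size Z)%N ->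
  expect (pick n Z) (fun x => (P x)%:R) <= (count P Z)%:R * 2 / (size Z)%:R :> R.
Proof.
move=> vZ Z0; have /andP[_ h] := @expect_pick R n Z (fun x => (P x)%:R) vZ Z0 (fun=> ler0n _ _).
by rewrite -sum_count.
Qed.

Lemma rnd_ge (R : realFieldType) n m i (g : nat -> R) : (i < m)%N -> (m <= n)%N ->
  (forall i, 0 <= g i) -> g i / (2 * m)%:R <= expect (rnd n m) g.
Proof.
move=> im mn g0; have m0 : (0 < m)%N by exact: leq_ltn_trans im.
have /andP[h _] := expect_rnd_bounds m0 mn g0; apply: le_trans h.
rewrite ler_wpM2r ?invr_ge0 ?ler0n// (bigD1_seq i)/= ?iota_uniq ?mem_index_iota//.
by rewrite lerDl sumr_ge0.
Qed.

(** Convexity: the tangent to the k-th power at b lies below the graph. Summed over g, it gives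
    Jensen's inequality. *)
Lemma expr_tangent (R : realFieldType) (b g : R) k : 0 <= b -> 0 <= g ->
  b ^+ k + k%:R * b ^+ k.-1 * (g - b) <= g ^+ k.
Proof.
move=> b0 g0; elim: k => [|k IH]; first by rewrite !expr0 mul0r mul0r addr0.
have h := ler_wpM2l g0 IH; rewrite -exprS in h; apply: le_trans h.
rewrite -subr_ge0 -natr1 /=.
have -> : k%:R * b ^+ k.-1 * (g - b) = k%:R * b ^+ k.-1 * g - k%:R * b ^+ k.
  case: k {IH} => [|k]; first by rewrite !mul0r subr0.
  by rewrite /= exprS; ring.
have -> : g * (b ^+ k + (k%:R * b ^+ k.-1 * g - k%:R * b ^+ k)) -
    (b ^+ k.+1 + (k%:R + 1) * b ^+ k * (g - b)) =
    k%:R * (b ^+ k.-1 * g ^+ 2 - 2 * b ^+ k * g + b ^+ k.+1).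
  rewrite exprS; ring.
case: k {IH} => [|k]; first by rewrite mul0r.
have -> : b ^+ k.+1.-1 * g ^+ 2 - 2 * b ^+ k.+1 * g + b ^+ k.+2 = b ^+ k * (g - b) ^+ 2.
  by rewrite /= !exprS expr0; ring.
by apply: mulr_ge0 => //; apply: mulr_ge0; [exact: exprn_ge0|exact: sqr_ge0].
Qed.

Definition adj_prob (R : realFieldType) n A o Z v : R :=
  expect (pick n Z) (fun x => (~~ nonadj n A o x v)%:R).

Lemma big_filter_nat (R : realFieldType) (P : pred nat) (s : seq nat) (c : nat -> R) :
  \sum_(v <- [seq v <- s | P v]) c v = \sum_(v <- s) (P v)%:R * c v.
Proof.
rewrite big_filter big_mkcond; apply: eq_bigr => v _.
by case: (P v); rewrite ?mul1r ?mul0r.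
Qed.

(** A fixed v survives each step with probability [adj_prob], independently of the other steps.
    Linearity of expectation makes the dependence between different v harmless. *)
Lemma steps_weight (R : realFieldType) n A o Z k W T (c : nat -> R) : (size W <= n)%N ->
  expect (iterM (step n A o false n Z) k (W, T)) (fun y => \sum_(v <- y.1) c v) =
  \sum_(v <- W) c v * adj_prob R n A o Z v ^+ k.
Proof.
elim: k W T c => [|k IH] W T c Wn; first by apply: eq_bigr => v _; rewrite expr0 mulr1.
rewrite [iterM _ _ _]/= expect_bind /step expect_bind.
rewrite (@eq_expect _ _ _ _ (fun x => \sum_(v <- W) (c v * adj_prob R n A o Z v ^+ k) *
   (~~ nonadj n A o x v)%:R)).
  by rewrite expect_sum; apply: eq_bigr => v _; rewrite expectZ exprSr mulrA.
move=> x /=; rewrite split_seq_full// IH; last first.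
  by apply: leq_trans Wn; rewrite size_filter count_size.
by rewrite big_filter_nat; apply: eq_bigr => v _; rewrite mulrC.
Qed.

(** Every pick repeats an earlier one with probability at most 2/|Z| for each earlier vertex, and
    there are never more than [size T + k] of these. *)
Lemma steps_collisions (R : realFieldType) n A o h cap Z k W T :
  valid n Z -> (0 < size Z)%N ->
  expect (iterM (step n A o h cap Z) k (W, T))
    (fun y => (size y.2)%:R - (size (undup y.2))%:R) <=
  (size T)%:R - (size (undup T))%:R + k%:R * (2 * (size T + k)%:R / (size Z)%:R) :> R.
Proof.
move=> vZ Z0; have zR : 0 < (size Z)%:R :> R by rewrite ltr0n.
elim: k W T => [|k IH] W T; first by rewrite /= mul0r addr0.
rewrite [iterM _ _ _]/= expect_bind /step expect_bind.
apply: (@le_trans _ _ (expect (pick n Z) (fun x => ((size T)%:R - (size (undup T))%:R +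
    k%:R * (2 * (size T + k.+1)%:R / (size Z)%:R)) + (x \in T)%:R))).
  apply: ler_expectT => x /=; apply: le_trans (IH _ _) _ => /=.
  rewrite addSnnS; case: (x \in T) => /=; rewrite -natr1; first lra.
  by rewrite -[X in _ - X]natr1; lra.
rewrite expectD expect_cst; set q := 2 * _ / _.
suff : expect (pick n Z) (fun x => (x \in T)%:R) <= q by rewrite -[k.+1%:R]natr1; lra.
apply: le_trans (pick_pred_le R (mem T) vZ Z0) _.
rewrite /q ler_pM2r ?invr_gt0// mulrC ler_pM2l// ler_nat.
apply: (@leq_trans (size T)); last by rewrite leq_addr.
rewrite -size_filter uniq_leq_size ?filter_uniq//; first by case/andP: vZ.
by move=> x; rewrite mem_filter => /andP[].
Qed.

(** Each vertex of Z misses at most a fraction 1/D of W, so the survival probabilities of the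
    vertices of W average at least b, and by convexity their sigma-th powers average at least
    b^sigma. The other terms pay for having fewer than sigma survivors and for repeated picks; the
    division by 2 pays for the coin choosing the side. *)
Lemma final_success (R : realFieldType) n A o D sigma L (b := 1 - D%:R^-1 : R)
    (Z := low_degree n A o D (chooser o L) (target o L)) (W := target o L) :
  (0 < D)%N -> valid n (chooser o L) -> valid n W -> (0 < size Z)%N -> (0 < size W)%N ->
  (b ^+ sigma - sigma%:R / (size W)%:R - 2 * sigma%:R ^+ 2 / (size Z)%:R) / 2 <=
  expect (final n A D sigma L) (fun r => (accepted (sigma, r))%:R).
Proof.
move=> D0 vC vW Z0 W0.
pose E (o' : bool) : R := expect (bind (steps n A o' false n
    (low_degree n A o' D (chooser o' L) (target o' L)) sigma (target o' L))
  (fun y => Ret (o', y))) (fun r => (accepted (sigma, r))%:R).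
rewrite -[leRHS]/((E true + E false) / 2).
suff H : b ^+ sigma - sigma%:R / (size W)%:R - 2 * sigma%:R ^+ 2 / (size Z)%:R <= E o.
  have E0 o' : 0 <= E o' by apply: expect_ge0 => r; exact: ler0n.
  rewrite ler_pM2r ?invr_gt0 ?ltr0n//; apply: le_trans H _.
  by case: (o); [rewrite lerDl|rewrite lerDr].
rewrite /E expect_bind /= -/W -/Z.
have Wn := valid_size vW.
have vZ : valid n Z.
  case/andP: vC => uC /allP Cn; rewrite /valid filter_uniq//.
  by apply/allP => v; rewrite mem_filter => /andP[_ /Cn].
have wR : 0 < (size W)%:R :> R by rewrite ltr0n.
have DR : 0 < D%:R :> R by rewrite ltr0n.
have b0 : 0 <= b by rewrite subr_ge0 invf_le1// ler1n.
set g := adj_prob R n A o Z.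
have g0 v : 0 <= g v by apply: expect_ge0 => x; exact: ler0n.
have sumg : (size W)%:R * b <= \sum_(v <- W) g v.
  rewrite /g /adj_prob -expect_sum -[leLHS](expect_cst (pick n Z)).
  apply: ler_expect (pick_mem Z0 (valid_size vZ)) _ => x.
  rewrite mem_filter => /andP[xD _]; rewrite sum_count.
  have := count_predC (nonadj n A o x) W => cW.
  rewrite -[in leLHS]cW; rewrite /b mulrBr mulr1 natrD.
  have : (count (nonadj n A o x) W)%:R <= (size W)%:R / D%:R :> R.
    by rewrite ler_pdivlMr// -natrM ler_nat mulnC.
  rewrite -cW natrD; lra.
have powg : (size W)%:R * b ^+ sigma <= \sum_(v <- W) g v ^+ sigma.
  apply: (@le_trans _ _ (\sum_(v <- W) (b ^+ sigma + sigma%:R * b ^+ sigma.-1 * (g v - b)))).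
    rewrite big_split/= -mulr_sumr sumrB !big_const_seq !count_predT.
    rewrite !iter_addr_0 -[b ^+ sigma *+ _]mulr_natl -[b *+ _]mulr_natl lerDl.
    by apply: mulr_ge0; [apply: mulr_ge0 => //; exact: exprn_ge0|rewrite subr_ge0].
  by apply: ler_sum => v _; exact: expr_tangent.
have ES : (size W)%:R * b ^+ sigma <=
    expect (steps n A o false n Z sigma W) (fun y => (size y.1)%:R).
  rewrite (@eq_expect _ _ _ _ (fun y => \sum_(v <- y.1) (1 : R))); last first.
    by move=> y; rewrite big_const_seq count_predT iter_addr_0.
  by rewrite steps_weight//; under eq_bigr do rewrite mul1r.
have EC : expect (steps n A o false n Z sigma W)
    (fun y => (size y.2)%:R - (size (undup y.2))%:R) <=
    sigma%:R * (2 * sigma%:R / (size Z)%:R) :> R.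
  have := steps_collisions R A o false n sigma W [::] vZ Z0.
  by rewrite [size (undup [::])]/= subrr add0r add0n.
(* The integrand lies below the indicator of acceptance: it is at most 1, and at most 0 when there
   are fewer than sigma survivors or at least one repeated pick. *)
apply: (@le_trans _ _ (expect (steps n A o false n Z sigma W) (fun y =>
   (size y.1)%:R / (size W)%:R - sigma%:R / (size W)%:R -
   ((size y.2)%:R - (size (undup y.2))%:R)))).
  rewrite !expectB expect_cst lerB//; last first.
    rewrite expectB in EC; apply: le_trans EC _; rewrite le_eqVlt; apply/orP; left; apply/eqP; ring.
  rewrite lerB//; under [leRHS]eq_expect do rewrite mulrC.
  by rewrite expectZ mulrC ler_pdivlMr// mulrC.
apply: ler_expect (steps_sound A o Z sigma Wn) _ => -[W' T] /= [sW sT _].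
rewrite /accepted /= sT.
have hW : (size W')%:R / (size W)%:R <= 1 :> R.
  by rewrite ler_pdivrMr// mul1r ler_nat size_subseq.
have hs : 0 <= sigma%:R / (size W)%:R :> R by rewrite divr_ge0.
have hu : (size (undup T) <= sigma)%N by rewrite -sT size_undup.
case: (leqP sigma (size (undup T))) => h1 /=; last first.
  have : (size (undup T))%:R + 1 <= sigma%:R :> R by rewrite natr1 ler_nat.
  lra.
have : (size (undup T))%:R <= sigma%:R :> R by rewrite ler_nat.
case: (leqP sigma (size W')) => h2 h3; rewrite ?mulr1n ?mulr0n; first lra.
have : (size W')%:R / (size W)%:R <= sigma%:R / (size W)%:R :> R.
  by rewrite ler_wpM2r ?invr_ge0// ler_nat ltnW.
have : sigma%:R <= (size (undup T))%:R :> R by rewrite ler_nat.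
lra.
Qed.

(** * Walks in a graph with a planted biclique *)

Definition side_pred (PA PB : pred nat) (o : bool) : pred nat := if o then PB else PA.

Definition planted n (A : nat -> nat) (PA PB : pred nat) : Prop :=
  forall x v, (x < n)%N -> (v < n)%N -> PA x -> PB v -> A (x * n + v)%N != 0%N.

Lemma planted_adj n A PA PB o x v : planted n A PA PB -> (x < n)%N -> (v < n)%N ->
  side_pred PA PB o x -> side_pred PA PB (~~ o) v -> nonadj n A o x v = false.
Proof.
by move=> pl xn vn; rewrite /nonadj; case: o => /= px pv; apply/negbTE/pl.
Qed.

Lemma count_filter_sub (P Q : pred nat) (s : seq nat) :
  (forall v, v \in s -> P v -> Q v) -> count P [seq v <- s | Q v] = count P s.
Proof.
move=> PQ; rewrite count_filter; apply: eq_in_count => v vs /=.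
by case Pv: (P v) => //=; apply: PQ vs Pv.
Qed.

Lemma filter_valid n (P : pred nat) W : valid n W -> valid n [seq v <- W | P v].
Proof.
case/andP=> uW /allP Wn; rewrite /valid filter_uniq//.
by apply/allP => v; rewrite mem_filter => /andP[_ /Wn].
Qed.

(** All picks satisfy P with probability p^tau; then no planted vertex of W is deleted, and Markov's
    inequality with threshold [theta] limits the surviving bad vertices. Instead of conditioning,
    the induction counts only picks in P, both in p and in g; other picks contribute at least 0
    because [phi] is nonnegative. *)
Lemma steps_planted (R : realFieldType) n A o PA PB Z (bad : pred nat) (theta c : R)
    (phi : seq nat -> R) k
    (P := side_pred PA PB o) (p := expect (pick n Z) (fun x => (P x)%:R) : R)
    (g := fun v => expect (pick n Z) (fun x => (P x && ~~ nonadj n A o x v)%:R) : R) :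
  planted n A PA PB -> valid n Z -> (0 < size Z)%N -> 0 <= c ->
  (forall W, 0 <= phi W) ->
  (forall W, valid n W -> count (side_pred PA PB (~~ o)) W = k ->
     c * (1 - theta^-1 * (count bad W)%:R) <= phi W) ->
  forall tau W T, valid n W -> count (side_pred PA PB (~~ o)) W = k ->
  c * (p ^+ tau - theta^-1 * \sum_(v <- W) (bad v)%:R * g v ^+ tau) <=
  expect (iterM (step n A o false n Z) tau (W, T)) (fun y => phi y.1).
Proof.
move=> pl vZ Z0 c0 phi0 phic; elim=> [|tau IH] W T vW Wk.
  rewrite expr0 /=; under eq_bigr do rewrite expr0 mulr1.
  by rewrite sum_count; exact: phic.
rewrite [iterM _ _ _]/= expect_bind /step expect_bind.
apply: (@le_trans _ _ (expect (pick n Z) (fun x => c * ((P x)%:R * p ^+ tau -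
   theta^-1 * \sum_(v <- W) (bad v)%:R * g v ^+ tau * (P x && ~~ nonadj n A o x v)%:R)))).
  rewrite expectZ expectB expectZ expect_sum.
  rewrite (@eq_expect _ _ _ (fun x => (P x)%:R * p ^+ tau) (fun x => p ^+ tau * (P x)%:R));
    last by move=> x; rewrite mulrC.
  rewrite expectZ -/p -exprSr ler_wpM2l// lerB// le_eqVlt; apply/orP; left; apply/eqP.
  by congr (_ * _); apply: eq_bigr => v _; rewrite expectZ exprSr mulrA.
apply: ler_expect (pick_mem Z0 (valid_size vZ)) _ => x xZ /=.
have xn : (x < n)%N by case/andP: vZ => _ /allP; apply.
rewrite split_seq_full ?valid_size//.
case Px: (P x); last first.
  rewrite mul0r; under eq_bigr do rewrite mulr0; rewrite big1// mulr0 subrr mulr0.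
  exact: expect_ge0.
rewrite mul1r; apply: le_trans _ (IH _ _ (filter_valid _ vW) _); last first.
  rewrite count_filter_sub// => v vW' Pv; apply/negbT/(planted_adj pl) => //.
  by case/andP: vW => _ /allP; apply.
rewrite le_eqVlt; apply/orP; left; apply/eqP; congr (_ * (_ - _ * _)).
rewrite big_filter_nat; apply: eq_bigr => v _; by rewrite /= mulrC.
Qed.

Lemma count_sum (P : pred nat) s : count P s = (\sum_(x <- s) P x)%N.
Proof. by elim: s => [|x s IH]; rewrite ?big_nil// big_cons /= IH. Qed.

(* Counts the pairs of a vertex of A and a non-neighbour in W: if few vertices
   of W are bad, at most half of A misses more than a fraction 1/D of W. *)
Lemma size_low_degree n A PA PB D k W : planted n A PA PB ->
  valid n W -> count PA (iota 0 n) = k -> count PB W = k ->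
  (4 * D * count (fun v => (k <= 4 * D * count (fun x => PA x && nonadj n A false x v)
     (iota 0 n))%N) W <= k)%N ->
  (0 < k)%N ->
  (k <= 2 * size (low_degree n A false D (iota 0 n) W))%N.
Proof.
move=> pl vW cA cB; set bad := fun v => _; move=> hbad k0.
set cnt := fun v => count (fun x => PA x && nonadj n A false x v) (iota 0 n).
pose high u := PA u && (size W < D * count (nonadj n A false u) W)%N.
have kW : (k <= size W)%N by rewrite -cB count_size.
have sumE : (\sum_(v <- W) cnt v =
    \sum_(u <- iota 0 n) PA u * count (nonadj n A false u) W)%N.
  transitivity (\sum_(v <- W) \sum_(u <- iota 0 n) (PA u && nonadj n A false u v))%N.
    by apply: eq_bigr => v _; exact: count_sum.
  rewrite exchange_big/=; apply: eq_bigr => u _; case: (PA u); last by rewrite big1.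
  by rewrite mul1n count_sum.
(* 4 * D * [cnt v] is at most k for a good v and at most 4 * D * k for a bad one. By [hbad] and k <=
   |W|, each kind contributes at most k * |W|. *)
have h1 : (4 * D * (\sum_(v <- W) cnt v) <= 2 * size W * k)%N.
  apply: (@leq_trans (\sum_(v <- W) (k + 4 * D * k * bad v))%N).
    rewrite big_distrr/=; apply: leq_sum => v _.
    have ck : (cnt v <= k)%N by rewrite -cA; apply: sub_count => x /andP[].
    rewrite /bad -/(cnt v); case: (leqP k (4 * D * cnt v)) => hv; last by rewrite muln0 addn0 ltnW.
    by rewrite muln1 (leq_trans _ (leq_addl _ _))// leq_mul2l ck orbT.
  rewrite big_split/= big_const_seq count_predT iter_addn_0 -big_distrr/=.
  rewrite (_ : \sum_(v <- W) bad v = count bad W)%N; last by rewrite count_sum.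
  rewrite [(2 * _ * _)%N](_ : _ = k * size W + size W * k)%N; last by ring.
  by rewrite leq_add// mulnAC leq_mul// (leq_trans hbad).
have h2 : (4 * (count high (iota 0 n) * size W) <=
    4 * D * \sum_(u <- iota 0 n) PA u * count (nonadj n A false u) W)%N.
  rewrite -mulnA leq_mul2l /= count_sum big_distrl big_distrr/=.
  apply: leq_sum => u _; rewrite /high; case: (PA u) => /=; last by rewrite !mul0n.
  by rewrite mul1n; case: (ltnP (size W)) => //; rewrite mul1n; exact: ltnW.
have h3 : (2 * count high (iota 0 n) <= k)%N.
  have W0 : (0 < size W)%N by exact: leq_trans kW.
  rewrite -sumE in h2; have hh := leq_trans h2 h1.
  by rewrite -(leq_pmul2r W0); nia.
have h4 : (count PA (iota 0 n) <= count high (iota 0 n) +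
    size (low_degree n A false D (iota 0 n) W))%N.
  rewrite /low_degree size_filter -[count PA _]addn0.
  rewrite -(count_predUI high) leq_add//.
  apply: sub_count => u Pu; rewrite /= /high Pu /=.
  by case: (leqP (D * _)).
rewrite cA in h4; lia.
Qed.

Lemma iota_valid n : valid n (iota 0 n).
Proof. by rewrite /valid iota_uniq; apply/allP => i; rewrite mem_iota. Qed.

(** The hypothesis on tau makes the expected number of bad survivors, divided by its threshold
    k/(4D), at most half of the chance that all picks lie in A. The final stage then succeeds with
    probability at least (y - y/4 - y/4)/2 = y/4. *)
Lemma sparse_success (R : realFieldType) n A PA PB k D tau sigma
    (y := (1 - D%:R^-1) ^+ sigma : R) :
  planted n A PA PB -> count PA (iota 0 n) = k -> count PB (iota 0 n) = k ->
  (0 < k)%N -> (0 < D)%N ->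
  4 * D%:R / k%:R * n%:R * (1 - (16 * D%:R)^-1) ^+ tau <= 2^-1 :> R ->
  sigma%:R / k%:R <= y / 4 -> 4 * sigma%:R ^+ 2 / k%:R <= y / 4 ->
  (k%:R / (2 * n)%:R) ^+ tau * y / 8 <=
  expect (explore n A ((tau, 0%N), (D, sigma))) (fun r => (accepted (sigma, r))%:R).
Proof.
move=> pl cA cB k0 D0 htau hs1 hs2.
have kR : 0 < k%:R :> R by rewrite ltr0n.
have DR : 0 < D%:R :> R by rewrite ltr0n.
have y0 : 0 <= y by rewrite exprn_ge0// subr_ge0 invf_le1// ler1n.
have kn : (k <= n)%N by rewrite -cA -[leqRHS](size_iota 0 n) count_size.
have n0 : (0 < n)%N by exact: leq_trans kn.
have nR : 0 < n%:R :> R by rewrite ltr0n.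
set Z := iota 0 n; have vZ : valid n Z := iota_valid n.
have zE : size Z = n by rewrite size_iota.
have Z0 : (0 < size Z)%N by rewrite zE.
set cnt := fun v => count (fun x => PA x && nonadj n A false x v) Z.
set bad := fun v => (k <= 4 * D * cnt v)%N.
set theta : R := k%:R / (4 * D%:R).
have th0 : 0 < theta by rewrite divr_gt0// mulr_gt0.
set phi : seq nat -> R := fun W => expect (final n A D sigma (Z, W)) (fun r => (accepted (sigma, r))%:R).
have phi0 W : 0 <= phi W by exact: expect_ge0.
(* If at most [theta] bad vertices remain, half of A has low degree; otherwise the left side is not
   positive. *)
have phic W : valid n W -> count (side_pred PA PB (~~ false)) W = k ->
    y / 4 * (1 - theta^-1 * (count bad W)%:R) <= phi W.
  move=> vW cW; case: (leqP (4 * D * count bad W) k) => hb; last first.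
    apply: le_trans (phi0 W); apply: mulr_ge0_le0; first by rewrite divr_ge0.
    rewrite subr_le0 /theta invf_div mulrAC ler_pdivlMr// mul1r.
    by rewrite -!natrM ler_nat ltnW.
  have hZ := size_low_degree pl vW cA cW hb k0.
  have kW : (k <= size W)%N by rewrite -cW count_size.
  apply: (@le_trans _ _ (y / 4)).
    by rewrite ler_piMr ?divr_ge0// gerBl mulr_ge0// invr_ge0 ltW.
  have Zp : (0 < size (low_degree n A false D Z W))%N.
    by rewrite -/Z in hZ; move: k0 hZ; case: (size _) => //; lia.
  have := @final_success R n A false D sigma (Z, W) D0 vZ vW Zp (leq_trans k0 kW).
  apply: le_trans.
  rewrite /= -/y; set z := size _ in hZ *.
  have zR : 0 < z%:R :> R by rewrite ltr0n; lia.
  have WR : 0 < (size W)%:R :> R by rewrite ltr0n; lia.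
  have h1 : sigma%:R / (size W)%:R <= sigma%:R / k%:R :> R.
    by rewrite ler_wpM2l// lef_pV2 ?posrE// ler_nat.
  have h2 : 2 * sigma%:R ^+ 2 / z%:R <= 4 * sigma%:R ^+ 2 / k%:R :> R.
    rewrite ler_pdivrMr// mulrAC ler_pdivlMr//.
    rewrite [leRHS](_ : _ = 2 * sigma%:R ^+ 2 * (2 * z%:R)); last by ring.
    by rewrite ler_wpM2l ?mulr_ge0 ?sqr_ge0// -natrM ler_nat.
  lra.
set p : R := expect (pick n Z) (fun x => (PA x)%:R).
have p_lo : k%:R / (2 * n)%:R <= p.
  by have := pick_pred_ge R PA vZ Z0; rewrite cA zE.
have p_hi : p <= k%:R * 2 / n%:R.
  by have := pick_pred_le R PA vZ Z0; rewrite cA zE.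
have p0 : 0 <= p by exact: expect_ge0.
set g : nat -> R := fun v => expect (pick n Z) (fun x => (PA x && ~~ nonadj n A false x v)%:R).
have q1 : (16 * D%:R)^-1 <= 1 :> R.
  by rewrite invf_le1 ?mulr_gt0// -natrM ler1n muln_gt0.
have g0 v : 0 <= g v by exact: expect_ge0.
(* A bad v misses at least k/(4D) vertices of A, which are hit with probability at least k/(8Dn),
   while p <= 2k/n; the quotient of the two is 1/(16D). *)
have g_bad v : bad v -> g v <= p * (1 - (16 * D%:R)^-1).
  move=> bv.
  have gE : g v = p - expect (pick n Z) (fun x => (PA x && nonadj n A false x v)%:R).
    rewrite -expectB; apply: eq_expect => x.
    by case: (PA x); case: (nonadj n A false x v); rewrite /= ?subr0 ?subrr.
  rewrite gE mulrBr mulr1 lerB//.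
  apply: le_trans (pick_pred_ge R _ vZ Z0); rewrite -/(cnt v) zE.
  have h : k%:R / (4 * D%:R) <= (cnt v)%:R :> R.
    by rewrite ler_pdivrMr ?mulr_gt0// mulrC -!natrM ler_nat.
  apply: (@le_trans _ _ (k%:R / (4 * D%:R) / (2 * n)%:R)).
    apply: (@le_trans _ _ (k%:R * 2 / n%:R * (16 * D%:R)^-1)).
      by rewrite ler_wpM2r// invr_ge0 mulr_ge0.
    rewrite le_eqVlt; apply/orP; left; apply/eqP; rewrite natrM; field.
    by rewrite !gt_eqF.
  by rewrite ler_wpM2r// invr_ge0.
have SP := @steps_planted R n A false PA PB Z bad theta (y / 4) phi k pl vZ Z0 _ phi0 phic tau Z [::] vZ cB.
rewrite /explore [X in expect (bind _ X) _](_ : _ = fun y => final n A D sigma (Z, y.1)) //.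
rewrite expect_bind; apply: le_trans (SP _); last by rewrite divr_ge0.
rewrite -/p -/g.
have sb : \sum_(v <- Z) (bad v)%:R * g v ^+ tau <= n%:R * (p * (1 - (16 * D%:R)^-1)) ^+ tau.
  apply: (@le_trans _ _ (\sum_(v <- Z) (p * (1 - (16 * D%:R)^-1)) ^+ tau)).
    apply: ler_sum => v _; case bv: (bad v); last first.
      by rewrite mul0r exprn_ge0// mulr_ge0// subr_ge0.
    by rewrite mul1r lerXn2r ?nnegrE ?g_bad// mulr_ge0// subr_ge0.
  by rewrite big_const_seq count_predT zE iter_addr_0 -[leLHS]mulr_natl lexx.
have pt0 : 0 <= p ^+ tau by rewrite exprn_ge0.
have hh : theta^-1 * \sum_(v <- Z) (bad v)%:R * g v ^+ tau <= p ^+ tau / 2.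
  apply: (@le_trans _ _ (theta^-1 * (n%:R * (p * (1 - (16 * D%:R)^-1)) ^+ tau))).
    by rewrite ler_wpM2l// invr_ge0 ltW.
  rewrite exprMn /theta invf_div.
  have := ler_wpM2l pt0 htau; apply: le_trans; rewrite le_eqVlt; apply/orP; left; apply/eqP.
  ring.
have pk : (k%:R / (2 * n)%:R) ^+ tau <= p ^+ tau by rewrite lerXn2r ?nnegrE ?divr_ge0.
apply: (@le_trans _ _ (p ^+ tau * y / 8)).
  rewrite -!mulrA; apply: ler_wpM2r pk.
  by apply: mulr_ge0; rewrite ?invr_ge0.
apply: (@le_trans _ _ (y / 4 * (p ^+ tau - p ^+ tau / 2))).
  rewrite le_eqVlt; apply/orP; left; apply/eqP; by field.
by apply: ler_wpM2l; [rewrite divr_ge0|rewrite lerB].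
Qed.

(** * Density increments by capped walks *)

Lemma split_seq_true f cap W : split_seq f cap true W = take cap [seq v <- W | f v].
Proof.
elim: W cap => [|v W IH] cap; first by case: cap.
rewrite /= IH; case: (f v) => /=; last by rewrite subn0.
by case: cap => [|cap] /=; rewrite ?take0// subn1.
Qed.

Lemma size_piece f cap W : size (split_seq f cap true W) = minn cap (count f W).
Proof. by rewrite split_seq_true size_take size_filter. Qed.

Lemma count_split (P : pred nat) f cap W :
  (count P (split_seq f cap true W) + count P (split_seq f cap false W))%N = count P W.
Proof.
elim: W cap => // v W IH cap /=; rewrite -(IH (cap - (f v && (0 < cap)%N))%N).
by case: (f v && _) => /=; lia.
Qed.

Lemma size_split (f : pred nat) cap W :
  (size (split_seq f cap true W) + size (split_seq f cap false W))%N = size W.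
Proof. by have := count_split predT f cap W; rewrite !count_predT. Qed.

Definition succ_prob (R : realFieldType) n A D sigma j (L : sides) : R :=
  expect (iterM (phase n A D) j L)
    (fun L' => expect (final n A D sigma L') (fun r => (accepted (sigma, r))%:R)).

Lemma succ_ge0 (R : realFieldType) n A D sigma j L : 0 <= succ_prob R n A D sigma j L.
Proof. by apply: expect_ge0 => L'; apply: expect_ge0. Qed.

(** The factor 8(D + 1) is 2 for the side, 2(D + 1) for the length t of the walk and 2 for the final
    coin. The two inequalities belong to the outcomes of that coin: keep the list reached, or pass
    to a piece of it. *)
Lemma phase_ge (R : realFieldType) n A D sigma j L o t (F := fun W => succ_prob R n A D sigma j (set_target o L W))
    (m := (size (target o L) %/ (2 * D))%N)
    (walk := steps n A o false m (chooser o L) t (target o L)) :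
  (D < n)%N -> (t <= D)%N ->
  (expect walk (fun y => F y.1) <= 8 * D.+1%:R * succ_prob R n A D sigma j.+1 L) /\
  (expect walk (fun y => expect (pick n (chooser o L))
     (fun x => F (split_seq (nonadj n A o x) m true y.1))) <=
   8 * D.+1%:R * succ_prob R n A D sigma j.+1 L).
Proof.
move=> Dn tD.
pose G (o' : bool) : R := expect (bind (rnd n D.+1) (fun c =>
    bind (steps n A o' false (size (target o' L) %/ (2 * D)) (chooser o' L) c (target o' L)) (fun y =>
    Toss (fun b : bool =>
    bind (steps n A o' true (size (target o' L) %/ (2 * D)) (chooser o' L) b y.1) (fun y' =>
    Ret (set_target o' L y'.1)))))) (fun L' => succ_prob R n A D sigma j L').
have G0 o' : 0 <= G o' by apply: expect_ge0 => L'; exact: succ_ge0.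
have SE : succ_prob R n A D sigma j.+1 L = (G true + G false) / 2.
  by rewrite /succ_prob -[iterM _ _ L]/(bind (phase n A D L) (iterM (phase n A D) j)) expect_bind.
set E1 := expect walk _; set E2 := expect walk _.
have E10 : 0 <= E1 by apply: expect_ge0 => y; exact: succ_ge0.
have E20 : 0 <= E2 by do 2!apply: expect_ge0 => ?; exact: succ_ge0.
have GE : (E1 + E2) / 2 / (2 * D.+1)%:R <= G o.
  rewrite /G expect_bind.
  set g := (X in expect _ X).
  have g0 i : 0 <= g i by apply: expect_ge0 => L'; exact: succ_ge0.
  apply: le_trans (rnd_ge (i := t) _ Dn g0); last by rewrite ltnS.
  rewrite ler_wpM2r ?invr_ge0// /g expect_bind -/m -/walk.
  rewrite le_eqVlt; apply/orP; left; apply/eqP.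
  rewrite /E1 /E2 -expectD mulrC -expectZ; apply: eq_expect => y.
  rewrite /= mulrC addrC; congr ((_ + _) / 2).
  by rewrite expect_bind /steps -[iterM _ 1 _]/(bind (step n A o true m (chooser o L) (y.1, [::]))
    (iterM (step n A o true m (chooser o L)) 0)) expect_bind /step expect_bind.
have G2 : (E1 + E2) / 2 / (2 * D.+1)%:R <= 2 * succ_prob R n A D sigma j.+1 L.
  apply: le_trans GE _; rewrite SE; have := G0 true; have := G0 false; case: (o); lra.
have dR : 0 < (2 * D.+1)%:R :> R by rewrite ltr0n.
rewrite ler_pdivrMr// in G2; rewrite natrM in G2.
split; lra.
Qed.

Lemma walk_inv n A o m Z t W : valid n W ->
  rall (fun y => valid n y.1 /\ (size W <= size y.1 + t * m)%N)
    (steps n A o false m Z t W).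
Proof.
move=> vW; apply: (@rall_imp _ (fun y => valid n y.1 /\ (size W + 0 * m <= size y.1 + t * m)%N)).
  by move=> y [v s]; split=> //; lia.
apply: (@rall_iterM _ (fun j y => valid n y.1 /\ (size W + j * m <= size y.1 + t * m)%N)) => //=.
move=> j [W' T] jt [/= vW' s]; rewrite /step.
apply: (@rall_bind _ _ (fun=> True)); first exact: rallT.
move=> x _ /=; split; first exact: split_seq_valid.
have := size_split (nonadj n A o x) m W'.
have : (size (split_seq (nonadj n A o x) m true W') <= m)%N.
  by rewrite size_piece geq_minl.
rewrite mulSn in s; lia.
Qed.

Lemma steps_size n A o h m Z t W :
  rall (fun y => (size y.1 <= size W)%N) (steps n A o h m Z t W).
Proof.
apply: (@rall_iterM _ (fun _ y => (size y.1 <= size W)%N)) => // j [W' T] _ /= s.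
apply: (@rall_bind _ _ (fun=> True)); first exact: rallT.
by move=> x _ /=; apply: leq_trans s; exact: size_split_seq.
Qed.

(** The source of the drift: what a planted vertex deletes contains no planted vertex of the other
    side. *)
Lemma count_piece_planted n A PA PB o m x W : planted n A PA PB -> (x < n)%N -> valid n W ->
  side_pred PA PB o x ->
  count (side_pred PA PB (~~ o)) (split_seq (nonadj n A o x) m true W) = 0%N.
Proof.
move=> pl xn vW Px; apply/eqP; rewrite -leqn0 leqNgt -has_count; apply/hasPn => v.
rewrite split_seq_true => /mem_take; rewrite mem_filter => /andP[h vin].
apply/negP => Qv; have := planted_adj pl xn _ Px Qv; rewrite h => /(_ _)/=.
by case/andP: vW => _ /allP /(_ v vin) vn /(_ vn).
Qed.

Lemma piece_bounds w D (m := (w %/ (2 * D))%N) : (0 < D)%N -> (4 * D <= w)%N ->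
  [/\ 0 < m, 2 * D * m <= w & w <= 4 * (D * m)]%N.
Proof.
move=> D0 Dw; have m0 : (0 < m)%N by rewrite divn_gt0; lia.
have h1 : (m * (2 * D) <= w)%N by exact: leq_trunc_div.
have h2 : (w < m.+1 * (2 * D))%N by apply: ltn_ceil; lia.
by clearbody m; split=> //; nia.
Qed.

Lemma half_size w w' D m t : (2 * D * m <= w)%N -> (t <= D)%N -> (w <= w' + t * m)%N ->
  (w <= 2 * w')%N.
Proof.
move=> mD tD h; have h2 : (t * m <= D * m)%N by rewrite leq_mul2r tD orbT.
by rewrite -mulnA in mD; lia.
Qed.

Lemma piece_small w w' D m : (0 < D)%N -> (2 * D * m <= w)%N -> (w <= 2 * w')%N -> (m <= w')%N.
Proof.
move=> D0 mD h; have h2 : (m <= D * m)%N by rewrite leq_pmull.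
by rewrite -mulnA in mD; lia.
Qed.

(* If the conclusion failed, rich pieces and winning sets W' would both be rare
   along the walk, so that Psi would drift upwards and end up nonnegative. *)
Lemma phase_boost (R : realFieldType) n A PA PB D sigma j L o (c : R) Nlow
    (Z := chooser o L) (W := target o L) (Q := side_pred PA PB (~~ o))
    (alpha := (count (side_pred PA PB o) Z)%:R / (size Z)%:R : R)
    (beta := (count Q W)%:R / (size W)%:R : R)
    (lam := beta * (1 + alpha / 32))
    (m := (size W %/ (2 * D))%N)
    (F := fun W' => succ_prob R n A D sigma j (set_target o L W')) :
  planted n A PA PB -> valid n Z -> valid n W -> (0 < size Z)%N ->
  (0 < D)%N -> (D < n)%N -> (4 * D <= size W)%N -> 0 <= c ->
  48 * Nlow%:R <= alpha * beta * (size Z)%:R ->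
  (forall W', valid n W' -> (m <= size W')%N ->
     lam * (size W')%:R <= (count Q W')%:R -> c <= F W') ->
  (forall W', valid n W' -> (size W <= 2 * size W')%N ->
     (Nlow <= count (fun u => count (nonadj n A o u) W' < m)%N Z)%N -> c <= F W') ->
  c * (alpha * beta) / (256 * D.+1%:R) <= succ_prob R n A D sigma j.+1 L.
Proof.
move=> pl vZ vW Z0 D0 Dn W4D c0 hN hrich hwin.
have zR : 0 < (size Z)%:R :> R by rewrite ltr0n.
have W0 : (0 < size W)%N by lia.
have wR : 0 < (size W)%:R :> R by rewrite ltr0n.
have a0 : 0 <= alpha by rewrite divr_ge0.
have b0 : 0 <= beta by rewrite divr_ge0.
have a1 : alpha <= 1 by rewrite ler_pdivrMr// mul1r ler_nat count_size.
have b1 : beta <= 1 by rewrite ler_pdivrMr// mul1r ler_nat count_size.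
have ab0 : 0 <= alpha * beta by exact: mulr_ge0.
have ab1 : alpha * beta <= beta by rewrite ler_piMl.
have lE : lam = beta + alpha * beta / 32 by rewrite /lam; ring.
have l2 : lam <= 2 by lra.
have lb : beta <= lam by lra.
have l0 : 0 <= lam by lra.
have [m0 mD mD4] : [/\ 0 < m, 2 * D * m <= size W & size W <= 4 * (D * m)]%N.
  exact: piece_bounds.
have mE : (size (target o L) %/ (2 * D))%N = m by [].
have aE : alpha = (count (side_pred PA PB o) Z)%:R / (size Z)%:R by [].
have bE : (count Q W)%:R = beta * (size W)%:R by rewrite /beta divfK// gt_eqF.
clearbody m lam beta alpha.
have mR : 0 < m%:R :> R by rewrite ltr0n.
pose Psi W' : R := (count Q W')%:R - lam * (size W')%:R.
pose rich x W' := (m <= count (nonadj n A o x) W')%N &&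
  (lam * m%:R < (count Q (split_seq (nonadj n A o x) m true W'))%:R).
pose low x W' := (count (nonadj n A o x) W' < m)%N.
pose win W' := (Nlow <= count (low^~ W') Z)%N.
(* A planted x gains lam * m since its piece avoids Q; a full piece that is not rich loses nothing,
   and a rich one at most m. If x is [low], the piece may be shorter; as lam <= 2, the coefficient 3
   covers both the missing gain and a loss of at most m. *)
have step_psi x W' : (x < n)%N -> valid n W' ->
    Psi W' + m%:R * (lam * (side_pred PA PB o x)%:R - (rich x W')%:R - 3 * (low x W')%:R) <=
    Psi (split_seq (nonadj n A o x) m false W').
  move=> xn vW'; rewrite /Psi; set f := nonadj n A o x.
  have := congr1 (fun k => k%:R : R) (count_split Q f m W'); rewrite natrD => cE.
  have := congr1 (fun k => k%:R : R) (size_split f m W'); rewrite natrD => sE.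
  set Y := split_seq f m true W' in cE sE *; set N := split_seq f m false W' in cE sE *.
  have sY : size Y = minn m (count f W').
    exact: size_piece.
  have cY : (count Q Y)%:R <= (size Y)%:R :> R by rewrite ler_nat count_size.
  have sYm : (size Y)%:R <= m%:R :> R by rewrite ler_nat sY geq_minl.
  have sY0 : 0 <= (size Y)%:R :> R by [].
  have lY0 : 0 <= lam * (size Y)%:R by rewrite mulr_ge0.
  have lm : lam * m%:R <= 2 * m%:R by rewrite ler_wpM2r.
  have lm0 : 0 <= lam * m%:R by rewrite mulr_ge0.
  have goalE : m%:R * (lam * (side_pred PA PB o x)%:R - (rich x W')%:R - 3 * (low x W')%:R)
      <= lam * (size Y)%:R - (count Q Y)%:R.
    rewrite /low ltnNge /rich -/f -/Y.
    case: (leqP m (count f W')) => hm /=.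
      have -> : size Y = m by rewrite sY; apply/minn_idPl.
      case Px: (side_pred PA PB o x).
        rewrite (count_piece_planted _ pl xn vW' Px).
        have -> : (lam * m%:R < 0%N%:R) = false by apply/negbTE; rewrite -leNgt.
        by rewrite /= ; lra.
      case: ltP => hr /=; lra.
    case: (side_pred PA PB o x) => /=; lra.
  rewrite -cE -sE mulrDr; lra.
pose rr W' := expect (pick n Z) (fun x => (rich x W')%:R : R).
(* Planted picks contribute at least alpha * beta / 2. Unless [win] holds, low vertices cost at most
   3 * 2 * [Nlow] / |Z|, which is at most alpha * beta / 8 by [hN]; what remains is 3/8. *)
have step_exp W' : valid n W' ->
    Psi W' + m%:R * (3 / 8 * (alpha * beta) - rr W' - 3 * (win W')%:R) <=
    expect (pick n Z) (fun x => Psi (split_seq (nonadj n A o x) m false W')).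
  move=> vW'.
  have hP : alpha / 2 <= expect (pick n Z) (fun x => (side_pred PA PB o x)%:R).
    apply: le_trans (pick_pred_ge R _ vZ Z0); rewrite aE natrM.
    rewrite le_eqVlt; apply/orP; left; apply/eqP; field; by rewrite gt_eqF.
  have hL : 3 * expect (pick n Z) (fun x => (low x W')%:R) <=
      alpha * beta / 8 + 3 * (win W')%:R.
    rewrite /win; case: leqP => hw /=.
      have : expect (pick n Z) (fun x => (low x W')%:R) <= 1 :> R.
        rewrite -[leRHS](expect_cst (pick n Z)); apply: ler_expectT => x.
        by rewrite lern1 leq_b1.
      lra.
    rewrite mulr0 addr0; have hp := pick_pred_le R (low^~ W') vZ Z0.
    have : (count (low^~ W') Z)%:R * 2 / (size Z)%:R <= alpha * beta / 24.
      rewrite ler_pdivrMr//.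
      have : (count (low^~ W') Z)%:R <= Nlow%:R :> R by rewrite ler_nat ltnW.
      lra.
    lra.
  apply: (@le_trans _ _ (expect (pick n Z) (fun x => Psi W' + m%:R *
      (lam * (side_pred PA PB o x)%:R - (rich x W')%:R - 3 * (low x W')%:R)))).
    rewrite expectD expect_cst lerD2l expectZ ler_wpM2l// !expectB !expectZ -/(rr W').
    have : beta * (alpha / 2) <= lam * expect (pick n Z) (fun x => (side_pred PA PB o x)%:R).
      by rewrite ler_pM// divr_ge0.
    have -> : beta * (alpha / 2) = alpha * beta / 2 by ring.
    lra.
  apply: ler_expect (pick_mem Z0 (valid_size vZ)) _ => x xZ.
  by apply: step_psi => //; case/andP: vZ => _ /allP; apply.
pose walk t := steps n A o false m Z t W.
set S := succ_prob R n A D sigma j.+1 L.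
have S0 : 0 <= S by exact: succ_ge0.
have [//|hS] := leP (c * (alpha * beta) / (256 * D.+1%:R)) S.
have dR : 0 < D.+1%:R :> R by rewrite ltr0n.
(* From here on the claim is assumed to fail. A phase could stop at any time t <= D and collect c
   from a win or from a rich piece, so each of these has probability below alpha * beta / 32 at
   every such time. *)
have {}hS : 8 * D.+1%:R * S < c * (alpha * beta / 32).
  have := hS; rewrite ltr_pdivlMr ?mulr_gt0//; lra.
have cpos : 0 < c.
  rewrite lt0r c0 andbT; apply: contraTneq hS => ->.
  by rewrite mul0r -leNgt mulr_ge0// mulr_ge0.
have half t (W' : seq nat) : (t <= D)%N -> (size W <= size W' + t * m)%N -> (size W <= 2 * size W')%N.
  exact: half_size mD.
have hw t : (t <= D)%N -> expect (walk t) (fun y => (win y.1)%:R) < alpha * beta / 32.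
  move=> tD; have [h1 _] := @phase_ge R n A D sigma j L o t Dn tD; rewrite mE in h1.
  rewrite -(ltr_pM2l cpos); apply: le_lt_trans hS; apply: le_trans h1.
  rewrite -expectZ; apply: ler_expect (walk_inv A o m Z t vW) _ => y [vy sy].
  case: (boolP (win y.1)) => hy; last by rewrite mulr0; exact: succ_ge0.
  by rewrite mulr1; apply: hwin => //; exact: half sy.
have hr t : (t <= D)%N -> expect (walk t) (fun y => rr y.1) < alpha * beta / 32.
  move=> tD; have [_ h2] := @phase_ge R n A D sigma j L o t Dn tD; rewrite mE in h2.
  rewrite -(ltr_pM2l cpos); apply: le_lt_trans hS; apply: le_trans h2.
  rewrite -expectZ; apply: ler_expect (walk_inv A o m Z t vW) _ => y [vy sy].
  rewrite /rr -expectZ; apply: ler_expectT => x.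
  case: (boolP (rich x y.1)) => hy; last by rewrite mulr0; exact: succ_ge0.
  rewrite mulr1; case/andP: hy => hm hl.
  have sm : size (split_seq (nonadj n A o x) m true y.1) = m.
    by rewrite size_piece; apply/minn_idPl.
  apply: hrich; rewrite ?sm ?ltW//; exact: split_seq_valid.
(* The initial deficit is (lam - beta) * |W|, and each step gains m * alpha * beta times at least
   3/8 - 1/32 - 3/32 = 1/4. *)
have hX t : (t <= D)%N ->
    - (alpha * beta * (size W)%:R / 32) + t%:R * (m%:R * (alpha * beta / 4)) <=
    expect (walk t) (fun y => Psi y.1).
  elim: t => [|t IH] tD.
    rewrite mul0r addr0 /= /Psi lE.
    rewrite bE; by rewrite le_eqVlt; apply/orP; left; apply/eqP; ring.
  rewrite /walk /steps expect_iterMSr -/(steps _ _ _ _ _ _ _ _) -/(walk t).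
  apply: (@le_trans _ _ (expect (walk t) (fun y => Psi y.1 +
      m%:R * (3 / 8 * (alpha * beta) - rr y.1 - 3 * (win y.1)%:R)))).
    have h1 := hw t (ltnW tD); have h2 := hr t (ltnW tD); have h3 := IH (ltnW tD).
    rewrite expectD expectZ; move: h3; move: (expect (walk t) (fun y => Psi y.1)) => E h3.
    rewrite !expectB expect_cst expectZ.
    have : m%:R * (alpha * beta / 4) <= m%:R * (3 / 8 * (alpha * beta) -
      expect (walk t) (fun y => rr y.1) - 3 * expect (walk t) (fun y => (win y.1)%:R)).
      by rewrite ler_wpM2l//; lra.
    rewrite -[t.+1%:R]natr1; lra.
  apply: ler_expect (walk_inv A o m Z t vW) _ => y [vy _].
  apply: le_trans (step_exp _ vy) _.
  by rewrite /step expect_bind.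
have [h1 _] := @phase_ge R n A D sigma j L o D Dn (leqnn D); rewrite mE in h1.
have hD := hX D (leqnn D).
(* Where [Psi] is nonnegative, the list has density at least lam and is worth c; as [Psi] is at most
   |W|, its mean over |W| bounds the probability of this event from below. *)
have hf : c * expect (walk D) (fun y => Psi y.1) <= (size W)%:R *
   expect (walk D) (fun y => F y.1).
  rewrite -!expectZ.
  apply: ler_expect (rall_and (walk_inv A o m Z D vW) (steps_size _ _ _ _ _ _ _ _)) _.
  move=> y [[vy sy] syW].
  have sy2 := half _ _ (leqnn D) sy.
  case: (lerP 0 (Psi y.1)) => hy; last first.
    apply: (@le_trans _ _ 0); first by rewrite mulr_ge0_le0// ltW.
    by rewrite mulr_ge0//; exact: succ_ge0.
  apply: (@le_trans _ _ (c * (size W)%:R)).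
    rewrite ler_wpM2l//; apply: (@le_trans _ _ (count Q y.1)%:R).
      by rewrite /Psi gerBl mulr_ge0.
    by rewrite ler_nat; apply: leq_trans syW; exact: count_size.
  rewrite mulrC ler_wpM2l//; apply: hrich => //.
    exact: piece_small mD sy2.
  by move: hy; rewrite /Psi subr_ge0.
have h4 : (size W)%:R <= 4 * (D%:R * m%:R) :> R by rewrite -!natrM ler_nat.
(* Since |W| <= 4 * D * m, the D steps gain at least alpha * beta * |W| / 16, twice the initial
   deficit. The surplus contradicts [hS]. *)
have h5 : alpha * beta * (size W)%:R / 32 <= expect (walk D) (fun y => Psi y.1).
  apply: le_trans hD.
  have : alpha * beta * (size W)%:R <= alpha * beta * (4 * (D%:R * m%:R)) by rewrite ler_wpM2l.
  lra.
have h6 : c * (alpha * beta * (size W)%:R / 32) < (size W)%:R * (c * (alpha * beta / 32)).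
  apply: (@le_lt_trans _ _ (c * expect (walk D) (fun y => Psi y.1))).
    by rewrite ler_wpM2l.
  apply: le_lt_trans hf _; rewrite ltr_pM2l//.
  exact: le_lt_trans h1 hS.
have h7 : c * (alpha * beta * (size W)%:R / 32) = (size W)%:R * (c * (alpha * beta / 32)) by ring.
by rewrite h7 ltxx in h6.
Qed.

(** A phase of length 0 whose last coin is false changes nothing. Such idle phases use up the
    guessed number of phases once the final stage can succeed. *)
Lemma succ_null (R : realFieldType) n A D sigma j L : (D < n)%N ->
  succ_prob R n A D sigma j L <= 8 * D.+1%:R * succ_prob R n A D sigma j.+1 L.
Proof.
move=> Dn; have [h _] := @phase_ge R n A D sigma j L false 0 Dn (leq0n D).
by rewrite -[X in succ_prob _ _ _ _ _ _ X <= _](set_target_id false L).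
Qed.

(** Bernoulli's inequality bounds each half of the exponent from below by 1/2. For odd D and x =
    1/D, the halves are at least (1 + x)/2, and (1 - x)(1 + x)^2 >= 1 for x <= 1/2. *)
Lemma half_bernoulli (R : realFieldType) D : (2 <= D)%N ->
  4^-1 <= (1 - D%:R^-1) ^+ D :> R.
Proof.
move=> D2.
have DR : 2 <= D%:R :> R by rewrite (ler_nat _ 2).
have bern (x : R) k : 0 <= x <= 1 -> 1 - k%:R * x <= (1 - x) ^+ k.
  move=> /andP[x0 x1]; elim: k => [|k IH]; first by rewrite mul0r subr0 expr0.
  rewrite exprS; have x1' : 0 <= 1 - x by lra.
  apply: le_trans (ler_wpM2l x1' IH); rewrite -natr1.
  have : 0 <= k%:R * (x * x) by rewrite mulr_ge0// mulr_ge0.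
  lra.
set x : R := D%:R^-1.
have x0 : 0 < x by rewrite invr_gt0; lra.
have Dx : D%:R * x = 1 by rewrite mulfV// gt_eqF; lra.
have x2 : x <= 2^-1 by rewrite lef_pV2 ?posrE//; lra.
have [k kE] : exists k, D = k.*2 \/ D = k.*2.+1.
  by exists D./2; have := odd_double_half D; case: (odd D); rewrite ?add1n ?add0n => ->; [right|left].
have hk (q : nat) : (q.*2 <= D)%N -> 2^-1 <= (1 - x) ^+ q.
  move=> qD; apply: le_trans (bern x q _); last by lra.
  have : q%:R * x * 2 <= 1.
    have : q%:R * 2 <= D%:R :> R by rewrite -natrM ler_nat muln2.
    rewrite -(ler_pM2r x0) Dx; lra.
  lra.
have sq (y z : R) : 2^-1 <= y -> 2^-1 <= z -> 4^-1 <= y * z by move=> hy hz; nra.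
case: kE => kE.
  have -> : (1 - x) ^+ D = (1 - x) ^+ k * (1 - x) ^+ k by rewrite -exprD addnn -kE.
  by apply: sq; apply: hk; lia.
have -> : (1 - x) ^+ D = (1 - x) * ((1 - x) ^+ k * (1 - x) ^+ k).
  by rewrite -exprD -exprS addnn -kE.
have k1 : (1 <= k)%N by lia.
have h3 : 1 - D%:R * x / 2 + x / 2 <= (1 - x) ^+ k.
  apply: le_trans (bern x k _); last by lra.
  have -> : D%:R = 2 * k%:R + 1 :> R by rewrite kE -addn1 natrD -muln2 natrM mulrC.
  lra.
rewrite Dx in h3.
have h4 : (2^-1 + x / 2) * (2^-1 + x / 2) <= (1 - x) ^+ k * (1 - x) ^+ k.
  by rewrite ler_pM//; lra.
have h5 : (1 - x) * ((2^-1 + x / 2) * (2^-1 + x / 2)) <= (1 - x) * ((1 - x) ^+ k * (1 - x) ^+ k).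
  by rewrite ler_wpM2l//; lra.
apply: le_trans h5; nra.
Qed.

(** As w <= 2 * |W|, fewer than w/(2D) non-neighbours is at most a fraction 1/D of W. With 16 * D
    vertices in W and 32 * D^2 of low degree, both error terms are at most 1/16, and (1/4 - 1/16 -
    1/16)/2 = 1/16. *)
Lemma low_success (R : realFieldType) n A D L o w :
  (2 <= D)%N -> valid n (chooser o L) -> valid n (target o L) ->
  (w <= 2 * size (target o L))%N -> (16 * D <= size (target o L))%N ->
  (32 * D ^ 2 <= count (fun u => count (nonadj n A o u) (target o L) < w %/ (2 * D))%N
     (chooser o L))%N ->
  16^-1 <= expect (final n A D D L) (fun r => (accepted (D, r))%:R) :> R.
Proof.
move=> D2 vZ vW hw hW hN.
have hz : (32 * D ^ 2 <= size (low_degree n A o D (chooser o L) (target o L)))%N.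
  apply: leq_trans hN _; rewrite /low_degree size_filter; apply: sub_count => u /= hu.
  have : (D * (2 * (w %/ (2 * D))) <= w)%N by rewrite mulnA [(D * 2)%N]mulnC mulnC leq_trunc_div.
  nia.
have D0 : (0 < D)%N by lia.
have DR : 0 < D%:R :> R by rewrite ltr0n.
have z0 : (0 < size (low_degree n A o D (chooser o L) (target o L)))%N.
  by apply: leq_trans hz; rewrite muln_gt0 expn_gt0 D0.
have w0 : (0 < size (target o L))%N by lia.
apply: le_trans (final_success R D D0 vZ vW z0 w0).
have h1 := half_bernoulli R D2.
have h2 : D%:R / (size (target o L))%:R <= 16^-1 :> R.
  rewrite ler_pdivrMr ?ltr0n//.
  have : 16 * D%:R <= (size (target o L))%:R :> R by rewrite -natrM ler_nat.
  lra.
have h3 : 2 * D%:R ^+ 2 / (size (low_degree n A o D (chooser o L) (target o L)))%:R <= 16^-1 :> R.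
  rewrite ler_pdivrMr ?ltr0n//.
  have : 32 * D%:R ^+ 2 <= (size (low_degree n A o D (chooser o L) (target o L)))%:R :> R.
    by rewrite -natrX -natrM ler_nat.
  lra.
lra.
Qed.

Lemma low_succ (R : realFieldType) n A D L (kappa : R) j :
  (D < n)%N -> 0 <= kappa -> 8 * D.+1%:R * kappa <= 1 ->
  16^-1 <= expect (final n A D D L) (fun r => (accepted (D, r))%:R) :> R ->
  kappa ^+ j / 16 <= succ_prob R n A D D j L.
Proof.
move=> Dn k0 k1 h; elim: j => [|j IH]; first by rewrite expr0 mul1r.
have h2 := le_trans IH (succ_null R A D j L Dn).
rewrite exprS -mulrA; apply: le_trans (ler_wpM2l k0 h2) _.
rewrite mulrA -[leRHS]mul1r ler_wpM2r ?succ_ge0//.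
by rewrite mulrC.
Qed.

Lemma piece_sizes S D w t : (0 < D)%N -> (32 * D <= S)%N -> (S * (4 * D) ^ t.+1 <= w)%N ->
  [/\ 2 * (S * (4 * D) ^ t) <= w %/ (2 * D), 32 * D <= w, 0 < w & 0 < S]%N.
Proof.
move=> D0 DS Sw; have Sw1 : (S <= w)%N.
  by apply: leq_trans Sw; rewrite leq_pmulr// expn_gt0 muln_gt0 D0.
have S0 : (0 < S)%N by apply: leq_trans DS; rewrite muln_gt0.
split=> //; [|exact: leq_trans Sw1|exact: leq_trans Sw1].
rewrite leq_divRL ?muln_gt0//; apply: leq_trans Sw; rewrite expnS.
by rewrite leq_eqVlt; apply/orP; left; apply/eqP; ring.
Qed.

(** Iterates [phase_boost] against a fixed list Z. Each phase gains a factor 1 + e/32 in density, at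
    the price of [kappa] in probability and 4 * D in size; t counts the phases still granted. The
    hypothesis on doubled density acts as a continuation, so that successive doublings compose. If a
    phase makes the final stage ready early, the others idle, and c <= kappa^j / 16 makes this
    outcome as valuable. The bound [rho] on the densities is shared by all levels, so [kappa] stays
    the same throughout. *)
Lemma boost_loop (R : realFieldType) n A PA PB D L o (e rho c : R) j S
    (Z := chooser o L) (Q := side_pred PA PB (~~ o))
    (kappa := rho ^+ 2 / (256 * D.+1%:R)) :
  planted n A PA PB -> valid n Z -> (2 <= D)%N -> (D < n)%N ->
  (32 * D <= S)%N -> 0 < rho -> rho <= e -> e <= 1 ->
  1536 * D%:R ^+ 2 <= rho ^+ 2 * (size Z)%:R -> (0 < size Z)%N ->
  e * (size Z)%:R <= (count (side_pred PA PB o) Z)%:R ->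
  0 <= c -> c <= kappa ^+ j / 16 ->
  (forall W', valid n W' -> (S <= size W')%N ->
     2 * e * (size W')%:R <= (count Q W')%:R -> c <= succ_prob R n A D D j (set_target o L W')) ->
  forall t W, valid n W -> (S * (4 * D) ^ t <= size W)%N ->
    e * (size W)%:R <= (count Q W)%:R ->
    2 * e * (size W)%:R <= (count Q W)%:R * (1 + e / 32) ^+ t ->
    c * kappa ^+ t <= succ_prob R n A D D (j + t) (set_target o L W).
Proof.
have kE : kappa = rho ^+ 2 / (256 * D.+1%:R) by [].
have ZE : chooser o L = Z by [].
have QE : side_pred PA PB (~~ o) = Q by [].
clearbody kappa Z Q.
move=> pl vZ D2 Dn hS r0 re e1 hZ Z0 eZ c0 cj given; elim=> [|t IH] W vW SW eW e2W.
  rewrite addn0 expr0 mulr1; apply: given => //; first by rewrite expn0 muln1 in SW.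
  by rewrite expr0 mulr1 in e2W.
have D0 : (0 < D)%N by exact: ltnW.
have dR : 0 < D.+1%:R :> R by rewrite ltr0n.
have zR : 0 < (size Z)%:R :> R by rewrite ltr0n.
have k0 : 0 <= kappa by rewrite kE divr_ge0 ?sqr_ge0// mulr_ge0.
have [SW2 W4D W0 S0] := piece_sizes D0 hS SW.
have wR : 0 < (size W)%:R :> R by rewrite ltr0n.
set alpha : R := (count (side_pred PA PB o) Z)%:R / (size Z)%:R.
set beta : R := (count Q W)%:R / (size W)%:R.
have ea : e <= alpha by rewrite ler_pdivlMr.
have eb : e <= beta by rewrite ler_pdivlMr.
have rab : rho ^+ 2 <= alpha * beta.
  by rewrite expr2; apply: ler_pM; rewrite ?(ltW r0)//; apply: le_trans re _.
(* 32 * D^2 is the number of low vertices that [low_success] asks for; 1536 = 48 * 32. *)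
have := @phase_boost R n A PA PB D D (j + t) (set_target o L W) o (c * kappa ^+ t) (32 * D ^ 2)%N.
rewrite !chooser_set !target_set ZE QE -/alpha -/beta => PB'.
have ck0 : 0 <= c * kappa ^+ t by rewrite mulr_ge0// exprn_ge0.
rewrite addnS exprSr mulrA.
apply: (@le_trans _ _ (c * kappa ^+ t * (alpha * beta) / (256 * D.+1%:R))).
  rewrite -[leRHS]mulrA ler_wpM2l// kE ler_wpM2r// invr_ge0 mulr_ge0//.
apply: PB' => //.
- by apply: leq_trans W4D; rewrite leq_mul2r orbT.
- apply: (@le_trans _ _ (rho ^+ 2 * (size Z)%:R)); last by rewrite ler_wpM2r.
  apply: le_trans hZ; rewrite natrM natrX; lra.
- move=> W' vW' mW' lW'.
  rewrite set_set.
  have lb : beta * (1 + e / 32) <= beta * (1 + alpha / 32).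
    by rewrite ler_wpM2l//; lra.
  have w'0 : 0 <= (size W')%:R :> R by [].
  have be : beta <= beta * (1 + e / 32) by rewrite ler_peMr//; lra.
  have cW' : beta * (1 + e / 32) * (size W')%:R <= (count Q W')%:R.
    by apply: le_trans lW'; rewrite ler_wpM2r.
  apply: IH => //.
  + by apply: leq_trans mW'; apply: leq_trans SW2; rewrite leq_pmull.
  + apply: le_trans cW'; rewrite ler_wpM2r//; lra.
  + apply: (@le_trans _ _ (beta * (1 + e / 32) * (size W')%:R * (1 + e / 32) ^+ t)); last first.
      by rewrite ler_wpM2r// exprn_ge0//; lra.
    rewrite [leRHS](_ : _ = beta * (1 + e / 32) ^+ t.+1 * (size W')%:R); last by rewrite exprS; ring.
    rewrite ler_wpM2r//.
    by rewrite /beta mulrAC ler_pdivlMr.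
- move=> W' vW' wW' nW'; rewrite set_set.
  apply: (@le_trans _ _ (kappa ^+ (j + t) / 16)).
    by rewrite exprD mulrAC ler_wpM2r// exprn_ge0.
  apply: low_succ => //.
    rewrite kE; have : rho ^+ 2 <= 1 by rewrite expr_le1//; lra.
    move=> r1; rewrite mulrA ler_pdivrMr ?mulr_gt0// mul1r.
    have : D.+1%:R * rho ^+ 2 <= D.+1%:R * 1 by rewrite ler_wpM2l.
    lra.
  apply: (@low_success R n A D _ o (size W)) => //; rewrite ?chooser_set ?target_set ?ZE//.
  by move: W4D wW'; clear; lia.
Qed.

Lemma expr_bernoulli (R : realFieldType) (x : R) k : 0 <= x -> 1 + k%:R * x <= (1 + x) ^+ k.
Proof.
move=> x0; elim: k => [|k IH]; first by rewrite mul0r addr0 expr0.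
rewrite exprS; have x1 : 0 <= 1 + x by rewrite addr_ge0.
apply: le_trans (ler_wpM2l x1 IH); rewrite -natr1.
have : 0 <= k%:R * (x * x) by rewrite mulr_ge0// mulr_ge0.
lra.
Qed.

Lemma doubling (R : realFieldType) i : 2 <= (1 + (2 ^+ i)^-1 / 32) ^+ (32 * 2 ^ i) :> R.
Proof.
have p0 : 0 < 2 ^+ i :> R by rewrite exprn_gt0.
apply: le_trans (expr_bernoulli _ _); last by rewrite divr_ge0// invr_ge0 ltW.
rewrite natrM natrX.
rewrite [X in _ + X](_ : _ = 1) //; field.
by rewrite gt_eqF.
Qed.

(* The densities 2^-i of both sides are doubled in turn, by 32 * 2^i phases; at
   density 1 the first doubling is impossible, so a walk must have won before. *)
Lemma level_success (R : realFieldType) n A PA PB D i0 S i L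
    (rho := (2 ^+ i0)^-1 : R) (kappa := rho ^+ 2 / (256 * D.+1%:R)) :
  planted n A PA PB -> (2 <= D)%N -> (D < n)%N -> (32 * D <= S)%N ->
  1536 * D%:R ^+ 2 <= rho ^+ 2 * S%:R -> (i <= i0)%N ->
  valid n L.1 -> valid n L.2 ->
  (S * (4 * D) ^ (64 * 2 ^ i) <= size L.1)%N -> (S * (4 * D) ^ (64 * 2 ^ i) <= size L.2)%N ->
  (2 ^+ i)^-1 * (size L.1)%:R <= (count PA L.1)%:R :> R ->
  (2 ^+ i)^-1 * (size L.2)%:R <= (count PB L.2)%:R :> R ->
  kappa ^+ (128 * 2 ^ i) / 16 <= succ_prob R n A D D (128 * 2 ^ i) L.
Proof.
move=> pl D2 Dn DS Srho.
have p0 k : 0 < 2 ^+ k :> R by rewrite exprn_gt0.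
have r0 : 0 < rho by rewrite invr_gt0.
have kE : rho ^+ 2 / (256 * D.+1%:R) = kappa by [].
have k0 : 0 <= kappa by rewrite -kE divr_ge0 ?sqr_ge0// mulr_ge0.
have re k : (k <= i0)%N -> rho <= (2 ^+ k)^-1.
  by move=> ki; rewrite lef_pV2 ?posrE// ler_weXn2l// ler1n.
have e1 k : (2 ^+ k)^-1 <= 1 :> R by rewrite invf_le1// exprn_ege1// ler1n.
have D0 : (0 < D)%N by exact: ltnW.
have S0 : (0 < S)%N by apply: leq_trans DS; rewrite muln_gt0.
have S1 k : (S <= S * (4 * D) ^ k)%N by rewrite leq_pmulr// expn_gt0 muln_gt0 D0.
have hZ (s : nat) : (S <= s)%N -> 1536 * D%:R ^+ 2 <= rho ^+ 2 * s%:R.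
  move=> Ss; apply: le_trans Srho _; apply: ler_wpM2l; first exact: sqr_ge0.
  by rewrite ler_nat.
clearbody kappa.
elim: i L => [|i IH] [X Y] ii /= vX vY sX sY cX cY.
  (* At density 1, only 32 of the 128 phases are spent on the attempted doubling; the other 96 are
     the reserve j left to its continuation. *)
  rewrite expn0 !muln1 in sX sY *.
  have -> : kappa ^+ 128 / 16 = kappa ^+ 96 / 16 * kappa ^+ 32.
    by rewrite -[128%N]/(96 + 32)%N exprD mulrAC.
  have h := @boost_loop R n A PA PB D (X, Y) false ((2 ^+ 0)^-1) rho (kappa ^+ 96 / 16) 96 S.
  rewrite /= kE in h.
  apply: (h pl vX D2 Dn DS r0 (re 0%N ii) (e1 0%N)) => //.
  - exact: hZ (leq_trans (S1 _) sX).
  - exact: leq_trans S0 (leq_trans (S1 _) sX).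
  - by rewrite divr_ge0 ?exprn_ge0.
  - move=> W' vW' SW'; rewrite expr0 invr1 mulr1 => h2.
    have : (count PB W')%:R <= (size W')%:R :> R by rewrite ler_nat count_size.
    have : 0 < (size W')%:R :> R by rewrite ltr0n; exact: leq_trans SW'.
    lra.
  - apply: leq_trans sY; rewrite leq_mul2l leq_exp2l ?orbT//.
    by apply: leq_trans (_ : 4 * 1 <= _)%N => //; rewrite leq_mul2l.
  - rewrite -mulrA mulrC; rewrite -[leRHS]mulr1.
    have := doubling R 0; rewrite muln1 => h2.
    rewrite -mulrA mulr1; apply: ler_pM => //.
    by rewrite mulr_ge0// invr_ge0 ltW.
have iE : ((2 ^+ i)^-1 : R) = 2 * (2 ^+ i.+1)^-1.
  by rewrite exprS; field; rewrite gt_eqF.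
have h2 := doubling R i.+1.
have tE : (32 * 2 ^ i.+1 = 64 * 2 ^ i)%N by rewrite expnS; ring.
rewrite tE in h2.
have sE : (S * (4 * D) ^ (64 * 2 ^ i.+1) = S * (4 * D) ^ (64 * 2 ^ i) * (4 * D) ^ (64 * 2 ^ i))%N.
  by rewrite -mulnA -expnD; congr (_ * _ ^ _)%N; rewrite expnS; ring.
(* Doubling from density 2^-(i+1) takes 32 * 2^(i+1) = 64 * 2^i phases per side; the 128 * 2^i
   others are those of the next level. *)
have jE : (128 * 2 ^ i.+1 = (128 * 2 ^ i + 64 * 2 ^ i) + 64 * 2 ^ i)%N by rewrite expnS; ring.
rewrite sE in sX sY; rewrite jE; move: sX sY; set S' := (S * (4 * D) ^ (64 * 2 ^ i))%N => sX sY.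
have SS' : (S <= S')%N by exact: S1.
have le2 s1 s2 : 0 <= s1 -> (2 ^+ i.+1)^-1 * s1 <= s2 ->
    2 * (2 ^+ i.+1)^-1 * s1 <= s2 * (1 + (2 ^+ i.+1)^-1 / 32) ^+ (64 * 2 ^ i) :> R.
  by move=> s10 s12; rewrite -mulrA [leLHS]mulrC; apply: ler_pM; rewrite // mulr_ge0// invr_ge0 ltW.
have := @boost_loop R n A PA PB D (X, Y) false (2 ^+ i.+1)^-1 rho
  (kappa ^+ (128 * 2 ^ i) / 16 * kappa ^+ (64 * 2 ^ i)) (128 * 2 ^ i + 64 * 2 ^ i) S'.
rewrite /= kE => outer.
have -> : kappa ^+ (128 * 2 ^ i + 64 * 2 ^ i + 64 * 2 ^ i) / 16 =
    kappa ^+ (128 * 2 ^ i) / 16 * kappa ^+ (64 * 2 ^ i) * kappa ^+ (64 * 2 ^ i).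
  by rewrite !exprD; ring.
have S'0 : (0 < S')%N by exact: leq_trans SS'.
have S'X (Z : seq nat) : (S' * (4 * D) ^ (64 * 2 ^ i) <= size Z -> S' <= size Z)%N.
  by apply: leq_trans; rewrite leq_pmulr// expn_gt0 muln_gt0 D0.
apply: (outer pl vX D2 Dn _ r0 (re _ ii) (e1 _)) => {outer} //.
- exact: leq_trans SS'.
- exact: hZ (leq_trans SS' (S'X _ sX)).
- exact: leq_trans S'0 (S'X _ sX).
- by rewrite mulr_ge0 ?exprn_ge0// divr_ge0 ?exprn_ge0.
- by rewrite exprD mulrAC.
(* The list of V has doubled its density. The roles are exchanged, and the list of U is doubled
   against W' before the induction hypothesis applies to both. *)
- move=> W' vW' SW' cW'.
  have inner := @boost_loop R n A PA PB D (X, W') true (2 ^+ i.+1)^-1 rho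
    (kappa ^+ (128 * 2 ^ i) / 16) (128 * 2 ^ i) S'.
  rewrite /= kE in inner.
  apply: (inner pl vW' D2 Dn _ r0 (re _ ii) (e1 _)) => {inner} //.
  + exact: leq_trans SS'.
  + exact: hZ (leq_trans SS' SW').
  + exact: leq_trans S'0 SW'.
  + apply: le_trans cW'; rewrite -mulrA ler_peMl ?ler1n//.
    by rewrite mulr_ge0// invr_ge0 ltW.
  + by rewrite divr_ge0 ?exprn_ge0.
  + move=> V vV SV cV; apply: IH => //=; first exact: ltnW.
    * by rewrite iE.
    * by rewrite iE.
  + exact: le2.
- exact: le2.
Qed.

Lemma dense_success (R : realFieldType) n A PA PB k D i
    (S := (1536 * D ^ 2 * (2 ^ i) ^ 2)%N) :
  planted n A PA PB -> count PA (iota 0 n) = k -> count PB (iota 0 n) = k ->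
  (2 <= D)%N -> (D < n)%N -> (n <= 2 ^ i * k)%N ->
  (S * (4 * D) ^ (64 * 2 ^ i) <= n)%N ->
  (((2 ^ i) ^ 2)%:R * (256 * D.+1%:R))^-1 ^+ (128 * 2 ^ i) / 16 <=
  expect (explore n A ((0, 128 * 2 ^ i), (D, D))%N) (fun r => (accepted (D, r))%:R) :> R.
Proof.
move=> pl cA cB D2 Dn nk Sn.
have p0 : 0 < 2 ^+ i :> R by rewrite exprn_gt0.
have D0 : (0 < D)%N by exact: ltnW.
have half : (2 ^+ i)^-1 * n%:R <= k%:R :> R.
  by rewrite mulrC ler_pdivrMr// mulrC -natrX -natrM ler_nat.
have := @level_success R n A PA PB D i S i (iota 0 n, iota 0 n) pl D2 Dn.
rewrite /= size_iota cA cB /succ_prob => h.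
have {h} := h _ _ (leqnn _) (iota_valid n) (iota_valid n) Sn Sn half half.
set e1 := expect _ _; set e2 := expect _ _ => h.
have -> : e2 = e1 by rewrite /e1 /e2 /explore expect_bind /= expect_bind.
apply: le_trans (h _ _); last 2 first.
- rewrite /S; have : (0 < 2 ^ i)%N by rewrite expn_gt0.
  by clear -D0; move: (2 ^ i)%N => r r0; nia.
- rewrite /S !natrM !natrX le_eqVlt; apply/orP; left; apply/eqP; field.
  by rewrite gt_eqF.
rewrite ler_wpM2r ?invr_ge0//.
rewrite le_eqVlt; apply/orP; left; apply/eqP.
congr (_ ^+ _).
rewrite !natrX invfM; congr (_ * _).
by rewrite exprVn.
Qed.

(** D = 0 switches the degree filter off, and there is no walk and no phase. What is left is the
    side coin and one pick, which hits u with probability at least 1/(2n). *)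
Lemma edge_success (R : realFieldType) n A u v : (u < n)%N -> (v < n)%N ->
  A (u * n + v)%N != 0%N ->
  (4 * n%:R)^-1 <= expect (explore n A ((0, 0), (0, 1))%N) (fun r => (accepted (1%N, r))%:R) :> R.
Proof.
move=> un vn Auv; set Z := iota 0 n.
have n0 : (0 < n)%N by exact: leq_ltn_trans un.
have nR : 0 < n%:R :> R by rewrite ltr0n.
have zE : size Z = n by rewrite size_iota.
have lE : low_degree n A false 0 Z Z = Z by rewrite /low_degree -[RHS]filter_predT.
rewrite /explore expect_bind /= expect_bind /= /final /= -/Z lE.
set a := expect _ _; set b := expect _ _.
have a0 : 0 <= a by exact: expect_ge0.
suff : (2 * n%:R)^-1 <= b.
  move=> h; have : (4 * n%:R)^-1 = (2 * n%:R)^-1 / 2 :> R by field; rewrite gt_eqF.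
  lra.
rewrite /b expect_bind /= /steps /= expect_bind /step expect_bind.
have := @pick_pred_ge R n Z (pred1 u) (iota_valid n); rewrite zE => /(_ n0).
have -> : count (pred1 u) Z = 1%N.
  by rewrite -[count _ _]/(count_mem u Z) count_uniq_mem ?iota_uniq// mem_iota un.
rewrite natrM div1r => h; apply: le_trans h _; apply: ler_expectT => x /=.
case: eqVneq => // ->; rewrite /accepted /= split_seq_full ?zE// ler_nat lt0b.
have : v \in [seq w <- Z | ~~ nonadj n A false u w] by rewrite mem_filter /nonadj Auv mem_iota.
by case: [seq _ <- _ | _].
Qed.

(** Each of the four parameters is guessed with probability at least 1/(2n). *)
Lemma attempt_ge (R : realFieldType) n A tau J D sigma : (0 < n)%N ->
  (tau < n)%N -> (J < n)%N -> (D < n)%N -> (sigma < n)%N ->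
  (2 * n%:R)^-1 ^+ 4 *
    expect (explore n A ((tau, J), (D, sigma))) (fun r => (accepted (sigma, r))%:R) <=
  expect (attempt n A) (fun r => (accepted r && (sigma <= r.1)%N)%:R) :> R.
Proof.
move=> n0 h1 h2 h3 h4.
rewrite /attempt expect_bind /setup expect_bind.
have c0 : 0 <= (2 * n%:R)^-1 :> R by rewrite invr_ge0 mulr_ge0.
have ge i (g : nat -> R) : (i < n)%N -> (forall i, 0 <= g i) ->
    (2 * n%:R)^-1 * g i <= expect (rnd n n) g.
  by move=> im g0; rewrite mulrC -natrM; exact: rnd_ge.
rewrite !exprS expr0 mulr1 -!mulrA.
apply: le_trans (ge tau _ h1 _); last by move=> ?; do 2!apply: expect_ge0 => ?.
rewrite ler_wpM2l// expect_bind.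
apply: le_trans (ge J _ h2 _); last by move=> ?; do 2!apply: expect_ge0 => ?.
rewrite ler_wpM2l// expect_bind.
apply: le_trans (ge D _ h3 _); last by move=> ?; do 2!apply: expect_ge0 => ?.
rewrite ler_wpM2l// expect_bind.
apply: le_trans (ge sigma _ h4 _); last by move=> ?; do 2!apply: expect_ge0 => ?.
rewrite ler_wpM2l//= expect_bind; apply: ler_expectT => r /=.
by rewrite leqnn andbT.
Qed.

(** * Choice of the parameters *)

(** Turns powers of l = log2 n into powers of 2 with exponent O(q), so that O(l/q) of them multiply
    to a power of n. *)
Lemma expn_le_log l q a : (0 < q)%N -> (l < 2 ^ q.+1)%N -> (l ^ a <= 2 ^ (2 * a * q))%N.
Proof.
move=> q0 lq; rewrite [(2 * a * q)%N](_ : _ = 2 * q * a)%N; last by rewrite mulnAC.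
rewrite expnM; case: a => // a; rewrite leq_exp2r//.
by apply: leq_trans (ltnW lq) _; rewrite leq_exp2l//; lia.
Qed.

(** The threshold 18 used everywhere below comes from here: the inequality fails at q = 17. The
    factor 768 = 2 * 384 yields D >= 2 in the sparse regime. *)
Lemma sqr_le_exp q : (18 <= q)%N -> (768 * q ^ 2 <= 2 ^ q)%N.
Proof.
elim: q => // q IH; rewrite leq_eqVlt => /orP[/eqP <-|q18]; first by rewrite -subn_eq0.
rewrite (expnS 2); apply: leq_trans (leq_mul (leqnn 2) (IH q18)).
rewrite mulnCA leq_mul2l /= -!mulnn; nia.
Qed.

(** With x = 1/m, (1 - x)^m (1 + x)^m <= 1 while (1 + x)^m >= 2 by Bernoulli's inequality. *)
Lemma halving (R : realFieldType) m q : (0 < m)%N ->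
  (1 - m%:R^-1) ^+ (m * q) <= (2 ^ q)%:R^-1 :> R.
Proof.
move=> m0; have mR : 0 < m%:R :> R by rewrite ltr0n.
have x1 : m%:R^-1 <= 1 :> R by rewrite invf_le1// ler1n.
have x0 : 0 <= 1 - m%:R^-1 :> R by lra.
rewrite exprM natrX -exprVn; case: q => [|q]; first by rewrite !expr0.
rewrite lerXn2r// ?nnegrE ?exprn_ge0 ?invr_ge0//.
have h : (1 - m%:R^-1) ^+ m * (1 + m%:R^-1) ^+ m <= 1 :> R.
  rewrite -exprMn; apply: exprn_ile1; last first.
    by have := sqr_ge0 (m%:R^-1 : R); rewrite expr2; lra.
  by rewrite mulr_ge0// addr_ge0// invr_ge0 ltW.
have h2 : 2 <= (1 + m%:R^-1) ^+ m :> R.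
  apply: le_trans (expr_bernoulli _ _); last by rewrite invr_ge0 ltW.
  by rewrite mulfV ?gt_eqF.
have x0m : 0 <= (1 - m%:R^-1) ^+ m :> R by exact: exprn_ge0.
have := ler_wpM2l x0m h2; lra.
Qed.

(** Here r stands for 2^i, about n/k. Since S <= l^9 and 4 * D <= l^4, the size condition costs
    2^(18q + 512qr); the price of a phase is at most l^6, so 128 * r phases cost 2^(1536qr). Both
    are at most 2^l because 4096 * q * r <= l. *)
Lemma dense_bounds n l q r D (S := (1536 * D ^ 2 * r ^ 2)%N) :
  (2 ^ l <= n)%N -> (2 ^ q <= l)%N -> (l < 2 ^ q.+1)%N -> (18 <= q)%N ->
  (0 < r)%N -> (4096 * q * r <= l)%N -> D = (l ^ 3)%N ->
  [/\ 2 <= D, D < n, 128 * r < n, S * (4 * D) ^ (64 * r) <= n &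
   16 * (r ^ 2 * (256 * D.+1)) ^ (128 * r) <= n ^ 14]%N.
Proof.
move=> ln ql lq q18 r0 rl DE.
have q0 : (0 < q)%N by lia.
have l18 : (1536 <= l)%N.
  by apply: (@leq_trans (2 ^ 11)) => //; apply: leq_trans ql; rewrite leq_exp2l//; exact: leq_trans q18.
have l2n : (l < n)%N by apply: leq_trans ln; exact: ltn_expl.
have lrq : (r <= l)%N by apply: leq_trans rl; rewrite leq_pmull// muln_gt0.
have qr : (q <= q * r)%N by rewrite leq_pmulr.
have rq : (r <= q * r)%N by rewrite leq_pmull.
have P a : (l ^ a <= 2 ^ (2 * a * q))%N by exact: expn_le_log.
have lX a b c : (a <= c)%N -> (b <= l ^ a -> b <= 2 ^ (2 * c * q))%N.
  move=> ac /leq_trans; apply; apply: leq_trans (P a) _.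
  by rewrite leq_exp2l// leq_mul2r leq_mul2l ac !orbT.
split.
- rewrite DE; apply: (@leq_trans (2 ^ 3)) => //; rewrite leq_exp2r//; lia.
- apply: leq_ltn_trans (_ : (2 ^ (2 * 3 * q) < n)%N); first by rewrite DE P.
  apply: leq_trans ln; rewrite ltn_exp2l//; lia.
- lia.
- apply: leq_trans ln; have hS : (S <= 2 ^ (2 * 9 * q))%N.
    apply: (lX 9%N) => //; rewrite /S DE -expnM -mulnA.
    rewrite [(l ^ 9)%N](_ : _ = l * (l ^ (3 * 2) * l ^ 2))%N; last by rewrite -expnD -expnS.
    by rewrite leq_mul// leq_mul2l leq_exp2r// lrq orbT.
  have hD : (4 * D <= 2 ^ (2 * 4 * q))%N.
    by apply: (lX 4%N) => //; rewrite DE [in leqRHS]expnS leq_mul2r; apply/orP; right; lia.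
  apply: (@leq_trans (2 ^ (2 * 9 * q) * (2 ^ (2 * 4 * q)) ^ (64 * r))).
    by apply: leq_mul => //; rewrite leq_exp2r// muln_gt0.
  rewrite -expnM -expnD leq_exp2l//; nia.
- have hD : (r ^ 2 * (256 * D.+1) <= 2 ^ (2 * 6 * q))%N.
    apply: (lX 6%N) => //.
    rewrite [(l ^ 6)%N](_ : _ = l ^ 2 * (l * l ^ 3))%N; last by rewrite -expnS -expnD.
    apply: leq_mul; first by rewrite leq_exp2r.
    have : (0 < l ^ 3)%N by rewrite expn_gt0; lia.
    by rewrite DE; move: (l ^ 3)%N => c c0; apply: (@leq_trans (512 * c)); [lia|rewrite leq_mul2r; lia].
  apply: (@leq_trans (16 * (2 ^ (2 * 6 * q)) ^ (128 * r))).
    by rewrite leq_mul2l leq_exp2r ?muln_gt0.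
  apply: (@leq_trans (n * n)).
    apply: leq_mul; first lia.
    apply: leq_trans ln; rewrite -expnM leq_exp2l//; nia.
  by rewrite mulnn leq_exp2l//; lia.
Qed.

Local Close Scope ring_scope.

(** The factor 16 * D in tau is the decay time of bad vertices, and 6 * q halvings beat 8 * D * n /
    k <= l^4. The choice of D gives tau <= l/(4q), so that (k/(2n))^tau >= l^(-4 tau) >= n^-2. With
    e = l/16, the factor 4^e is at most n^(1/8), which leaves k large compared with sigma^2. Finally
    l <= 768 * q^2 * D and l <= 32 * e, whence 24576 = 768 * 32. *)
Lemma sparse_bounds n l q k D tau e sigma :
  2 ^ l <= n -> 2 ^ q <= l -> l < 2 ^ q.+1 -> 18 <= q -> 0 < k -> n <= k * l ^ 3 ->
  D = l %/ (384 * q ^ 2) -> tau = 16 * D * (6 * q) -> e = l %/ 16 -> sigma = D * e ->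
  [/\ [/\ 2 <= D, tau < n, D < n & 0 < sigma < n],
   8 * D * n <= k * 2 ^ (6 * q),
   16 * sigma ^ 2 * 4 ^ e <= k,
   (2 * n) ^ tau * (8 * 4 ^ e) <= k ^ tau * n ^ 14 &
   l ^ 2 <= 24576 * q ^ 2 * sigma].
Proof.
move=> ln ql lq q18 k0 nk DE tE eE sE.
have q0 : 0 < q by exact: leq_trans q18.
have Q0 : 0 < 384 * q ^ 2 by rewrite muln_gt0 expn_gt0 q0.
have l1 : 768 * q ^ 2 <= l := leq_trans (sqr_le_exp q18) ql.
have qq : 18 * q <= q ^ 2 by rewrite -mulnn leq_mul2r q18 orbT.
have l2n : l < n by apply: leq_trans ln; exact: ltn_expl.
have Dl : D * (384 * q ^ 2) <= l by rewrite DE leq_trunc_div.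
have D2 : 2 <= D by rewrite DE leq_divRL// mulnA.
have lD : l < D.+1 * (384 * q ^ 2) by rewrite DE ltn_ceil.
have el : e * 16 <= l by rewrite eE leq_trunc_div.
have le : l < e.+1 * 16 by rewrite eE ltn_ceil.
have e1 : 1 <= e by clear -le l1 qq q18; lia.
have P a : l ^ a <= 2 ^ (2 * a * q) by exact: expn_le_log.
have Dl1 : 8 * D <= l.
  apply: leq_trans Dl; rewrite mulnC leq_mul2l; apply/orP; right.
  by clear -qq q18; lia.
have sl : sigma <= l ^ 2 by rewrite sE -mulnn leq_mul//; clear -Dl1 el; lia.
have s0 : 0 < sigma by rewrite sE muln_gt0 e1 (ltnW D2).
have tD : tau * (4 * q) <= D * (384 * q ^ 2).
  by rewrite tE -mulnn leq_eqVlt; apply/orP; left; apply/eqP; ring.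
have tl : tau <= l.
  by apply: leq_trans Dl; apply: leq_trans tD; rewrite leq_pmulr// muln_gt0 q0.
have hs : 16 * sigma ^ 2 * 4 ^ e * l ^ 3 <= n.
  apply: leq_trans ln; apply: (@leq_trans (l ^ 8 * 4 ^ e)).
    rewrite mulnAC leq_mul2r; apply/orP; right.
    rewrite [l ^ 8](_ : _ = l * (l ^ 2) ^ 2 * l ^ 3); last by rewrite -expnM -expnS -expnD.
    rewrite leq_mul2r; apply/orP; right; apply: leq_mul; first by clear -l1 qq q18; lia.
    by rewrite leq_exp2r.
  apply: (@leq_trans (2 ^ (2 * 8 * q) * 4 ^ e)); first by rewrite leq_mul2r P orbT.
  rewrite -[4]/(2 ^ 2) -expnM -expnD leq_exp2l//.
  by clear -el l1 qq q18; lia.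
have l0 : 0 < l ^ 3 by rewrite expn_gt0; clear -l2n l1 qq q18; lia.
split.
- split=> //; [exact: leq_ltn_trans l2n|clear -Dl1 l2n; lia|].
  rewrite s0; apply: leq_ltn_trans sl _; apply: leq_trans ln.
  apply: leq_ltn_trans (P 2) _; rewrite ltn_exp2l//; clear -l1 qq q18; lia.
- apply: (@leq_trans (l * (k * l ^ 3))); first exact: leq_mul.
  rewrite mulnCA -expnS leq_mul2l; apply/orP; right.
  apply: (@leq_trans ((2 ^ q.+1) ^ 4)); first by rewrite leq_exp2r// ltnW.
  by rewrite -expnM leq_exp2l//; clear -q18; lia.
- by rewrite -(leq_pmul2r l0); exact: leq_trans hs nk.
- apply: (@leq_trans ((k * l ^ 4) ^ tau * (8 * 4 ^ e))).
    rewrite leq_mul2r; apply/orP; right; rewrite leq_exp2r; last by rewrite tE !muln_gt0 q0 (ltnW D2).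
    apply: (@leq_trans (l * (k * l ^ 3))); last by rewrite mulnCA -expnS.
    by apply: leq_mul => //; clear -l1 qq q18; lia.
  rewrite expnMn -mulnA leq_mul2l; apply/orP; right.
  apply: (@leq_trans (n ^ 2 * (n * n))); last by rewrite mulnn -expnD leq_pexp2l//; exact: leq_ltn_trans l2n.
  apply: leq_mul.
    apply: (@leq_trans ((2 ^ (2 * 4 * q)) ^ tau)); first by rewrite leq_exp2r ?P// tE !muln_gt0 q0 (ltnW D2).
    apply: (@leq_trans ((2 ^ l) ^ 2)); last by rewrite leq_exp2r.
    rewrite -!expnM leq_exp2l//; clear -tD Dl; lia.
  apply: leq_mul; first by clear -l2n l1 qq q18; lia.
  apply: leq_trans ln; rewrite -[4]/(2 ^ 2) -expnM leq_exp2l//; clear -el; lia.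
- apply: (@leq_trans ((768 * q ^ 2 * D) * (32 * e))).
    rewrite -mulnn; apply: leq_mul.
      apply: leq_trans (ltnW lD) _; apply: (@leq_trans (2 * D * (384 * q ^ 2))).
        by rewrite leq_mul2r; apply/orP; right; clear -D2; lia.
      by rewrite leq_eqVlt; apply/orP; left; apply/eqP; ring.
    by clear -le e1; lia.
  by rewrite sE leq_eqVlt; apply/orP; left; apply/eqP; ring.
Qed.

Local Open Scope ring_scope.

(** Guessing the parameters costs (2n)^4 <= n^5 once n >= 16, and 5 + 14 = 19; the exponent 14
    serves both regimes. *)
Lemma attempt_lower_bound (R : realFieldType) n A tau J D sigma :
  (16 <= n)%N -> (tau < n)%N -> (J < n)%N -> (D < n)%N -> (sigma < n)%N ->
  (n ^ 14)%:R^-1 <= expect (explore n A ((tau, J), (D, sigma)))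
    (fun r => (accepted (sigma, r))%:R) :> R ->
  (n ^ 19)%:R^-1 <= expect (attempt n A) (fun r => (accepted r && (sigma <= r.1)%N)%:R) :> R.
Proof.
move=> n16 h1 h2 h3 h4 hP; have n0 : (0 < n)%N by exact: leq_trans n16.
apply: le_trans (attempt_ge R A n0 h1 h2 h3 h4).
have p0 : 0 <= (2 * n%:R)^-1 ^+ 4 :> R by rewrite exprn_ge0// invr_ge0 mulr_ge0.
apply: le_trans (ler_wpM2l p0 hP).
rewrite -natrM exprVn -natrX -invfM -natrM lef_pV2 ?posrE ?ltr0n ?muln_gt0 ?expn_gt0 ?n0 ?orbT//.
rewrite ler_nat (_ : 19 = 5 + 14)%N// expnD leq_mul2r; apply/orP; right.
by rewrite expnMn expnS leq_mul2r n16 orbT.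
Qed.

Lemma edge_attempt (R : realFieldType) n A PA PB : (3 <= n)%N -> planted n A PA PB ->
  (0 < count PA (iota 0 n))%N -> (0 < count PB (iota 0 n))%N ->
  (n ^ 19)%:R^-1 <= expect (attempt n A) (fun r => (accepted r && (1 <= r.1)%N)%:R) :> R.
Proof.
move=> n3 pl; rewrite -!has_count => /hasP[u]; rewrite mem_iota => /= un Pu.
move=> /hasP[v]; rewrite mem_iota => /= vn Pv.
have n0 : (0 < n)%N by exact: leq_trans n3.
have h := edge_success R un vn (pl _ _ un vn Pu Pv).
apply: le_trans (attempt_ge R A n0 n0 n0 n0 (ltnW n3)).
have p0 : 0 <= (2 * n%:R)^-1 ^+ 4 :> R by rewrite exprn_ge0// invr_ge0 mulr_ge0.
apply: le_trans (ler_wpM2l p0 h).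
rewrite -!natrM exprVn -natrX -invfM -natrM lef_pV2 ?posrE ?ltr0n ?muln_gt0 ?expn_gt0 ?n0 ?muln_gt0 ?n0//.
rewrite ler_nat expnMn mulnACA -[X in (_ * X)%N]expnSr (_ : 19 = 14 + 5)%N// expnD.
rewrite leq_mul2r; apply/orP; right; apply: (@leq_trans (3 ^ 4)) => //.
apply: (@leq_trans (n ^ 4)); first by rewrite leq_exp2r.
by rewrite leq_pexp2l.
Qed.

Lemma dense_attempt (R : realFieldType) n A PA PB k i
    (l := trunc_log 2 n) (q := trunc_log 2 l) :
  planted n A PA PB -> count PA (iota 0 n) = k -> count PB (iota 0 n) = k ->
  (18 <= q)%N -> (n <= 2 ^ i * k)%N -> (4096 * q * 2 ^ i <= l)%N ->
  (n ^ 19)%:R^-1 <= expect (attempt n A) (fun r => (accepted r && (l ^ 3 <= r.1)%N)%:R) :> R.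
Proof.
move=> pl cA cB q18 nk hl.
have l0 : (0 < l)%N by rewrite lt0n; apply: contraTneq q18; rewrite /q => ->.
have n0 : (0 < n)%N by rewrite lt0n; apply: contraTneq l0; rewrite /l => ->.
have ln : (2 ^ l <= n)%N by exact: trunc_logP.
have ql : (2 ^ q <= l)%N by exact: trunc_logP.
have lq : (l < 2 ^ q.+1)%N by exact: trunc_log_ltn.
have r0 : (0 < 2 ^ i)%N by rewrite expn_gt0.
have [D2 Dn Jn Sn Pn] := dense_bounds ln ql lq q18 r0 hl erefl.
have h := dense_success R pl cA cB D2 Dn nk Sn.
apply: (attempt_lower_bound (tau := 0) (J := 128 * 2 ^ i) (D := l ^ 3)) => //.
  apply: leq_trans ln; apply: (@leq_trans (2 ^ 4)) => //; rewrite leq_exp2l//.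
  by apply: leq_trans ql; apply: leq_trans (_ : 2 ^ 2 <= _)%N => //; rewrite leq_exp2l// (leq_trans _ q18).
apply: le_trans h; rewrite -!natrM exprVn -natrX -invfM -natrM.
rewrite lef_pV2 ?posrE ?ltr0n ?muln_gt0 ?expn_gt0 ?n0//; last by rewrite muln_gt0 expn_gt0 r0.
by rewrite ler_nat mulnC.
Qed.

Lemma sparse_attempt (R : realFieldType) n A PA PB k
    (l := trunc_log 2 n) (q := trunc_log 2 l) :
  planted n A PA PB -> count PA (iota 0 n) = k -> count PB (iota 0 n) = k -> (0 < k)%N ->
  (18 <= q)%N -> (n <= k * l ^ 3)%N ->
  exists2 s, (l ^ 2 <= 24576 * q ^ 2 * s)%N &
  (n ^ 19)%:R^-1 <= expect (attempt n A) (fun r => (accepted r && (s <= r.1)%N)%:R) :> R.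
Proof.
move=> pl cA cB k0 q18 nk.
have l0 : (0 < l)%N by rewrite lt0n; apply: contraTneq q18; rewrite /q => ->.
have n0 : (0 < n)%N by rewrite lt0n; apply: contraTneq l0; rewrite /l => ->.
have ln : (2 ^ l <= n)%N by exact: trunc_logP.
have ql : (2 ^ q <= l)%N by exact: trunc_logP.
have lq : (l < 2 ^ q.+1)%N by exact: trunc_log_ltn.
have [[D2 tn Dn /andP[s0 sn]] h1 h2 h3 h4] := sparse_bounds ln ql lq q18 k0 nk erefl erefl erefl erefl.
move: D2 tn Dn s0 sn h1 h2 h3 h4.
set D := (l %/ _)%N; set tau := (16 * D * _)%N; set e := (l %/ 16)%N; set sigma := (D * e)%N.
move=> D2 tn Dn s0 sn h1 h2 h3 h4.
exists sigma => //.
have D0 : (0 < D)%N by exact: ltnW.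
have kR : 0 < k%:R :> R by rewrite ltr0n.
have nR : 0 < n%:R :> R by rewrite ltr0n.
have ey : (4 ^ e)%:R^-1 <= (1 - D%:R^-1) ^+ sigma :> R.
  rewrite /sigma exprM natrX -exprVn; case: (posnP e) => [->|e0]; first by rewrite !expr0.
  rewrite lerXn2r ?nnegrE ?invr_ge0 ?half_bernoulli// exprn_ge0//.
  by rewrite subr_ge0 invf_le1 ?ltr0n// ler1n.
have fR : 0 < (4 ^ e)%:R :> R by rewrite ltr0n expn_gt0.
have htau : 4 * D%:R / k%:R * n%:R * (1 - (16 * D%:R)^-1) ^+ tau <= 2^-1 :> R.
  have D16 : (0 < 16 * D)%N by rewrite muln_gt0.
  apply: (@le_trans _ _ (4 * D%:R / k%:R * n%:R * (2 ^ (6 * q))%:R^-1)).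
    apply: ler_wpM2l; last by rewrite -[16 * D%:R]natrM; exact: halving.
    by rewrite mulr_ge0// divr_ge0// mulr_ge0.
  have pR : 0 < (2 ^ (6 * q))%:R :> R by rewrite ltr0n expn_gt0.
  rewrite ler_pdivrMr// mulrAC ler_pdivrMr//.
  have : (8 * D * n)%:R <= (k * 2 ^ (6 * q))%:R :> R by rewrite ler_nat.
  rewrite !natrM; lra.
have hs2 : 4 * sigma%:R ^+ 2 / k%:R <= (1 - D%:R^-1) ^+ sigma / 4 :> R.
  apply: (@le_trans _ _ ((4 ^ e)%:R^-1 / 4)); last by rewrite ler_wpM2r ?invr_ge0.
  rewrite ler_pdivrMr// [leRHS](_ : _ = k%:R / 4 / (4 ^ e)%:R); last by ring.
  rewrite ler_pdivlMr// ler_pdivlMr// -natrX -!natrM ler_nat.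
  by rewrite (_ : _ * 4 = 16 * sigma ^ 2 * 4 ^ e)%N//; ring.
have hs1 : sigma%:R / k%:R <= (1 - D%:R^-1) ^+ sigma / 4 :> R.
  apply: le_trans hs2; rewrite ler_pM2r ?invr_gt0//.
  by rewrite -natrX -natrM ler_nat -mulnn mulnCA leq_pmulr// muln_gt0.
apply: (attempt_lower_bound (tau := tau) (J := 0%N) (D := D)) => //.
  apply: leq_trans ln; apply: (@leq_trans (2 ^ 4)) => //; rewrite leq_exp2l//.
  by apply: leq_trans ql; apply: leq_trans (_ : 2 ^ 2 <= _)%N => //; rewrite leq_exp2l// (leq_trans _ q18).
apply: le_trans (sparse_success pl cA cB k0 D0 htau hs1 hs2).
apply: (@le_trans _ _ ((k%:R / (2 * n)%:R) ^+ tau * (4 ^ e)%:R^-1 / 8)); last first.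
  by rewrite ler_wpM2r ?invr_ge0// ler_wpM2l// exprn_ge0// divr_ge0.
rewrite expr_div_n -!natrX -!mulrA -!invfM -!natrM ler_pdivlMr; last first.
  by rewrite ltr0n !muln_gt0 !expn_gt0 muln_gt0 n0.
rewrite mulrC ler_pdivrMr ?ltr0n ?expn_gt0 ?n0//.
by rewrite -natrM ler_nat [(4 ^ e * 8)%N]mulnC.
Qed.

Lemma attempt_success (R : realFieldType) : exists K : nat,
  forall n A PA PB k (l := trunc_log 2 n) (q := trunc_log 2 l),
  (3 <= n)%N -> planted n A PA PB ->
  count PA (iota 0 n) = k -> count PB (iota 0 n) = k -> (0 < k)%N ->
  exists2 s, (k * l ^ 3 <= K * n * q.+1 ^ 3 * s)%N &
    (n ^ 19)%:R^-1 <= expect (attempt n A) (fun r => (accepted r && (s <= r.1)%N)%:R) :> R.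
Proof.
(* K is hidden behind two inequalities, since a unary number of this size must never be evaluated.
   The first covers l < 2^18; the second multiplies the constants of the sparse regime. *)
have [K K1 K2] : exists2 K, ((2 ^ 18) ^ 3 <= K)%N & (4096 * 2 * 24576 <= K)%N.
  by exists ((2 ^ 18) ^ 3 + 4096 * 2 * 24576)%N; [exact: leq_addr|exact: leq_addl].
have K0 : (0 < K)%N by apply: leq_trans K1; rewrite !expn_gt0.
exists K => n A PA PB k l q n3 pl cA cB k0.
have n0 : (0 < n)%N by exact: leq_trans n3.
have l0 : (0 < l)%N by rewrite trunc_log_gt0 /= (leq_trans _ n3).
have kn : (k <= n)%N by rewrite -cA -[leqRHS](size_iota 0 n) count_size.
have edge : (k * l ^ 3 <= K * n * q.+1 ^ 3 * 1)%N -> exists2 s, (k * l ^ 3 <= K * n * q.+1 ^ 3 * s)%N &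
    (n ^ 19)%:R^-1 <= expect (attempt n A) (fun r => (accepted r && (s <= r.1)%N)%:R) :> R.
  by move=> h; exists 1%N => //; apply: edge_attempt pl _ _; rewrite // ?cA ?cB.
(* For small q the whole factor l^3 is bounded by K, and an edge suffices. *)
case: (leqP 18 q) => q18; last first.
  apply: edge; rewrite muln1; apply: (@leq_trans (K * n)); last by rewrite leq_pmulr// expn_gt0.
  rewrite mulnC; apply: leq_mul => //; apply: leq_trans K1; rewrite leq_exp2r//.
  apply: ltnW; apply: leq_trans (trunc_log_ltn l (isT : 1 < 2)%N) _; rewrite leq_exp2l//.
case: (leqP n (k * l ^ 3)%N) => kl; last first.
  apply: edge; rewrite muln1; apply: leq_trans (ltnW kl) _.
  by rewrite mulnAC leq_pmull// muln_gt0 K0 expn_gt0.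
(* 2^i is n/k rounded up to a power of 2; minimality gives 2^i * k <= 2 * n. *)
have [i ni imin] : exists2 i, (n <= 2 ^ i * k)%N & forall j, (n <= 2 ^ j * k)%N -> (i <= j)%N.
  have ex : exists i, (n <= 2 ^ i * k)%N.
    by exists n; apply: leq_trans (ltnW (ltn_expl n (isT : 1 < 2)%N)) _; rewrite leq_pmulr.
  by exists (ex_minn ex); case: ex_minnP.
case: (leqP (4096 * q * 2 ^ i)%N l) => hi.
  exists (l ^ 3)%N; last exact: dense_attempt pl cA cB q18 ni hi.
  rewrite leq_mul2r; apply/orP; right; apply: leq_trans kn _.
  by rewrite mulnAC leq_pmull// muln_gt0 K0 expn_gt0.
(* Failure of the dense condition bounds k * l by O(q * n). Multiplied by l^2 = O(q^2 * s), this
   produces the third power of q. *)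
have kl2 : (k * l <= 4096 * q * (2 * n))%N.
  have ik : (2 ^ i * k <= 2 * n)%N.
    case: i imin {ni hi} => [|i] imin; first by rewrite expn0 mul1n; lia.
    rewrite expnS -mulnA leq_mul2l /= ltnW// ltnNge; apply/negP => /imin.
    by rewrite ltnn.
  apply: (@leq_trans (k * (4096 * q * 2 ^ i))); first by rewrite leq_mul2l ltnW ?orbT.
  rewrite (mulnC k) -mulnA.
  by rewrite leq_mul2l ik orbT.
have [s hs hp] := sparse_attempt R pl cA cB k0 q18 kl.
exists s => //.
apply: (@leq_trans ((4096 * q * (2 * n)) * (24576 * q ^ 2 * s))).
  by rewrite [(l ^ 3)%N]expnS mulnA leq_mul.
apply: (@leq_trans (K * n * q ^ 3 * s)).
  have E (a b c : nat) : (a * q * (b * n) * (c * q ^ 2 * s) = a * b * c * (n * q ^ 3 * s))%N.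
    by ring.
  rewrite E.
  by apply: leq_trans (leq_mul K2 (leqnn _)) _; rewrite !mulnA.
by rewrite leq_mul2r leq_mul2l leq_exp2r// leqnSn !orbT.
Qed.

(** * Natural against binary logarithms *)

Lemma ln_expr (R : realType) (x : R) k : 0 < x -> ln (x ^+ k) = k%:R * ln x.
Proof. by move=> x0; rewrite lnXn// mulr_natl. Qed.

Lemma ln2_bounds (R : realType) : 2^-1 <= ln (2 : R) <= 1.
Proof.
apply/andP; split.
  have := @le_ln1Dx R (- 2^-1) ltac:(lra).
  rewrite (_ : 1 + - 2^-1 = 2^-1 :> R); last by lra.
  by rewrite lnV ?posrE// lerN2.
by have := @le_ln1Dx R 1 ltac:(lra).
Qed.

(** Makes ln ln n positive down to n = 3. From ln (1 + x) <= x at x = -1/6 one gets ln (6/5) >= 1/6,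
    and (6/5)^6 = 2.985984 < 3. *)
Lemma ln3_gt1 (R : realType) : 1 < ln (3 : R).
Proof.
have h : 6^-1 <= ln (6 / 5 : R).
  have := @le_ln1Dx R (- 6^-1) ltac:(lra).
  rewrite (_ : 1 + - 6^-1 = (6 / 5)^-1 :> R); last by field.
  by rewrite lnV ?posrE ?divr_gt0// lerN2.
have : ln ((6 / 5) ^+ 6) < ln (3 : R).
  by rewrite ltr_ln ?posrE ?exprn_gt0 ?divr_gt0//; rewrite !exprS expr0; lra.
by rewrite ln_expr ?divr_gt0//; lra.
Qed.

Lemma log_bounds (R : realType) : exists2 c : R, 0 < c &
  forall n (l := trunc_log 2 n) (q := trunc_log 2 l), (3 <= n)%N ->
  [/\ 0 < ln (n%:R : R), ln (n%:R : R) <= 2 * l%:R & c * q.+1%:R <= ln (ln (n%:R : R))].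
Proof.
have /andP[ln2lo ln2hi] := ln2_bounds R; have ln3 := ln3_gt1 R.
have a0 : 0 < ln (ln (3 : R)) by rewrite ln_gt0.
(* The first value serves q <= 1, where q + 1 <= 2. For q >= 2, ln n >= l/2 >= 2^(q-1), so ln ln n
   >= (q - 1)/2 >= (q + 1)/6. *)
exists (Num.min (ln (ln 3) / 2) 6^-1); first by rewrite lt_min invr_gt0 divr_gt0//=.
move=> n l q n3.
have nR : 3 <= n%:R :> R by rewrite (ler_nat _ 3).
have n0 : 0 < n%:R :> R by lra.
have n0' : (0 < n)%N by exact: leq_trans n3.
have ln3n : ln 3 <= ln (n%:R : R) by rewrite ler_ln ?posrE.
have lnn0 : 0 < ln (n%:R : R) by lra.
have l1 : (1 <= l)%N by rewrite trunc_log_gt0 /= (leq_trans _ n3).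
have lR : 1 <= l%:R :> R by rewrite ler1n.
split=> //.
  have : ln (n%:R : R) <= ln (2 ^+ l.+1).
    rewrite ler_ln ?posrE ?exprn_gt0// -natrX ler_nat ltnW//; exact: trunc_log_ltn.
  rewrite ln_expr// -[l.+1%:R]natr1 => h; apply: le_trans h _.
  have : (l%:R + 1) * ln 2 <= (l%:R + 1) * 1 :> R by rewrite ler_wpM2l//; lra.
  lra.
have lnl : l%:R / 2 <= ln (n%:R : R).
  have : ln (2 ^+ l) <= ln (n%:R : R).
    by rewrite ler_ln ?posrE ?exprn_gt0// -natrX ler_nat; exact: trunc_logP.
  rewrite ln_expr//; have : l%:R * 2^-1 <= l%:R * ln 2 :> R by rewrite ler_wpM2l//; lra.
  lra.
have mono : ln (ln 3) <= ln (ln (n%:R : R)) by rewrite ler_ln ?posrE//; lra.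
case: (leqP 2 q) => q2; last first.
  apply: le_trans mono; apply: (@le_trans _ _ (ln (ln 3) / 2 * q.+1%:R)).
    by rewrite ler_wpM2r// ge_min lexx.
  have : q.+1%:R <= 2 :> R by rewrite (ler_nat _ _ 2).
  move=> h; have : ln (ln 3) / 2 * q.+1%:R <= ln (ln 3) / 2 * 2 :> R.
    by rewrite ler_wpM2l// divr_ge0// ltW.
  lra.
apply: (@le_trans _ _ (6^-1 * q.+1%:R)); first by rewrite ler_wpM2r// ge_min lexx orbT.
have qE : q = q.-1.+1 by rewrite prednK// ltnW.
have ql : (2 ^ q <= l)%N by exact: trunc_logP.
have hq : ln (2 ^+ q.-1) <= ln (ln (n%:R : R)).
  rewrite ler_ln ?posrE ?exprn_gt0//; apply: le_trans lnl.
  rewrite ler_pdivlMr// -exprSr -qE -natrX ler_nat//.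
rewrite ln_expr// in hq; apply: le_trans hq.
have hr : q.+1%:R = q.-1%:R + 2 :> R by rewrite {1}qE -!natr1; lra.
have q1 : 1 <= q.-1%:R :> R by rewrite ler1n; rewrite qE in q2.
have : q.-1%:R * 2^-1 <= q.-1%:R * ln 2 :> R by rewrite ler_wpM2l//; lra.
lra.
Qed.

(** * Amplification by repetition *)

(** (1 - p)(1 + p) <= 1, and Bernoulli's inequality bounds (1 + p)^N from below. With p = n^-19 and
    N = n^20 this is 1/(n + 1), without any use of the exponential. *)
Lemma inv_pow_bound (R : realFieldType) (p : R) N : 0 <= p -> p <= 1 ->
  (1 - p) ^+ N <= (1 + N%:R * p)^-1.
Proof.
move=> p0 p1.
have h := expr_bernoulli N p0.
have d0 : 0 < 1 + N%:R * p by rewrite ltr_pwDl// mulr_ge0.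
have q0 : 0 <= 1 - p by lra.
rewrite -[leRHS]mul1r ler_pdivlMr//; apply: le_trans (ler_wpM2l (exprn_ge0 N q0) h) _.
rewrite -exprMn; apply: exprn_ile1.
  by rewrite mulr_ge0// addr_ge0.
by have := sqr_ge0 p; rewrite expr2; lra.
Qed.

Lemma repeat_success (R : realFieldType) n A s m : (0 < n)%N -> invariant n A m ->
  (n ^ 19)%:R^-1 <= expect (attempt n A) (fun r => (accepted r && (s <= r.1)%N)%:R) :> R ->
  expect (den (p_repeat 20) m) (fails R s) <= n.+1%:R^-1.
Proof.
move=> n0 im hp.
have nR : 0 < (n ^ 19)%:R :> R by rewrite ltr0n expn_gt0 n0.
have p01 : 0 <= (n ^ 19)%:R^-1 :> R /\ (n ^ 19)%:R^-1 <= 1 :> R.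
  by split; [rewrite invr_ge0|rewrite invf_le1// ler1n expn_gt0 n0].
have [p0 p1] := p01.
apply: le_trans (repeat_fails 20 n0 im p1 hp) _.
apply: (@le_trans _ _ (1 * (1 - (n ^ 19)%:R^-1) ^+ (n ^ 20))).
  by rewrite ler_wpM2r ?exprn_ge0 ?subr_ge0// lern1 leq_b1.
rewrite mul1r; apply: le_trans (inv_pow_bound (n ^ 20) p0 p1) _.
by rewrite expnSr natrM mulrAC mulfV ?gt_eqF// mul1r -natr1 addrC.
Qed.

(** * The input graph and its optimal biclique *)

Lemma card_set_count n (P : pred nat) : #|[set i : 'I_n | P i]| = count P (iota 0 n).
Proof.
rewrite -val_enum_ord count_map cardsE cardE -size_filter /enum_mem.
by rewrite -filter_predI; congr size; apply: eq_filter => x; rewrite /= andbT.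

Qed.

Lemma card_set_mem n (S : seq nat) : valid n S -> #|[set i : 'I_n | (i : nat) \in S]| = size S.
Proof.
case/andP=> uS /allP Sn; rewrite card_set_count -size_filter; apply: perm_size.
apply: uniq_perm; rewrite ?filter_uniq ?iota_uniq// => x.
rewrite mem_filter mem_iota add0n leq0n.
by apply/andP/idP => [[]//|xS]; split; [|exact: Sn].
Qed.

Lemma input_bounded n (E : {set 'I_n * 'I_n}) : bounded n (input_mem E).
Proof.
split=> // -[|[|a]] i //=; first by case: ifP.
by case: [exists _ in _, _].
Qed.

Lemma input_adj n (E : {set 'I_n * 'I_n}) (u v : 'I_n) :
  (input_mem E 1 (u * n + v) != 0%N) = ((u, v) \in E).
Proof.
rewrite /= eqb0 negbK; apply/existsP/idP => [[[u' v'] /andP[eE /eqP /= h]]|eE]; last first.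
  by exists (u, v); rewrite eE /=.
have n0 : (0 < n)%N by exact: leq_ltn_trans (ltn_ord u).
have hu : u = u'.
  apply: val_inj; have := congr1 (divn^~ n) h.
  by rewrite /= !divnMDl// !divn_small// !addn0.
have hv : v = v' by apply: val_inj; move: h; rewrite hu => /addnI.
by rewrite hu hv.
Qed.

Lemma OPT_planted n (E : {set 'I_n * 'I_n}) : exists PA PB : pred nat,
  [/\ planted n (input_mem E 1) PA PB, count PA (iota 0 n) = OPT E &
      count PB (iota 0 n) = OPT E].
Proof.
pose P (k : 'I_n.+1) := [exists S, exists T, balanced_biclique E k S T].
have [|k Pk kE] := @eq_bigmax_cond _ P (fun k => k : nat).
  (* The empty biclique makes the range of the maximum nonempty, so that the maximum is attained. *)
  apply/card_gt0P; exists ord0; apply/existsP; exists finset.set0; apply/existsP; exists finset.set0.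
  by rewrite /balanced_biclique cards0 eqxx /=; apply/forall_inP => i; rewrite inE.
have -> : OPT E = k by rewrite -kE.
move: Pk => /existsP[S /existsP[T /and3P[/eqP cS /eqP cT /forall_inP h]]].
pose lift (X : {set 'I_n}) x := [exists i in X, val i == x].
have liftE X (i : 'I_n) : lift X i = (i \in X).
  apply/existsP/idP => [[j /andP[jX /eqP/val_inj <-]]//|iX].
  by exists i; rewrite iX /=.
have cE X : count (lift X) (iota 0 n) = #|X|.
  by rewrite -card_set_count; congr #|pred_of_set _|; apply/setP => i; rewrite inE liftE.
exists (lift S), (lift T); split; rewrite ?cE// => x v xn vn.
rewrite -[x]/(val (Ordinal xn)) -[v]/(val (Ordinal vn)) !liftE => xS vT.
by rewrite input_adj; exact: (forall_inP (h _ xS)).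
Qed.

Lemma input_invariant n (E : {set 'I_n * 'I_n}) : invariant n (input_mem E 1) (input_mem E).
Proof.
split=> //; first exact: input_bounded.
by exists [::], [::]; split.
Qed.

Lemma output_biclique n (E : {set 'I_n * 'I_n}) m w :
  invariant n (input_mem E 1) m ->
  balanced_biclique E (m BEST 0%N) (output_set n (State m w) 2) (output_set n (State m w) 3).
Proof.
case=> _ _ [S [T [/andP[vS vT] [sS sT] adj out]]].
have e2 : output_set n (State m w) 2 = [set i : 'I_n | (i : nat) \in S].
  by apply/setP => i; rewrite !inE; have [-> _] := out i (ltn_ord i).
have e3 : output_set n (State m w) 3 = [set i : 'I_n | (i : nat) \in T].
  by apply/setP => i; rewrite !inE; have [_ ->] := out i (ltn_ord i).
rewrite /balanced_biclique e2 e3 !card_set_mem// sS sT eqxx /=.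
apply/forall_inP => u; rewrite inE => uS; apply/forall_inP => v; rewrite inE => vT'.
by rewrite -input_adj; exact: adj.
Qed.

Local Open Scope classical_set_scope.

Theorem theorem1 (R : realType) :
  exists (C : R) (A : cmd) (time : nat -> nat) (eps : nat -> R),
    [/\ 0 < C,
        polynomially_bounded time,
        runs_in_time A time,
        eps @ \oo --> (0 : R) &
        forall (n : nat) (E : {set 'I_n * 'I_n}), (3 <= n)%N ->
          1 - eps n <=
          coin_prob R (time n) (fun w =>
            exists (S T : {set 'I_n}) (s : nat),
              [/\ outputs A E w S T,
                  balanced_biclique E s S T &
                  (OPT E)%:R <=
                  C * n%:R * (ln (ln n%:R) / ln n%:R) ^+ 3 * s%:R])].
Proof.
have [c c0 logs] := log_bounds R; have [K HK] := attempt_success R.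
(* [log_bounds] gives (q + 1)/l <= (2/c) * ln ln n / ln n, whence the cube in the constant; the
   successor of K makes it visibly positive. The failure probability is 1/(n + 1), the harmonic
   sequence. *)
exists (K.+1%:R * (2 / c) ^+ 3), (compile (p_repeat 20)), (tbound (p_repeat 20)), (@harmonic R).
split.
- by rewrite mulr_gt0// exprn_gt0// divr_gt0.
- exact: poly_tbound.
- move=> n E w; have [t [h1 h2]] := den_exec w wf_main (input_bounded E).
  by eexists; exists t; split; [exact: h1|].
- exact: cvg_harmonic.
move=> n E n3; have n0 : (0 < n)%N by exact: leq_trans n3.
set rho := ln (ln n%:R) / ln n%:R.
have [s hs hf] : exists2 s, (OPT E)%:R <= K.+1%:R * (2 / c) ^+ 3 * n%:R * rho ^+ 3 * s%:R &
    expect (den (p_repeat 20) (input_mem E)) (fails R s) <= n.+1%:R^-1.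
  (* Without edges no attempt needs to succeed: the empty output is optimal, and s = 0 is never
     missed. *)
  have [opt0|opt0] := posnP (OPT E).
    exists 0%N; first by rewrite opt0 mulr0.
    rewrite (@eq_expect _ _ _ _ (fun=> 0)); first by rewrite expect_cst invr_ge0.
    by move=> m; rewrite /fails ltn0.
  have [PA [PB [pl cA cB]]] := OPT_planted E.
  have [s hs hp] := HK n _ PA PB _ n3 pl cA cB opt0.
  exists s; last exact: repeat_success n0 (input_invariant E) hp.
  have [L0 Ll Mq] := logs n n3.
  move: hs Ll Mq; set l := trunc_log 2 n; set q := trunc_log 2 l => hs Ll Mq.
  have lR : 0 < l%:R :> R by lra.
  have rq : q.+1%:R / l%:R <= 2 / c * rho.
    rewrite ler_pdivrMr// (_ : _ * _ = 2 * l%:R * ln (ln n%:R) / (c * ln n%:R)); last first.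
      by rewrite /rho; field; rewrite !gt_eqF.
    rewrite ler_pdivlMr ?mulr_gt0// mulrCA mulrA mulrC.
    by apply: ler_pM; rewrite ?mulr_ge0// ltW.
  have rho3 : (q.+1%:R / l%:R) ^+ 3 <= (2 / c * rho) ^+ 3.
    by apply: lerXn2r => //; rewrite nnegrE; [|apply: le_trans rq]; rewrite divr_ge0.
  apply: (@le_trans _ _ (K%:R * n%:R * (q.+1%:R / l%:R) ^+ 3 * s%:R)).
    have : (OPT E * l ^ 3)%:R <= (K * n * q.+1 ^ 3 * s)%:R :> R by rewrite ler_nat.
    rewrite natrM natrX 2!natrM natrX natrM -ler_pdivlMr ?exprn_gt0// => h; apply: le_trans h _.
    by rewrite le_eqVlt; apply/orP; left; apply/eqP; rewrite expr_div_n; ring.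
  rewrite (_ : _ * rho ^+ 3 = K.+1%:R * n%:R * (2 / c * rho) ^+ 3); last by rewrite exprMn; ring.
  rewrite ler_wpM2r//; apply: ler_pM => //.
  - by rewrite mulr_ge0.
  - by rewrite exprn_ge0// divr_ge0.
  - by rewrite ler_wpM2r// ler_nat.
(* The event of reaching size s is determined by the run, whose number of tosses is at most the time
   bound, so its [coin_prob] is an expectation over the tree. *)
pose good m := ~~ (m BEST 0%N < s)%N.
apply: (@le_trans _ _ (coin_prob R (tbound (p_repeat 20) n)
    (fun w => good (run (den (p_repeat 20) (input_mem E)) w).1))).
  rewrite coin_prob_run; last exact: den_tosses wf_main (input_bounded E).
  rewrite (@eq_expect _ _ _ _ (fun m => 1 - fails R s m)); last first.
    by move=> m; rewrite /good /fails; case: (_ < _)%N; rewrite /= ?subrr ?subr0.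
  by rewrite expectB expect_cst lerD2l lerN2.
apply: ler_coin_prob => w gw.
have [t [h1 h2]] := den_exec w wf_main (input_bounded E).
have [im _] := rall_run w (repeat_invariant 20 n0 (input_invariant E)).
set m := (run _ w).1 in gw im h1 *; set w' := (run _ w).2 in h1 *.
exists (output_set n (State m w') 2), (output_set n (State m w') 3), (m BEST 0%N); split.
- by exists (State m w'), t.
- exact: output_biclique.
- apply: le_trans hs _; rewrite ler_wpM2l ?ler_nat 1?leqNgt//.
  have M0 : 0 <= ln (ln (n%:R : R)).
    by have [_ _ h] := logs n n3; apply: le_trans h; rewrite mulr_ge0// ltW.
  have [L0 _ _] := logs n n3.
  have c2 : 0 <= 2 / c by rewrite divr_ge0// ltW.
  have r0 : 0 <= rho by rewrite divr_ge0// ltW.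
  by rewrite mulr_ge0 ?exprn_ge0// mulr_ge0// mulr_ge0// exprn_ge0.
Qed.
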